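(* Let $g\in\mathrm{Hol}(\Omega)$, let $\varphi:\Omega\to\Omega$ be holomorphic with $\varphi(0)=0$, and assume that $\mu_{g,\varphi,2}$ is locally finite. Let $K$ be the Bergman kernel of $\Omega$. Then the following are equivalent: $$C_{g,\varphi}\in\mathcal S_2(A^2(\Omega))$$ and $$\int_{\{\varphi(z)\ne0\}}|g(z)|^2\delta(z)^2\left[R_w\overline{R_w}K(w,w)\right]_{w=\varphi(z)}\,dv(z)<\infty.$$ Moreover, the last integral is comparable to $\|C_{g,\varphi}\|_{\mathcal S_2}^2$.
   Context: $\Omega\subset\mathbb C^n$ ($n\ge1$) is a bounded convex domain with smooth ($C^\infty$) boundary of finite type, with $0\in\Omega$. $dv$ is Lebesgue volume measure and $\delta(z)=\mathrm{dist}(z,\partial\Omega)$. $A^2(\Omega)$ is the Hilbert space of holomorphic functions in $L^2(\Omega,dv)$, and $K(z,w)$ is its reproducing kernel. $Rf(z)=\sum_{k=1}^n z_k\partial_kf(z)$; in $R_w\overline{R_w}K(w,w)$, $R_w=\sum_kw_k\partial_{w_k}$ acts in the holomorphic variable and $\overline{R_w}=\sum_k\bar w_k\partial_{\bar w_k}$ in the antiholomorphic variable, evaluated on the diagonal. $\mathcal S_2$ is the Hilbert–Schmidt class. $C_{g,\varphi}f(z)=\int_0^1Rf(\varphi(tz))\,g(tz)\,\frac{dt}{t}$, first defined for $f$ holomorphic in a neighbourhood of $\overline\Omega$ (a dense subspace of $A^2(\Omega)$); when bounded, the same symbol denotes the unique bounded extension to $A^2(\Omega)$. $\mu_{g,\varphi,2}$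 is the positive Borel measure on $\Omega$ $$\mu_{g,\varphi,2}(E)=\int_{\varphi^{-1}(E\setminus\{0\})}|g(z)|^2\left(\frac{\delta(z)}{\delta(\varphi(z))}\right)^2 dv(z);$$ locally finite means finite on compact subsets of $\Omega$. ''Comparable'' means two-sided inequality up to positive constants depending only on $\Omega$ and fixed geometric parameters, not on $g$ or $\varphi$. *)

(* Defs.v *)
From HB Require Import structures.
From mathcomp Require Import all_boot all_order all_algebra.
From mathcomp Require Import all_classical all_reals all_analysis.
From mathcomp Require Import complex.
Set Implicit Arguments. Unset Strict Implicit. Unset Printing Implicit Defensive.
Import Order.TTheory GRing.Theory Num.Theory.
Import numFieldNormedType.Exports.
Local Open Scope classical_set_scope.
Local Open Scope ring_scope.


(* Topology of C given by the modulus.  real_closed does not export its R-module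
   structure on R[i], so the C-module structure below is the only one, and
   [differentiable], ['D_v] over R[i] are complex differentiability. *)
HB.instance Definition _ (R : realType) := NormedModule.copy R[i] R[i]^o.

(* The library also registers a sub-probability instance on [m1 \x m2] which
   hides its sigma-finiteness, hence this copy. *)
Section sigma_finite_product.
Context d1 d2 (T1 : measurableType d1) (T2 : measurableType d2) (R : realType).
Variables (m1 : {sigma_finite_measure set T1 -> \bar R})
          (m2 : {sigma_finite_measure set T2 -> \bar R}).

Definition product_sigma_finite : set (T1 * T2) -> \bar R := (m1 \x m2)%E.

HB.instance Definition _ := Measure.on product_sigma_finite.

Let product_sigma_finiteT : sigma_finite setT product_sigma_finite.
Proof.
have /sigma_finiteP[F [TF ndF Foo]] := sigma_finiteT m1.
have /sigma_finiteP[G [TG ndG Goo]] := sigma_finiteT m2.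
exists (fun n => F n `*` G n).
  rewrite -setXTT TF TG predeqE => -[x y]; split.
    move=> [/= [n _ Fnx] [k _ Gky]]; exists (maxn n k) => //; split.
    - by move: x Fnx; exact/subsetPset/ndF/leq_maxl.
    - by move: y Gky; exact/subsetPset/ndG/leq_maxr.
  by move=> [n _ []/= ? ?]; split; exists n.
move=> k; have [? ?] := Foo k; have [? ?] := Goo k.
split; first exact: measurableX.
rewrite /product_sigma_finite product_measure1E// lte_mul_pinfty//.
by rewrite ge0_fin_numE.
Qed.

HB.instance Definition _ := Measure_isSigmaFinite.Build _ _ _
  product_sigma_finite product_sigma_finiteT.

End sigma_finite_product.

Section tuple_measure_step.
Context d (T : measurableType d) (R : realType) (n : nat).
Variables (m : {sigma_finite_measure set T -> \bar R})
          (mu : {sigma_finite_measure set (n.-tuple T) -> \bar R}).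

Definition tuple_cons (p : T * n.-tuple T) : n.+1.-tuple T :=
  cons_tuple p.1 p.2.

Lemma measurable_tuple_cons :
  measurable_fun [set: T * n.-tuple T] tuple_cons.
Proof. exact: (measurable_cons measurable_fst measurable_snd). Qed.

Definition tuple_measure_step : set (n.+1.-tuple T) -> \bar R :=
  pushforward (product_sigma_finite m mu) tuple_cons.

Let step0 : tuple_measure_step set0 = 0%E.
Proof. by rewrite /tuple_measure_step /pushforward preimage_set0 measure0. Qed.

Let step_ge0 A : (0 <= tuple_measure_step A)%E.
Proof. exact: (measure_ge0 (product_sigma_finite m mu)). Qed.

Let step_sigma_additive : semi_sigma_additive tuple_measure_step.
Proof. exact: (@measure_semi_sigma_additive _ _ _
  (measure_function_pushforward__canonical__measure_function_Measure
     (product_sigma_finite m mu) measurable_tuple_cons)). Qed.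

HB.instance Definition _ := isMeasure.Build _ _ _
  tuple_measure_step step0 step_ge0 step_sigma_additive.

Let step_sigma_finite : sigma_finite setT tuple_measure_step.
Proof.
have [F FT mF] := sigma_finiteT (product_sigma_finite m mu).
exists (fun i => [set t : n.+1.-tuple T | F i (thead t, [tuple of behead t])]).
  apply/esym; rewrite -subTset => t _.
  have : setT (thead t, [tuple of behead t]) by [].
  by rewrite FT => -[i _ Fi]; exists i.
move=> i; have [mFi Fioo] := mF i; split.
  have mf : measurable_fun [set: n.+1.-tuple T]
      (fun t : n.+1.-tuple T => (thead t, [tuple of behead t])).
    apply/measurable_fun_pairP; split => /=.
      exact: (measurable_tnth ord0).
    exact: measurable_behead.
  by rewrite -[X in measurable X]setTI; exact: mf.
rewrite /tuple_measure_step /pushforward /=.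
rewrite [X in (_ X < _)%E](_ : _ = F i)//.
apply/seteqP; split => -[x t] /=;
  by rewrite /tuple_cons theadE (_ : [tuple of _] = t)//; exact: val_inj.
Qed.

HB.instance Definition _ := Measure_isSigmaFinite.Build _ _ _
  tuple_measure_step step_sigma_finite.

End tuple_measure_step.


Section lebesgue_Cn.
Variable R : realType.

Definition plane := (measurableTypeR R * measurableTypeR R)%type.

Definition lebesgue_plane : {sigma_finite_measure set plane -> \bar R} :=
  product_sigma_finite (@lebesgue_measure R) (@lebesgue_measure R).

Fixpoint lebesgue_tuple (n : nat) :
    {sigma_finite_measure set (n.-tuple plane) -> \bar R} :=
  if n is k.+1 then tuple_measure_step lebesgue_plane (lebesgue_tuple k)
  else \d_([tuple] : 0.-tuple plane).

(* The point of C^n with real coordinates (x_1, y_1), ..., (x_n, y_n).  It is a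
   homeomorphism; integrals over C^n are taken in these coordinates. *)
Definition point_of n (x : n.-tuple plane) : 'rV[R[i]]_n :=
  \row_k ((tnth x k).1 +i* (tnth x k).2)%C.

Definition vintegral n (D : set 'rV[R[i]]_n) (f : 'rV[R[i]]_n -> \bar R) :
    \bar R :=
  (\int[lebesgue_tuple n]_(x in @point_of n @^-1` D) f (point_of x))%E.

Definition vCintegral n (D : set 'rV[R[i]]_n) (f : 'rV[R[i]]_n -> R[i]) : R[i] :=
  (Rintegral (lebesgue_tuple n) (@point_of n @^-1` D)
     (fun x => complex.Re (f (point_of x)))
   +i* Rintegral (lebesgue_tuple n) (@point_of n @^-1` D)
     (fun x => complex.Im (f (point_of x))))%C.

End lebesgue_Cn.

Notation cmod := Normc.normc.

Section geometry.
Variables (R : realType) (n : nat).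
Local Notation C := R[i].
Local Notation Cn := 'rV[R[i]]_n.+1.

(* The norm `|z| of the library on row vectors is the max-norm; distances are
   measured with the Euclidean one. *)
Definition euclid_norm (z : Cn) : R := Num.sqrt (\sum_k cmod (z ord0 k) ^+ 2).

Definition bdry (Omega : set Cn) : set Cn := closure Omega `\` interior Omega.

Definition delta (Omega : set Cn) (z : Cn) : R :=
  inf [set euclid_norm (z - w) | w in bdry Omega].

Definition real_line (f : Cn -> R) (p v : Cn) : R -> R :=
  fun t => f (p + (t%:C)%C *: v).

Definition real_derive (f : Cn -> R) (v p : Cn) : R := derive1 (real_line f p v) 0.

(* Functions of class C^k on C^n = R^2n, through iterated directional
   derivatives along all real directions. *)
Fixpoint class_C (k : nat) (f : Cn -> R) : Prop :=
  continuous f /\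
  if k is j.+1 then
    (forall v p, derivable (real_line f p v) 0 1) /\
    (forall v, class_C j (real_derive f v))
  else True.

Definition smooth (f : Cn -> R) : Prop := forall k, class_C k f.

Definition defining_function (Omega : set Cn) (r : Cn -> R) : Prop :=
  [/\ smooth r, Omega = [set z | r z < 0] &
      forall p, bdry Omega p -> exists v, real_derive r v p != 0].

(* ord_0 h >= k, i.e. all derivatives of order < k vanish, for h smooth or the
   norm of a smooth map. *)
Definition vanishes_to_order (h : C -> R) (k : nat) : Prop :=
  exists A : R, \forall x \near (0 : C), `|h x| <= A * cmod x ^+ k.

(* Finite D'Angelo type at p: over all nonconstant germs gamma of holomorphic
   discs with gamma 0 = p, the orders of contact
   ord_0 (r \o gamma) / ord_0 (gamma - p) are bounded.
   Here m = ord_0 (gamma - p). *)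
Definition finite_type_at (r : Cn -> R) (p : Cn) : Prop :=
  exists M : nat, forall (gamma : C -> Cn) (m k : nat),
    (\forall x \near (0 : C), differentiable gamma x) -> gamma 0 = p ->
    vanishes_to_order (fun x => euclid_norm (gamma x - p)) m ->
    ~ vanishes_to_order (fun x => euclid_norm (gamma x - p)) m.+1 ->
    vanishes_to_order (fun x => r (gamma x)) k ->
    (k <= M * m)%N.

Definition smooth_finite_type_boundary (Omega : set Cn) : Prop :=
  exists2 r, defining_function Omega r &
    forall p, bdry Omega p -> finite_type_at r p.

End geometry.

Section bergman.
Variables (R : realType) (n : nat).
Local Notation C := R[i].
Local Notation Cn := 'rV[R[i]]_n.+1.
Implicit Types (Omega : set Cn) (f h g : Cn -> C) (phi : Cn -> Cn).

Definition holomorphic_on (W : normedModType C) (U : set Cn) (f : Cn -> W) :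
  Prop := forall z, U z -> differentiable f z.

Definition sqnorm Omega f : \bar R :=
  vintegral Omega (fun z => (cmod (f z) ^+ 2)%:E).

Definition inner Omega f h : C := vCintegral Omega (fun z => f z * (h z)^*%C).

(* Elements of A^2(Omega) are represented by functions on C^n; only their
   values on Omega matter. *)
Definition A2 Omega : set (Cn -> C) :=
  [set f | holomorphic_on Omega f /\ (sqnorm Omega f < +oo)%E].

Definition bergman_kernel Omega (K : Cn -> Cn -> C) : Prop :=
  forall w, Omega w ->
    A2 Omega (K ^~ w) /\
    (forall f, A2 Omega f -> f w = inner Omega f (K ^~ w)).

Definition radial f (z : Cn) : C :=
  \sum_k z ord0 k * 'D_(delta_mx ord0 k) f z.

(* d/d(conj w_k) = (d/dx_k + i d/dy_k) / 2 *)
Definition dbar (k : 'I_n.+1) f (w : Cn) : C :=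
  let D v := (real_derive (fun z => complex.Re (f z)) v w
              +i* real_derive (fun z => complex.Im (f z)) v w)%C in
  (D (delta_mx ord0 k) + 'i%C * D ('i%C *: delta_mx ord0 k)) / 2%:R.

Definition radial_bar f (w : Cn) : C := \sum_k (w ord0 k)^*%C * dbar k f w.

(* The first variable of K is the holomorphic one.  On the diagonal the value
   for the Bergman kernel is a nonnegative real. *)
Definition radial_radial_bar (K : Cn -> Cn -> C) (w : Cn) : R :=
  complex.Re (radial (fun z => radial_bar (K z) w) w).

Definition orthonormal_basis Omega (e : nat -> Cn -> C) : Prop :=
  [/\ forall k, A2 Omega (e k),
      forall j k, inner Omega (e j) (e k) = (j == k)%:R &
      forall f, A2 Omega f ->
        (fun m : nat => sqnorm Omega
           (fun z => f z - \sum_(k < m) inner Omega f (e k) * e k z))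
        @ \oo --> (0 : \bar R)%E].

Definition bounded_operator Omega (T : (Cn -> C) -> Cn -> C) : Prop :=
  [/\ forall f, A2 Omega f -> A2 Omega (T f),
      forall (a : C) f h z, A2 Omega f -> A2 Omega h -> Omega z ->
        T (fun w => a * f w + h w) z = a * T f z + T h z &
      exists M : R, forall f, A2 Omega f ->
        (sqnorm Omega (T f) <= M%:E * sqnorm Omega f)%E].

(* \sum_k ||T e_k||^2, which is ||T||_{S_2}^2 when e is an orthonormal basis *)
Definition hs_sqnorm Omega (e : nat -> Cn -> C) (T : (Cn -> C) -> Cn -> C) :
  \bar R := (\sum_(0 <= k <oo) sqnorm Omega (T (e k)))%E.

Definition hilbert_schmidt Omega (T : (Cn -> C) -> Cn -> C) : Prop :=
  bounded_operator Omega T /\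
  exists2 e, orthonormal_basis Omega e & (hs_sqnorm Omega e T < +oo)%E.

(* The defining integral of C_{g,phi} f, for f holomorphic near the closure of
   Omega. *)
Definition volterra g phi f (z : Cn) : C :=
  let F (t : R) : C :=
    radial f (phi ((t%:C)%C *: z)) * g ((t%:C)%C *: z) / (t%:C)%C in
  (Rintegral lebesgue_measure `[0%R, 1%R] (fun t => complex.Re (F t))
   +i* Rintegral lebesgue_measure `[0%R, 1%R] (fun t => complex.Im (F t)))%C.

(* Such a T is unique up to values off Omega, by density. *)
Definition volterra_extension Omega g phi (T : (Cn -> C) -> Cn -> C) : Prop :=
  bounded_operator Omega T /\
  forall (U : set Cn) f, open U -> closure Omega `<=` U -> holomorphic_on U f ->
    forall z, Omega z -> T f z = volterra g phi f z.

Definition volterra_in_S2 Omega g phi : Prop :=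
  exists2 T, volterra_extension Omega g phi T & hilbert_schmidt Omega T.

Definition mu2 Omega g phi (E : set Cn) : \bar R :=
  vintegral [set z | Omega z /\ (E `\` [set 0]) (phi z)]
    (fun z => (cmod (g z) ^+ 2 * (delta Omega z / delta Omega (phi z)) ^+ 2)%:E).

Definition locally_finite_on Omega (mu : set Cn -> \bar R) : Prop :=
  forall E, compact E -> E `<=` Omega -> (mu E < +oo)%E.

Definition kernel_integral Omega (K : Cn -> Cn -> C) g phi : \bar R :=
  vintegral [set z | Omega z /\ phi z <> 0]
    (fun z => (cmod (g z) ^+ 2 * delta Omega z ^+ 2 *
               radial_radial_bar K (phi z))%:E).

End bergman.

(* Main.v *)
Require Import Defs.
From HB Require Import structures.
From mathcomp Require Import all_boot all_order all_algebra.
From mathcomp Require Import all_classical all_reals all_analysis.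
From mathcomp Require Import complex.
From mathcomp Require Import measurable_realfun ring lra.
Set Implicit Arguments. Unset Strict Implicit. Unset Printing Implicit Defensive.
Import Order.TTheory GRing.Theory Num.Theory.
Import numFieldNormedType.Exports.
Local Open Scope classical_set_scope.
Local Open Scope ring_scope.

(** The heart of the matter is a Littlewood-Paley equivalence: for [h] holomorphic
    on [Omega] with [h 0 = 0], the squared norm of [h] in the Bergman space is
    comparable to the integral of [dist^2 |R h|^2], where [R] is the radial
    derivative and [dist] is a distance to the complement of [Omega], comparable
    to [delta].

    The Volterra integral of [f] is the primitive of [(R f \o phi) g] along rays
    that vanishes at the origin ([volterra_primitive]), and every bounded extension
    [T] keeps the identity [R (T f) = (R f \o phi) g] on the whole space, by
    density of dilates ([radial_extension]).  So the squared norm of [T (e k)] is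
    comparable to the integral of [dist^2 |g|^2 |R (e k) \o phi|^2].  When this is
    summed over an orthonormal basis ([sqsum_integral], [hs_comparable]), the sum of
    the [|R (e k) (w)|^2] appears: it is the squared norm of the functional
    [f |-> R f (w)], which is [radial_radial_bar K w] since [K] represents point
    evaluations ([kernel_radial]).  When the integral is finite, the same
    functionals bound the operator ([volterra_bounded]), and the basis in which to
    compute its Hilbert-Schmidt norm comes from Gram-Schmidt applied to kernel
    functions ([basis_exists]).

    As for the equivalence, the mean value inequality and Cauchy's estimate on a
    box of size comparable to [dist z] bound [dist^2 |R h|^2] at [z] by the mean of
    [|h|^2] over the box; integrating over [z] gives [lp_lower].  The converse
    [lp_upper] uses convexity: [dist (t z) >= t dist z + (1 - t) dist 0].  When
    the integral of [dist |u|^2] is compared with that of its dilate by [t], to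
    first order in [1 - t], the last term yields a Hardy inequality ([hardy]),
    which bounds the integral of [|u|^2] by those of [dist |u|^2] and of
    [dist |u| |R u|].  The second one is split by Cauchy-Schwarz into a small
    multiple of the integral of [|u|^2], which is absorbed, and one of
    [dist^2 |R u|^2].  The first one is absorbed near the boundary, and in the
    interior [u] is recovered by integrating [R u] along rays ([interior_bound]).
    This is done for functions smooth up to the boundary, such as dilates of [h],
    and Fatou's lemma gives the general case.

    The function theory rests on Goursat's theorem for rectangles.  For a function
    averaged over the four rotations by right angles, the Cauchy integral around a
    square reduces to a real integral over one side; this gives both Cauchy's
    estimate and the mean value inequality, and from the former follow Taylor's
    formula with remainder and Weierstrass's theorem on limits. *)

(** * Integrals over segments and Goursat's theorem *)

Section interval_integral.
Variable R : realType.
Implicit Types (f g : R -> R) (a b c : R).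

Definition cts_on a b f := forall x, a <= x <= b -> {for x, continuous f}.

Definition int_itv a b f : R := Rintegral lebesgue_measure `[a, b] f.

Lemma cts_on_sub a b c d f : cts_on a b f -> a <= c -> d <= b -> cts_on c d f.
Proof. by move=> cf ac db x /andP[cx xd]; apply: cf; lra. Qed.

Lemma cts_on_integrable a b f : cts_on a b f ->
  lebesgue_measure.-integrable `[a, b] (EFin \o f).
Proof.
move=> cf; apply: continuous_compact_integrable; first exact: segment_compact.
by apply: continuous_in_subspaceT => x /set_mem/=; rewrite in_itv/=; apply: cf.
Qed.

Lemma int_itv_split a b c f : a <= c -> c <= b -> cts_on a b f ->
  int_itv a b f = int_itv a c f + int_itv c b f.
Proof.
move=> ac cb cf; rewrite /int_itv.
have := @Rintegral_itvB R f (BLeft a) (BRight b) c (cts_on_integrable cf).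
rewrite !bnd_simp => /(_ ac cb).
rewrite (@Rintegral_itv_obnd_cbnd R c (BRight b) f); first by move=> <-; ring.
apply: integrableS (cts_on_integrable cf) => //.
by apply: subset_itvr; rewrite bnd_simp.
Qed.

Lemma int_itv_cst a b (k : R) : a <= b -> int_itv a b (fun=> k) = k * (b - a).
Proof.
move=> ab; rewrite /int_itv Rintegral_cst//= lebesgue_measure_itv/=.
case: ifP => //=; rewrite lte_fin => /negbT; rewrite -leNgt => ba.
by rewrite (_ : a = b) ?subrr//; apply/le_anti; rewrite ab ba.
Qed.

Lemma cts_onB a b f g : cts_on a b f -> cts_on a b g -> cts_on a b (f \- g).
Proof. by move=> cf cg x xab; apply: cvgB; [exact: cf|exact: cg]. Qed.

Lemma cts_on_cst a b (k : R) : cts_on a b (fun=> k).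
Proof. by move=> x _; exact: cvg_cst. Qed.

Lemma int_itvB a b f g : cts_on a b f -> cts_on a b g ->
  int_itv a b (f \- g) = int_itv a b f - int_itv a b g.
Proof.
by move=> cf cg; rewrite /int_itv RintegralB//; exact: cts_on_integrable.
Qed.

Lemma le_int_itv a b f g : cts_on a b f -> cts_on a b g ->
  (forall x, a <= x <= b -> f x <= g x) -> int_itv a b f <= int_itv a b g.
Proof.
by move=> cf cg fg; apply: le_Rintegral => //; exact: cts_on_integrable.
Qed.

Lemma int_itv_bound a b f (M : R) : a <= b -> cts_on a b f ->
  (forall x, a <= x <= b -> `|f x| <= M) -> `|int_itv a b f| <= M * (b - a).
Proof.
move=> ab cf fM; rewrite ler_norml -mulNr -!int_itv_cst//; apply/andP; split;
  apply: le_int_itv => // [|x /fM]; try exact: cts_on_cst;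
  by rewrite ler_norml => /andP[].
Qed.

Lemma eq_int_itv a b f g : (forall x, a <= x <= b -> f x = g x) ->
  int_itv a b f = int_itv a b g.
Proof.
move=> fg; apply: eq_Rintegral => x /set_mem/=; rewrite in_itv/=; exact: fg.
Qed.

Lemma int_itv_opp a b f : a <= b -> cts_on (- b) (- a) f ->
  int_itv (- b) (- a) f = int_itv a b (fun x => f (- x)).
Proof.
move=> ab cf; congr fine; apply: integration_by_substitution_oppr => //.
by apply: continuous_in_subspaceT => x /set_mem/=; rewrite in_itv/=; apply: cf.
Qed.

End interval_integral.

Section goursat.
Variables (R : realType) (P Q : R -> R -> R).

(** Both components are affine to first order at the point, and the crossed
    coefficient [m] is shared: this says that [P dx + Q dy] is closed there. *)
Definition closed_form_at (x0 y0 : R) := exists p m q : R,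
  forall eps : R, 0 < eps -> exists2 del : R, 0 < del & forall x y,
    `|x - x0| < del -> `|y - y0| < del ->
    `|P x y - P x0 y0 - p * (x - x0) - m * (y - y0)|
       <= eps * (`|x - x0| + `|y - y0|) /\
    `|Q x y - Q x0 y0 - m * (x - x0) - q * (y - y0)|
       <= eps * (`|x - x0| + `|y - y0|).

(** The integral of [P dx + Q dy] around the rectangle [[a, b] x [c, d]]. *)
Definition boundary_integral (a b c d : R) : R :=
  (int_itv c d (Q b) - int_itv c d (Q a))
  - (int_itv a b (P ^~ d) - int_itv a b (P ^~ c)).

Let cts_lin (f : R -> R) (x0 k : R) :
  (forall eps : R, 0 < eps -> exists2 del : R, 0 < del & forall x,
    `|x - x0| < del -> `|f x - f x0 - k * (x - x0)| <= eps * `|x - x0|) ->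
  {for x0, continuous f}.
Proof.
move=> H; apply/cvgrPdist_lt => e e0.
have [del del0 Hd] := H 1 ltr01.
near=> x.
have k0 : 0 < 1 + `|k| by rewrite ltr_pwDl.
have xd : `|x - x0| < del.
  by rewrite distrC; near: x; exact: cvgr_dist_lt.
have xe : `|x - x0| < e / (1 + `|k|).
  rewrite distrC; near: x; apply: cvgr_dist_lt; last exact: divr_gt0.
  exact: cvg_id.
rewrite distrC.
have -> : f x - f x0 = (f x - f x0 - k * (x - x0)) + k * (x - x0) by ring.
apply: le_lt_trans (ler_normD _ _) _; rewrite normrM.
apply: (@le_lt_trans _ _ (`|x - x0| * (1 + `|k|))).
  have := Hd _ xd; rewrite mul1r; lra.
by rewrite -ltr_pdivlMr.
Unshelve. all: by end_near. Qed.

Lemma closed_form_ctsx x0 y0 : closed_form_at x0 y0 ->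
  {for x0, continuous (P ^~ y0)} /\ {for x0, continuous (Q ^~ y0)}.
Proof.
move=> [p [m [q H]]]; split; [apply: (@cts_lin _ _ p)|apply: (@cts_lin _ _ m)];
  move=> e /H[del d0 Hd]; exists del => // x xd;
  have := Hd x y0 xd; rewrite subrr normr0 !mulr0 !subr0 addr0; case=> //.
Qed.

Lemma closed_form_ctsy x0 y0 : closed_form_at x0 y0 ->
  {for y0, continuous (P x0)} /\ {for y0, continuous (Q x0)}.
Proof.
move=> [p [m [q H]]]; split; [apply: (@cts_lin _ _ m)|apply: (@cts_lin _ _ q)];
  move=> e /H[del d0 Hd]; exists del => // x xd;
  have := Hd x0 x; rewrite subrr normr0 !mulr0 !subr0 add0r; case=> //.
Qed.

Definition closed_form_on a b c d :=
  forall x y, a <= x <= b -> c <= y <= d -> closed_form_at x y.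

Lemma closed_form_cts a b c d : closed_form_on a b c d ->
  (forall y, c <= y <= d -> cts_on a b (P ^~ y)) /\
  (forall x, a <= x <= b -> cts_on c d (Q x)).
Proof.
move=> H; split=> [y yi x xi|x xi y yi].
- exact: (closed_form_ctsx (H x y xi yi)).1.
- exact: (closed_form_ctsy (H x y xi yi)).2.
Qed.

Lemma boundary_integral_splitx a b c d u : closed_form_on a b c d -> c <= d ->
  a <= u <= b -> boundary_integral a b c d =
    boundary_integral a u c d + boundary_integral u b c d.
Proof.
move=> H cd /andP[au ub]; have [HP HQ] := closed_form_cts H.
rewrite /boundary_integral (@int_itv_split _ a b u (P ^~ d))//; last by apply: HP; lra.
rewrite (@int_itv_split _ a b u (P ^~ c))//; last by apply: HP; lra.
ring.
Qed.

Lemma boundary_integral_splity a b c d v : closed_form_on a b c d -> a <= b ->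
  c <= v <= d -> boundary_integral a b c d =
    boundary_integral a b c v + boundary_integral a b v d.
Proof.
move=> H ab /andP[cv vd]; have [HP HQ] := closed_form_cts H.
rewrite /boundary_integral (@int_itv_split _ c d v (Q a))//; last by apply: HQ; lra.
rewrite (@int_itv_split _ c d v (Q b))//; last by apply: HQ; lra.
ring.
Qed.

(** To first order around a point the form is exact, so its integral around a
    small rectangle is negligible with respect to the squared size. *)
Lemma boundary_integral_small x0 y0 eps : closed_form_at x0 y0 -> 0 < eps ->
  exists2 del : R, 0 < del & forall a b c d, closed_form_on a b c d ->
    a <= x0 <= b -> c <= y0 <= d -> b - a < del -> d - c < del ->
    `|boundary_integral a b c d| <= 2 * eps * ((b - a) + (d - c)) ^+ 2.
Proof.
move=> [p [m [q H]]] e0; have [del d0 Hd] := H _ e0.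
exists del => // a b c d Hc /andP[ax xb] /andP[cy yd] bad dcd.
have [HP HQ] := closed_form_cts Hc.
have ab : a <= b by lra.
have cd : c <= d by lra.
have [ai bi] : a <= a <= b /\ a <= b <= b by rewrite ab !lexx.
have [ci di] : c <= c <= d /\ c <= d <= d by rewrite cd !lexx.
set l := (b - a) + (d - c).
have near_ x y : a <= x <= b -> c <= y <= d ->
    [/\ `|x - x0| < del, `|y - y0| < del & `|x - x0| + `|y - y0| <= l].
  move=> /andP[ax' xb'] /andP[cy' yd'].
  have h1 : `|x - x0| <= b - a by rewrite ler_norml; clear -ax xb ax' xb'; lra.
  have h2 : `|y - y0| <= d - c by rewrite ler_norml; clear -cy yd cy' yd'; lra.
  by split; [exact: le_lt_trans h1 bad|exact: le_lt_trans h2 dcd|exact: lerD].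
have EQ y : c <= y <= d -> `|Q b y - Q a y - m * (b - a)| <= 2 * eps * l.
  move=> yi.
  have [b1 b2 b3] := near_ b y bi yi; have [a1 a2 a3] := near_ a y ai yi.
  have [_ hb] := Hd _ _ b1 b2; have [_ ha] := Hd _ _ a1 a2.
  have {}b3 := ler_wpM2l (ltW e0) b3; have {}a3 := ler_wpM2l (ltW e0) a3.
  have {}hb := le_trans hb b3; have {}ha := le_trans ha a3.
  move: hb ha; rewrite !ler_norml; clear; move=> /andP[? ?] /andP[? ?]; lra.
have EP x : a <= x <= b -> `|P x d - P x c - m * (d - c)| <= 2 * eps * l.
  move=> xi.
  have [b1 b2 b3] := near_ x d xi di; have [a1 a2 a3] := near_ x c xi ci.
  have [hb _] := Hd _ _ b1 b2; have [ha _] := Hd _ _ a1 a2.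
  have {}b3 := ler_wpM2l (ltW e0) b3; have {}a3 := ler_wpM2l (ltW e0) a3.
  have {}hb := le_trans hb b3; have {}ha := le_trans ha a3.
  move: hb ha; rewrite !ler_norml; clear; move=> /andP[? ?] /andP[? ?]; lra.
have cQ x : a <= x <= b -> cts_on c d (Q x) by apply: HQ.
have cP y : c <= y <= d -> cts_on a b (P ^~ y) by apply: HP.
have cQa : cts_on c d (Q a) by exact: cQ.
have cQb : cts_on c d (Q b) by exact: cQ.
have cPc : cts_on a b (P ^~ c) by exact: cP.
have cPd : cts_on a b (P ^~ d) by exact: cP.
have cm u v k : @cts_on R u v (fun=> k) by exact: cts_on_cst.
have cQm := cts_onB (cts_onB cQb cQa) (cm c d (m * (b - a))).
have cPm := cts_onB (cts_onB cPd cPc) (cm a b (m * (d - c))).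
have -> : boundary_integral a b c d =
    int_itv c d ((Q b \- Q a) \- fun=> m * (b - a))
    - int_itv a b ((P ^~ d \- P ^~ c) \- fun=> m * (d - c)).
  rewrite /boundary_integral.
  rewrite (int_itvB (cts_onB cQb cQa) (cm _ _ _)) (int_itvB cQb cQa).
  rewrite (int_itvB (cts_onB cPd cPc) (cm _ _ _)) (int_itvB cPd cPc).
  rewrite !int_itv_cst//; ring.
apply: le_trans (ler_normB _ _) _.
have -> : 2 * eps * l ^+ 2 = 2 * eps * l * (d - c) + 2 * eps * l * (b - a).
  by rewrite /l; ring.
apply: lerD; [exact: (int_itv_bound cd cQm)|exact: (int_itv_bound ab cPm)].
Qed.

(** Bisection: [u k] is the left end of the half kept at step [k]. *)
Lemma nested_corner (u : nat -> R) (w : R) : 0 <= w ->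
  (forall n, u n.+1 = u n \/ u n.+1 = u n + w / 2 ^+ n.+1) ->
  exists x0 : R, forall n, u n <= x0 <= u n + w / 2 ^+ n.
Proof.
move=> w0 hu.
have wn n : w / 2 ^+ n.+1 + w / 2 ^+ n.+1 = w / 2 ^+ n.
  by rewrite exprS; field; rewrite expf_neq0.
have wp n : 0 <= w / 2 ^+ n by rewrite divr_ge0// exprn_ge0.
have up n : u n <= u n.+1 by case: (hu n) => ->; have := wp n.+1; lra.
have dn n : u n.+1 + w / 2 ^+ n.+1 <= u n + w / 2 ^+ n.
  by rewrite -(wn n); case: (hu n) => ->; have := wp n.+1; lra.
have upm n k : u n <= u (n + k)%N.
  by elim: k => [|k IH]; rewrite ?addn0// addnS (le_trans IH).
have dnm n k : u (n + k)%N + w / 2 ^+ (n + k) <= u n + w / 2 ^+ n.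
  by elim: k => [|k IH]; rewrite ?addn0// addnS (le_trans (dn _)).
have ub n k : u k <= u n + w / 2 ^+ n.
  have [nk|/ltnW kn] := leqP n k.
  - by rewrite -(subnKC nk) (le_trans _ (dnm n (k - n)%N))// lerDl.
  - by rewrite (@le_trans _ _ (u n))// ?lerDl// -(subnKC kn) upm.
exists (sup (range u)) => n; apply/andP; split.
- apply: sup_upper_bound; last by exists n.
  by split; [exists (u 0%N); exists 0%N|exists (u 0%N + w / 2 ^+ 0) => _ [k _ <-]].
- by apply: ge_sup; [exists (u 0%N); exists 0%N|move=> _ [k _ <-]].
Qed.

(** Goursat: if the integral exceeded [eps] times the squared size of the
    rectangle, so would it for one of the four quarters, and so on; the nested
    quarters shrink to a point where the previous estimate is violated. *)
Theorem goursat a b c d : a <= b -> c <= d -> closed_form_on a b c d ->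
  boundary_integral a b c d = 0.
Proof.
move=> ab cd H; apply/eqP; rewrite -normr_eq0; apply/eqP; apply/le_anti.
rewrite normr_ge0 andbT leNgt; apply/negP => E0.
set E := `|_| in E0.
pose l := (b - a) + (d - c).
(* The rectangle with corner (x, y) left after n bisections in each direction
   carries at least its share E / 4 ^ n of the integral. *)
pose bad (n : nat) (x y : R) := [/\ a <= x, x + (b - a) / 2 ^+ n <= b,
   c <= y, y + (d - c) / 2 ^+ n <= d &
   E / 4 ^+ n <= `|boundary_integral x (x + (b - a) / 2 ^+ n)
     y (y + (d - c) / 2 ^+ n)|].
have wn (w : R) n : w / 2 ^+ n.+1 + w / 2 ^+ n.+1 = w / 2 ^+ n.
  by rewrite exprS; field; rewrite expf_neq0.
have wp (w : R) n : 0 <= w -> 0 <= w / 2 ^+ n.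
  by move=> w0; rewrite divr_ge0// exprn_ge0.
have step n x y : bad n x y -> exists x' y', [/\ bad n.+1 x' y',
    x' = x \/ x' = x + (b - a) / 2 ^+ n.+1 &
    y' = y \/ y' = y + (d - c) / 2 ^+ n.+1].
  case; set bx := (b - a) / 2 ^+ n; set dy := (d - c) / 2 ^+ n.
  move=> ax xb cy yd Eb; apply: contrapT => nex.
  set hx := (b - a) / 2 ^+ n.+1; set hy := (d - c) / 2 ^+ n.+1.
  have hx2 : hx + hx = bx by exact: wn.
  have hy2 : hy + hy = dy by exact: wn.
  have hx0 : 0 <= hx by apply: wp; lra.
  have hy0 : 0 <= hy by apply: wp; lra.
  have small x' y' : x' = x \/ x' = x + hx -> y' = y \/ y' = y + hy ->
      `|boundary_integral x' (x' + hx) y' (y' + hy)| < E / 4 ^+ n.+1.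
    move=> hx' hy'; rewrite ltNge; apply/negP => Eb'; apply: nex.
    exists x', y'; split=> //; split => //.
    + by clear -hx' ax hx0; case: hx' => ->; lra.
    + by rewrite -/hx; clear -hx' xb hx0 hx2; case: hx' => ->; lra.
    + by clear -hy' cy hy0; case: hy' => ->; lra.
    + by rewrite -/hy; clear -hy' yd hy0 hy2; case: hy' => ->; lra.
  have sub x1 x2 y1 y2 : x <= x1 -> x2 <= x + bx -> y <= y1 -> y2 <= y + dy ->
      closed_form_on x1 x2 y1 y2.
    move=> h1 h2 h3 h4 s t /andP[s1 s2] /andP[t1 t2]; apply: H.
      by clear -h1 h2 s1 s2 ax xb; lra.
    by clear -h3 h4 t1 t2 cy yd; lra.
  have [xl xr] : x <= x + hx /\ x + hx <= x + bx by clear -hx0 hx2; lra.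
  have [yl yr] : y <= y + hy /\ y + hy <= y + dy by clear -hy0 hy2; lra.
  have := Eb.
  rewrite (@boundary_integral_splitx _ _ _ _ (x + hx));
    [|exact: sub|exact: le_trans yl yr|by rewrite xl xr].
  rewrite (@boundary_integral_splity _ _ _ _ (y + hy));
    [|exact: sub|by []|by rewrite yl yr].
  rewrite (@boundary_integral_splity (x + hx) _ _ _ (y + hy));
    [|exact: sub|by []|by rewrite yl yr].
  have q1 := small x y (or_introl erefl) (or_introl erefl).
  have q2 := small x (y + hy) (or_introl erefl) (or_intror erefl).
  have q3 := small (x + hx) y (or_intror erefl) (or_introl erefl).
  have q4 := small (x + hx) (y + hy) (or_intror erefl) (or_intror erefl).
  rewrite -!addrA hx2 hy2 in q1 q2 q3 q4.
  rewrite leNgt => /negP; apply.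
  have -> : E / 4 ^+ n = E / 4 ^+ n.+1 + E / 4 ^+ n.+1 + E / 4 ^+ n.+1 + E / 4 ^+ n.+1.
    by rewrite exprS; field; rewrite expf_neq0.
  move: q1 q2 q3 q4; rewrite !ltr_norml.
  move: (boundary_integral _ _ _ _) (boundary_integral _ _ _ _) => B1 B2.
  move: (boundary_integral _ _ _ _) (boundary_integral _ _ _ _) => B3 B4.
  lra.
have step' n : forall z : R * R, exists z' : R * R, bad n z.1 z.2 -> [/\ bad n.+1 z'.1 z'.2,
    z'.1 = z.1 \/ z'.1 = z.1 + (b - a) / 2 ^+ n.+1 &
    z'.2 = z.2 \/ z'.2 = z.2 + (d - c) / 2 ^+ n.+1].
  move=> [x y]; have [/step[x' [y' h]]|nb] := pselect (bad n x y).
    by exists (x', y').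
  by exists (x, y).
pose f n := projT1 (choice (step' n)).
have Hf n := projT2 (choice (step' n)).
pose z := fix z n := if n is k.+1 then f k (z k) else (a, c).
have zbad n : bad n (z n).1 (z n).2.
  elim: n => [|n IH]; last by have [] := Hf n _ IH.
  rewrite /bad /= expr0 !divr1 !(addrC _ (_ - _)) !subrK.
  by split => //; rewrite expr0 divr1.
have [|n|x0 hx0] := @nested_corner (fun n => (z n).1) (b - a).
- by lra.
- by have [] := Hf n _ (zbad n).
have [|n|y0 hy0] := @nested_corner (fun n => (z n).2) (d - c).
- by lra.
- by have [] := Hf n _ (zbad n).
have l0 : 0 <= l by rewrite /l; lra.
(* Chosen to make 2 * eps * l ^ 2 < E; the 1 covers degenerate rectangles. *)
pose eps := E / (4 * (l ^+ 2 + 1)).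
have l2 : 0 < l ^+ 2 + 1 by rewrite ltr_wpDl// sqr_ge0.
have eps0 : 0 < eps by rewrite divr_gt0// mulr_gt0.
have [|del del0 Hd] := @boundary_integral_small x0 y0 eps _ eps0.
  apply: H.
  - by have := hx0 0%N; rewrite /= expr0 divr1 addrC subrK.
  - by have := hy0 0%N; rewrite /= expr0 divr1 addrC subrK.
have [n hn] : exists n : nat, l / 2 ^+ n < del.
  exists (Num.bound (l / del)).
  by rewrite ltr_pdivrMr ?exprn_gt0// mulrC -ltr_pdivrMr// upper_nthrootP.
have [ax xb cy yd Eb] := zbad n.
have hb : (b - a) / 2 ^+ n <= l / 2 ^+ n.
  by rewrite ler_wpM2r ?invr_ge0 ?exprn_ge0// lerDl subr_ge0.
have hd : (d - c) / 2 ^+ n <= l / 2 ^+ n.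
  by rewrite ler_wpM2r ?invr_ge0 ?exprn_ge0// lerDr subr_ge0.
have Hsub : closed_form_on (z n).1 ((z n).1 + (b - a) / 2 ^+ n)
    (z n).2 ((z n).2 + (d - c) / 2 ^+ n).
  by move=> s t /andP[s1 s2] /andP[t1 t2]; apply: H; apply/andP; split;
    do ?[exact: le_trans s1|exact: le_trans t1|exact: le_trans s2 _|
         exact: le_trans t2 _].
have := Hd _ _ _ _ Hsub (hx0 n) (hy0 n).
have addKl (u v : R) : u + v - u = v by ring.
rewrite !addKl => /(_ (le_lt_trans hb hn) (le_lt_trans hd hn)).
rewrite leNgt => /negP; apply; apply: lt_le_trans Eb; rewrite -mulrDl -/l expr_div_n.
rewrite -exprM mulnC exprM (_ : 2 ^+ 2 = 4); last by ring.
rewrite mulrA ltr_pM2r ?invr_gt0 ?exprn_gt0//.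
have -> : 2 * eps * l ^+ 2 = E * (l ^+ 2 / (2 * (l ^+ 2 + 1))).
  by rewrite /eps; move: (l ^+ 2) l2; clear; move=> u u0; field; lra.
rewrite -[ltRHS]mulr1 ltr_pM2l// ltr_pdivrMr ?mul1r;
  move: (l ^+ 2) (sqr_ge0 l); clear; move=> u u0; lra.
Qed.

End goursat.

(** * Cauchy's estimate in one variable *)

Section complex_modulus.
Variable R : realType.
Local Notation C := R[i].
Implicit Types (x y z w : C).

Lemma cmod_ge0 z : 0 <= cmod z.
Proof. by case: z => a b; rewrite /= sqrtr_ge0. Qed.

Lemma cmodD z w : cmod (z + w) <= cmod z + cmod w.
Proof. exact: le_normcD. Qed.

Lemma cmodN z : cmod (- z) = cmod z.
Proof. exact: normcN. Qed.

Lemma cmodM z w : cmod (z * w) = cmod z * cmod w.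
Proof. exact: Normc.normcM. Qed.

Lemma cmod0 : cmod (0 : C) = 0.
Proof. exact: Normc.normc0. Qed.

Lemma cmod1 : cmod (1 : C) = 1.
Proof. exact: Normc.normc1. Qed.

Lemma cmodV z : cmod z^-1 = (cmod z)^-1.
Proof. exact: Normc.normcV. Qed.

Lemma cmod_eq0 z : (cmod z == 0) = (z == 0).
Proof.
by apply/eqP/eqP => [/Normc.eq0_normc//|->]; exact: cmod0.
Qed.

Lemma cmod_gt0 z : (0 < cmod z) = (z != 0).
Proof. by rewrite lt_def cmod_eq0 cmod_ge0 andbT. Qed.

Lemma cmodB z w : cmod (z - w) <= cmod z + cmod w.
Proof. by rewrite -(cmodN w); exact: cmodD. Qed.

Lemma cmod_distC z w : cmod (z - w) = cmod (w - z).
Proof. by rewrite -cmodN opprB. Qed.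

Lemma cmod_real (a : R) : cmod (a%:C)%C = `|a|.
Proof. by rewrite /= expr0n addr0 sqrtr_sqr. Qed.

Lemma cmod_i : cmod ('i%C : C) = 1.
Proof. by rewrite /= expr0n expr1n add0r sqrtr1. Qed.

Lemma ler_Re_cmod z : `|complex.Re z| <= cmod z.
Proof. by case: z => a b /=; rewrite -sqrtr_sqr ler_wsqrtr// lerDl sqr_ge0. Qed.

Lemma ler_Im_cmod z : `|complex.Im z| <= cmod z.
Proof. by case: z => a b /=; rewrite -sqrtr_sqr ler_wsqrtr// lerDr sqr_ge0. Qed.

Lemma ReleC z : complex.Re z <= cmod z.
Proof. exact: le_trans (ler_norm _) (ler_Re_cmod z). Qed.

Lemma cmod_ReIm z : cmod z <= `|complex.Re z| + `|complex.Im z|.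
Proof.
case: z => a b /=; rewrite -(ler_pXn2r (n := 2)) ?nnegrE ?sqrtr_ge0 ?addr_ge0//.
rewrite sqr_sqrtr ?addr_ge0 ?sqr_ge0// sqrrD (real_normK (num_real a)).
rewrite (real_normK (num_real b)) lerD2r lerDl.
by rewrite mulrn_wge0// mulr_ge0.
Qed.

Lemma cmod_sqr z : cmod z ^+ 2 = complex.Re z ^+ 2 + complex.Im z ^+ 2.
Proof. by case: z => a b /=; rewrite sqr_sqrtr// addr_ge0 ?sqr_ge0. Qed.

Lemma cmod_conj z : cmod z^*%C = cmod z.
Proof. by case: z => a b /=; rewrite sqrrN. Qed.

Lemma natr_complex_mod n : cmod (n%:R : C) = n%:R.
Proof. by rewrite -(rmorph_nat (real_complex R)) cmod_real ger0_norm. Qed.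

Lemma cmod_phase z : exists2 c, cmod c = 1 & c * z = ((cmod z)%:C)%C.
Proof.
have [->|z0] := eqVneq z 0; first by exists 1; rewrite ?cmod1// mulr0 cmod0.
exists (((cmod z)%:C)%C / z).
  by rewrite cmodM cmodV cmod_real ger0_norm ?cmod_ge0// divff// cmod_eq0.
by rewrite mulfVK.
Qed.

Lemma ci_neq0 : 'i%C != 0 :> C.
Proof. by rewrite -cmod_eq0 cmod_i oner_eq0. Qed.

Lemma invci : 'i%C^-1 = - 'i%C :> C.
Proof. by apply: (mulfI ci_neq0); rewrite divff ?ci_neq0//; simpc. Qed.

End complex_modulus.

Section complex_derivative.
Variable R : realType.
Local Notation C := R[i].
Implicit Types (f g : C -> C) (a z d : C).

(** Complex differentiability as an estimate on real moduli, which chains better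
    than limits in the C-valued norm. *)
Definition is_cderiv f z d := forall eps : R, 0 < eps ->
  exists2 del : R, 0 < del & forall w : C, cmod (w - z) < del ->
    cmod (f w - f z - d * (w - z)) <= eps * cmod (w - z).

Lemma is_cderiv_cts f z d : is_cderiv f z d -> forall eps : R, 0 < eps ->
  exists2 del : R, 0 < del & forall w, cmod (w - z) < del -> cmod (f w - f z) < eps.
Proof.
move=> H e e0; have [del del0 Hd] := H 1 ltr01.
have k0 : 0 < 1 + cmod d by rewrite ltr_pwDl// cmod_ge0.
exists (Num.min del (e / (1 + cmod d))); first by rewrite lt_min del0 divr_gt0.
move=> w; rewrite lt_min => /andP[wd]; rewrite ltr_pdivlMr// => we.
rewrite (_ : f w - f z = (f w - f z - d * (w - z)) + d * (w - z)); last by ring.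
apply: le_lt_trans (cmodD _ _) _; apply: le_lt_trans we.
have := Hd _ wd; rewrite cmodM; lra.
Qed.

Lemma is_cderivD f g z d e : is_cderiv f z d -> is_cderiv g z e ->
  is_cderiv (fun w => f w + g w) z (d + e).
Proof.
move=> Hf Hg eps e0; have e2 : 0 < eps / 2 by rewrite divr_gt0.
have [df df0 {}Hf] := Hf _ e2; have [dg dg0 {}Hg] := Hg _ e2.
exists (Num.min df dg); first by rewrite lt_min df0.
move=> w; rewrite lt_min => /andP[/Hf {}Hf /Hg {}Hg].
rewrite (_ : _ - _ - _ = (f w - f z - d * (w - z)) + (g w - g z - e * (w - z)));
  last by ring.
apply: le_trans (cmodD _ _) _; lra.
Qed.

Lemma is_cderiv_cst c z : is_cderiv (fun=> c) z 0.
Proof.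
move=> e e0; exists 1 => // w _; rewrite subrr mul0r subr0 cmod0.
by rewrite mulr_ge0 ?cmod_ge0// ltW.
Qed.

Lemma is_cderiv_id z : is_cderiv id z 1.
Proof.
move=> e e0; exists 1 => // w _; rewrite mul1r subrr cmod0.
by rewrite mulr_ge0 ?cmod_ge0// ltW.
Qed.

Lemma is_cderivM f g z d e : is_cderiv f z d -> is_cderiv g z e ->
  is_cderiv (fun w => f w * g w) z (d * g z + f z * e).
Proof.
move=> Hf Hg eps e0.
pose K := cmod (g z) + 1 + cmod d + cmod (f z).
have K0 : 0 < K by rewrite /K; have := cmod_ge0 (g z); have := cmod_ge0 d; have := cmod_ge0 (f z); lra.
pose e' := Num.min 1 (eps / K).
have e'0 : 0 < e' by rewrite lt_min ltr01 divr_gt0.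
have [df df0 {}Hf] := Hf _ e'0.
have [dc dc0 Hc] := is_cderiv_cts Hg e'0.
have [dg dg0 {}Hg] := Hg _ e'0.
exists (Num.min df (Num.min dc dg)); first by rewrite !lt_min df0 dc0.
move=> w; rewrite !lt_min => /andP[/Hf {}Hf /andP[/Hc {}Hc /Hg {}Hg]].
rewrite (_ : _ - _ - _ = (f w - f z - d * (w - z)) * g w
  + d * (w - z) * (g w - g z) + f z * (g w - g z - e * (w - z))); last by ring.
have e'1 : e' <= 1 by rewrite ge_min lexx.
have e'K : e' * K <= eps by rewrite -ler_pdivlMr// ge_min lexx orbT.
have gw : cmod (g w) <= cmod (g z) + 1.
  rewrite (_ : g w = g z + (g w - g z)); last by ring.
  apply: le_trans (cmodD _ _) _; rewrite lerD2l; exact: le_trans (ltW Hc) e'1.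
have h0 := cmod_ge0 (w - z).
apply: (@le_trans _ _ (e' * K * cmod (w - z))); last by rewrite ler_wpM2r.
apply: le_trans (cmodD _ _) _; apply: le_trans (lerD (cmodD _ _) (lexx _)) _.
rewrite !cmodM.
have -> : e' * K * cmod (w - z) = e' * cmod (w - z) * (cmod (g z) + 1)
   + cmod d * cmod (w - z) * e' + cmod (f z) * (e' * cmod (w - z)).
  by rewrite /K; ring.
apply: lerD; last by rewrite ler_wpM2l ?cmod_ge0.
apply: lerD; first by apply: ler_pM; rewrite ?cmod_ge0.
by rewrite ler_wpM2l ?mulr_ge0 ?cmod_ge0// ltW.
Qed.

Lemma is_cderivV z : z != 0 -> is_cderiv (fun w => w^-1) z (- (z ^+ 2)^-1).
Proof.
move=> z0 eps e0; have nz : 0 < cmod z by rewrite cmod_gt0.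
exists (Num.min (cmod z / 2) (eps * cmod z ^+ 3 / 2)).
  by rewrite lt_min divr_gt0//= divr_gt0// mulr_gt0// exprn_gt0.
move=> w; rewrite lt_min => /andP[w1 w2].
have wz : cmod z / 2 < cmod w.
  have := cmodD (z - w) w; rewrite subrK (cmod_distC z); lra.
have w0 : w != 0 by rewrite -cmod_gt0; apply: lt_trans wz; rewrite divr_gt0.
rewrite (_ : _ - _ - _ = (w - z) * (w - z) / (w * z ^+ 2)); last first.
  by field; rewrite z0 w0.
rewrite !cmodM cmodV !cmodM -mulrA mulrC.
apply: ler_wpM2r; rewrite ?cmod_ge0//.
have zz : 0 < cmod z * cmod z by rewrite mulr_gt0.
rewrite ler_pdivrMr; last by rewrite mulr_gt0// cmod_gt0.
apply: (le_trans (ltW w2)).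
rewrite -mulrA ler_pM2l// (_ : _ / 2 = cmod z / 2 * (cmod z * cmod z)); last by rewrite exprS expr2; ring.
by rewrite ler_pM2r// ltW.
Qed.

Lemma is_cderiv_scale f a z d : is_cderiv f (a * z) d ->
  is_cderiv (fun w => f (a * w)) z (d * a).
Proof.
move=> H e e0; have k0 : 0 < 1 + cmod a by rewrite ltr_pwDl// cmod_ge0.
have [del d0 Hd] := H (e / (1 + cmod a)) (divr_gt0 e0 k0).
exists (del / (1 + cmod a)); first by rewrite divr_gt0.
move=> w; rewrite ltr_pdivlMr// => hw.
have wa : cmod (a * w - a * z) <= cmod (w - z) * (1 + cmod a).
  by rewrite -mulrBr cmodM mulrC ler_wpM2l ?cmod_ge0// lerDr.
have := Hd _ (le_lt_trans wa hw); rewrite -mulrBr mulrA => /le_trans; apply.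
rewrite mulrAC -mulrA ler_pM2l// ler_pdivrMr// mulrBr.
by rewrite (le_trans wa).
Qed.

(** The Cauchy-Riemann equations: the imaginary part of [f dz] is closed. *)
Lemma is_cderiv_closed_form f (x y : R) d : is_cderiv f (x +i* y)%C d ->
  closed_form_at (fun x y => complex.Im (f (x +i* y)%C))
                 (fun x y => complex.Re (f (x +i* y)%C)) x y.
Proof.
move=> H; exists (complex.Im d), (complex.Re d), (- complex.Im d) => e e0.
have [del d0 Hd] := H _ e0; exists (del / 2); first by rewrite divr_gt0.
move=> x1 y1 hx hy.
have hle : cmod ((x1 +i* y1)%C - (x +i* y)%C) <= `|x1 - x| + `|y1 - y|.
  exact: cmod_ReIm.
have /Hd : cmod ((x1 +i* y1)%C - (x +i* y)%C) < del by apply: le_lt_trans hle _; lra.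
move=> /le_trans/(_ (ler_wpM2l (ltW e0) hle)); set E := (X in cmod X <= _) => HE.
split; [apply: le_trans HE|apply: le_trans HE].
- apply: le_trans (ler_Im_cmod _); rewrite /E.
  move: (f _) (f _) (d) => [? ?] [? ?] [? ?] /=.
  by rewrite le_eqVlt; apply/orP; left; apply/eqP; congr `|_|; ring.
- apply: le_trans (ler_Re_cmod _); rewrite /E.
  move: (f _) (f _) (d) => [? ?] [? ?] [? ?] /=.
  by rewrite le_eqVlt; apply/orP; left; apply/eqP; congr `|_|; ring.
Qed.

Lemma is_cderiv_cts_line f (u v : C) (t : R) d :
  is_cderiv f (u + (t%:C)%C * v) d ->
  {for t, continuous (fun s : R => cmod (f (u + (s%:C)%C * v)))}.
Proof.
move=> H; apply/cvgrPdist_lt => e e0.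
have [del d0 Hd] := is_cderiv_cts H e0.
have k0 : 0 < 1 + cmod v by rewrite ltr_pwDl// cmod_ge0.
near=> s.
have ts : `|t - s| < del / (1 + cmod v).
  near: s; apply: cvgr_dist_lt; last exact: divr_gt0.
  exact: cvg_id.
set a := f _; set b := f _.
have : cmod (b - a) < e.
  apply: Hd; rewrite opprD addrACA subrr add0r -mulrBl -raddfB cmodM cmod_real distrC.
  apply: (@le_lt_trans _ _ (`|t - s| * (1 + cmod v))).
    by rewrite ler_wpM2l// lerDr.
  by rewrite -ltr_pdivlMr.
rewrite -/(_ - _) => ab; apply: le_lt_trans ab; rewrite ler_norml.
have h1 := cmodD (b - a) a; have h2 := cmodD (a - b) b.
rewrite !subrK in h1 h2; rewrite (cmod_distC a b) in h2; lra.
Unshelve. all: by end_near. Qed.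

End complex_derivative.

Section square_estimates.
Variable R : realType.
Local Notation C := R[i].

Definition in_square (r : R) (z : C) :=
  `|complex.Re z| <= r /\ `|complex.Im z| <= r.

Lemma in_square_i r z : in_square r z -> in_square r ('i%C * z).
Proof. by case: z => a b [/= ha hb]; split; simpc => //=; rewrite normrN. Qed.

Lemma in_squareN r z : in_square r z -> in_square r (- z).
Proof. by case: z => a b [/= ha hb]; split; simpc => /=; rewrite normrN. Qed.

Lemma ReiE (z : C) : complex.Re (- 'i%C * z) = complex.Im z.
Proof. by case: z => a b; simpc. Qed.

Lemma ImiE (z : C) : complex.Im (- 'i%C * z) = - complex.Re z.
Proof. by case: z => a b; simpc. Qed.

Lemma cts_on_side (H : C -> C) (r : R) :
  (forall y : R, - r <= y <= r -> exists d, is_cderiv H (r +i* y)%C d) ->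
  cts_on (- r) r (fun y => cmod (H (r +i* y)%C)).
Proof.
move=> HH y /HH[d Hd].
have e (s : R) : (r +i* s)%C = (r%:C)%C + (s%:C)%C * 'i%C by simpc.
rewrite e in Hd; have := is_cderiv_cts_line Hd; congr ({for _, continuous _}).
by apply/funext => ?; apply/funext => s; rewrite e.
Qed.

(** The square annulus between the squares of half-sides [rho] and [r] is the
    union of the four rotations of the rectangle [rho, r] x [- rho, r], so for
    a form invariant under rotation by a right angle, the integral around this
    rectangle is the difference of those along the right sides of the two
    squares. *)
Lemma side_integral_const (G : C -> C) (rho r : R) : 0 < rho -> rho <= r ->
  (forall z : C, z != 0 -> in_square r z -> exists d, is_cderiv G z d) ->
  (forall z : C, G ('i%C * z) = - 'i%C * G z) ->
  int_itv (- r) r (fun y => complex.Re (G (r +i* y)%C)) =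
  int_itv (- rho) rho (fun y => complex.Re (G (rho +i* y)%C)).
Proof.
move=> rho0 rr HG Gi.
set P := fun x y : R => complex.Im (G (x +i* y)%C).
set Q := fun x y : R => complex.Re (G (x +i* y)%C).
have cf x y : x != 0 -> `|x| <= r -> `|y| <= r -> closed_form_at P Q x y.
  move=> x0 xr yr; have [|//|d Hd] := HG (x +i* y)%C.
    by rewrite eq_complex /= negb_and x0.
  exact: is_cderiv_closed_form Hd.
have cQ x : x != 0 -> `|x| <= r -> cts_on (- r) r (Q x).
  move=> x0 xr y yr; apply: (closed_form_ctsy (cf x y x0 xr _)).2.
  by rewrite ler_norml.
have r0 : 0 < r by lra.
have nr : `|r| <= r by rewrite ger0_norm// ltW.
have nrho : `|rho| <= r by rewrite ger0_norm// ltW.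
have rn : r != 0 by rewrite gt_eqF.
have rhon : rho != 0 by rewrite gt_eqF.
have cQr := cQ _ rn nr; have cQrho := cQ _ rhon nrho.
have := @goursat R P Q rho r (- rho) r.
rewrite /boundary_integral => /(_ _ _ _)/eqP.
have -> : int_itv rho r (P ^~ (- rho)) = int_itv rho r (Q rho).
  apply: eq_int_itv => x _; rewrite /P /Q -ReiE -Gi; congr (complex.Re (G _)).
  by simpc.
have -> : int_itv rho r (P ^~ r) = - int_itv rho r (fun x => Q r (- x)).
  rewrite -[RHS]mulN1r /int_itv -RintegralZl//; last first.
    apply: (@cts_on_integrable _ rho r (fun x => Q r (- x))) => x xr.
    apply: continuous_comp; first exact: opp_continuous.
    by apply: cQr; lra.
  apply: eq_Rintegral => x _; rewrite /P /Q mulN1r -ImiE -Gi.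
  by congr (complex.Im (G _)); simpc.
rewrite -int_itv_opp//; last by apply: (cts_on_sub cQr); lra.
rewrite (@int_itv_split _ (- r) r (- rho) (Q r))//; [|lra|lra].
rewrite (@int_itv_split _ (- rho) r rho (Q rho)); [|lra|lra|]; last first.
  by apply: (cts_on_sub cQrho); lra.
move=> E; apply/eqP; rewrite -subr_eq0; apply: etrans (E _ _ _).
- by congr (_ == 0); ring.
- by [].
- by lra.
- move=> x y /andP[x1 x2] /andP[y1 y2]; apply: cf; [rewrite gt_eqF//; exact: lt_le_trans x1| |];
  by rewrite ler_norml; clear -x1 x2 y1 y2 rho0 rr; lra.
Qed.

(** The integral of [H z / z] along the right side stays the same when the square
    shrinks.  For a small square [H] is nearly [L], and on the side
    [Re (1 / (rho + i y))] is at least [1 / (2 rho)], which bounds the integral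
    from below by about [|L|]. *)
Lemma rot_invariant_side (H : C -> C) (L : C) (r : R) : 0 < r ->
  (forall z : C, z != 0 -> in_square r z -> exists d, is_cderiv H z d) ->
  (forall z : C, H ('i%C * z) = H z) ->
  (forall eps : R, 0 < eps -> exists2 del : R, 0 < del &
     forall z : C, z != 0 -> cmod z < del -> cmod (H z - L) <= eps) ->
  cmod L * r <= int_itv (- r) r (fun y => cmod (H (r +i* y)%C)).
Proof.
move=> r0 HH Hi HL.
(* Rotating the values makes [L] real and nonnegative. *)
have [c c1 cL] := cmod_phase L.
pose G z := c * H z * z^-1.
have HG z : z != 0 -> in_square r z -> exists d, is_cderiv G z d.
  move=> z0 /(HH _ z0)[d Hd]; eexists.
  apply: is_cderivM; last exact: is_cderivV.
  by apply: is_cderivM Hd; exact: is_cderiv_cst.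
have Gi z : G ('i%C * z) = - 'i%C * G z.
  rewrite /G Hi invfM (_ : 'i%C^-1 = - 'i%C); first by ring.
  exact: invci.
have rn : r != 0 by rewrite gt_eqF.
have cH : cts_on (- r) r (fun y => cmod (H (r +i* y)%C)).
  apply: cts_on_side => y yr; apply: HH.
  - by rewrite eq_complex /= negb_and rn.
  - by split => /=; [rewrite ger0_norm// ltW|rewrite ler_norml].
have cG rho : 0 < rho -> rho <= r ->
    cts_on (- rho) rho (fun y => complex.Re (G (rho +i* y)%C)).
  move=> rho0 rhor y yr; have [||d Hd] := HG (rho +i* y)%C.
  - by rewrite eq_complex /= negb_and gt_eqF.
  - by split => /=; [rewrite ger0_norm// ltW|rewrite ler_norml; lra].
  exact: (closed_form_ctsy (is_cderiv_closed_form Hd)).2.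
have up : int_itv (- r) r (fun y => complex.Re (G (r +i* y)%C)) * r <=
    int_itv (- r) r (fun y => cmod (H (r +i* y)%C)).
  rewrite /int_itv -RintegralZr//; last exact: cts_on_integrable (cG _ r0 _).
  apply: le_int_itv => //.
  - move=> y yr; apply: cvgMl; exact: (cG _ r0 (lexx r)).
  - move=> y _; apply: (@le_trans _ _ (cmod (G (r +i* y)%C) * r)).
      by rewrite ler_wpM2r ?ReleC// ltW.
    rewrite /G !cmodM c1 mul1r cmodV -mulrA ler_piMr ?cmod_ge0//.
    have ry : r <= cmod (r +i* y)%C by apply: le_trans (ReleC _).
    by rewrite mulrC ler_pdivrMr ?mul1r// (lt_le_trans r0).
apply: le_trans up; rewrite ler_pM2r//.
apply/ler_addgt0Pr => e e0.
have e2 : 0 < e / 2 by rewrite divr_gt0.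
have [del del0 Hd] := HL _ e2.
pose rho := Num.min r (del / 3).
have rho0 : 0 < rho by rewrite lt_min r0 divr_gt0.
have rhor : rho <= r by rewrite ge_min lexx.
rewrite (side_integral_const rho0 rhor HG Gi).
have -> : cmod L = (cmod L / 2 / rho - e / 2 / rho) * (rho - - rho) + e.
  by field; rewrite gt_eqF.
rewrite lerD2r -int_itv_cst; last by lra.
apply: le_int_itv; [exact: cts_on_cst|exact: cG|move=> y yr].
set z := (rho +i* y)%C.
have z0 : z != 0 by rewrite eq_complex /= negb_and gt_eqF.
have rz : rho <= cmod z by apply: le_trans (ReleC _).
have zd : cmod z < del.
  apply: (le_lt_trans (cmod_ReIm _)) => /=; rewrite (ger0_norm (ltW rho0)).
  have : `|y| <= rho by rewrite ler_norml.
  have : rho <= del / 3 by rewrite ge_min lexx orbT.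
  lra.
have {Hd} := Hd _ z0 zd => HLz.
have -> : G z = ((cmod L)%:C)%C * z^-1 + c * (H z - L) * z^-1.
  by rewrite /G -cL; ring.
have h1 : cmod L / 2 / rho <= complex.Re (((cmod L)%:C)%C * z^-1).
  rewrite /z /=; simpc => /=; rewrite -mulrA ler_wpM2l ?cmod_ge0//.
  have zz : 0 < rho ^+ 2 + y ^+ 2 by rewrite ltr_pwDl ?exprn_gt0 ?sqr_ge0.
  rewrite ler_pdivlMr// -invfM mulrC ler_pdivrMr ?mulr_gt0//.
  have : 0 <= (rho - y) * (rho + y) by rewrite mulr_ge0//; lra.
  lra.
have h2 : - (e / 2 / rho) <= complex.Re (c * (H z - L) * z^-1).
  rewrite lerNl; apply: le_trans (ler_norm _) _; rewrite normrN.
  apply: le_trans (ler_Re_cmod _) _; rewrite !cmodM c1 mul1r cmodV.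
  by apply: ler_pM; rewrite ?cmod_ge0 ?invr_ge0 ?cmod_ge0// lef_pV2 ?posrE// (lt_le_trans rho0).
rewrite raddfD; exact: lerD h1 h2.
Qed.

Lemma is_cderiv_rot (f : C -> C) (a z : C) :
  (exists d, is_cderiv f (a * z) d) ->
  exists d, is_cderiv (fun w => f (a * w)) z d.
Proof. by move=> [d /is_cderiv_scale Hd]; exists (d * a). Qed.

Definition rot_sum (f : C -> C) (z : C) : C :=
  f z + f ('i%C * z) + f (- 'i%C * z) + f (- z).

Lemma is_cderiv_rot_sum (f : C -> C) (r : R) :
  (forall z : C, in_square r z -> exists d, is_cderiv f z d) ->
  forall z : C, in_square r z -> exists d, is_cderiv (rot_sum f) z d.
Proof.
move=> Hf z zr.
have fi (a : C) : cmod a = 1 -> in_square r (a * z) ->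
    exists d, is_cderiv (fun w => f (a * w)) z d.
  by move=> a1 /Hf; exact: is_cderiv_rot.
have [d0 h0] := Hf z zr.
have [d1 h1] := fi _ (cmod_i R) (in_square_i zr).
have c2 : cmod (- 'i%C : C) = 1 by rewrite cmodN cmod_i.
have c3 : cmod (- 1 : C) = 1 by rewrite cmodN cmod1.
have s2 : in_square r (- 'i%C * z) by rewrite mulNr; exact/in_squareN/in_square_i.
have s3 : in_square r (-1 * z) by rewrite mulN1r; exact/in_squareN.
have [d2 h2] := fi _ c2 s2; have [d3 h3] := fi _ c3 s3.
exists (d0 + d1 + d2 + d3).
have -> : rot_sum f = fun w => f w + f ('i%C * w) + f (- 'i%C * w) + f (-1 * w).
  by apply/funext => w; rewrite /rot_sum mulN1r.
by do 3?apply: is_cderivD.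
Qed.

(** [rot_sum f] is invariant under rotation by a right angle, with value [4 f 0]
    at the centre. *)
Lemma value_le_sides (f : C -> C) (r : R) : 0 < r ->
  (forall z : C, in_square r z -> exists d, is_cderiv f z d) ->
  4 * cmod (f 0) * r <= int_itv (- r) r (fun y => cmod (rot_sum f (r +i* y)%C)).
Proof.
move=> r0 Hf; set H := rot_sum f.
have -> : 4 * cmod (f 0) = cmod (4 * f 0).
  by rewrite cmodM natr_complex_mod.
apply: (@rot_invariant_side H (4 * f 0) r r0).
- by move=> z _ zr; exact: is_cderiv_rot_sum zr.
- move=> z; rewrite /H /rot_sum.
  have -> : 'i%C * ('i%C * z) = - z by rewrite mulrA -expr2 sqr_i mulN1r.
  have -> : - 'i%C * ('i%C * z) = z by rewrite mulrA mulNr -expr2 sqr_i opprK mul1r.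
  rewrite -mulNr; ring.
- move=> e e0.
  have [|d Hd] := Hf 0; first by split; rewrite /= normr0 ltW.
  have e4 : 0 < e / 4 by rewrite divr_gt0.
  have [del del0 {}Hd] := is_cderiv_cts Hd e4; exists del => // z _ zd.
  have h (a : C) : cmod a = 1 -> cmod (f (a * z) - f 0) <= e / 4.
    by move=> a1; apply/ltW/Hd; rewrite subr0 cmodM a1 mul1r.
  rewrite (_ : H z - _ = (f (1 * z) - f 0) + (f ('i%C * z) - f 0) +
     (f (- 'i%C * z) - f 0) + (f (-1 * z) - f 0)); last first.
    by rewrite /H /rot_sum mul1r mulN1r; ring.
  have h1 := h 1 (cmod1 R); have h2 := h _ (cmod_i R).
  have h3 : cmod (f (- 'i%C * z) - f 0) <= e / 4 by apply: h; rewrite cmodN cmod_i.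
  have h4 : cmod (f (-1 * z) - f 0) <= e / 4 by apply: h; rewrite cmodN cmod1.
  apply: le_trans (cmodD _ _) _; apply: le_trans (lerD (cmodD _ _) (lexx _)) _.
  apply: le_trans (lerD (lerD (cmodD _ _) (lexx _)) (lexx _)) _.
  lra.
Qed.

(** The component [h1] of [f] satisfying [h1 (i z) = i h1 z] is [4 d z] to first
    order, so [h1 z / z] is invariant under rotation by a right angle, with value
    [4 d] at the centre. *)
Lemma cauchy_estimate0 (f : C -> C) (r M : R) (d : C) : 0 < r ->
  (forall z : C, in_square r z -> exists d, is_cderiv f z d) ->
  is_cderiv f 0 d -> (forall z : C, in_square r z -> cmod (f z) <= M) ->
  cmod d <= 2 * M / r.
Proof.
move=> r0 Hf Hd fM.
pose h1 (z : C) := f (1 * z) + - 'i%C * f ('i%C * z) + 'i%C * f (- 'i%C * z)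
  + -1 * f (-1 * z).
pose H z := h1 z * z^-1.
have fi (a z : C) : cmod a = 1 -> in_square r (a * z) ->
    exists d, is_cderiv (fun w => f (a * w)) z d.
  by move=> a1 /Hf; exact: is_cderiv_rot.
have cNi : cmod (- 'i%C : C) = 1 by rewrite cmodN cmod_i.
have cN1 : cmod (- 1 : C) = 1 by rewrite cmodN cmod1.
have sq z : in_square r z -> [/\ in_square r (1 * z), in_square r ('i%C * z),
   in_square r (- 'i%C * z) & in_square r (-1 * z)].
  move=> zr; split; rewrite ?mul1r//; first exact: in_square_i.
    by rewrite mulNr; apply/in_squareN/in_square_i.
  by rewrite mulN1r; apply/in_squareN.
have h1M z : in_square r z -> cmod (h1 z) <= 4 * M.
  move=> /sq[s1 s2 s3 s4]; rewrite /h1.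
  have [m1 m2 m3 m4] := And4 (fM _ s1) (fM _ s2) (fM _ s3) (fM _ s4).
  apply: le_trans (cmodD _ _) _; apply: le_trans (lerD (cmodD _ _) (lexx _)) _.
  apply: le_trans (lerD (lerD (cmodD _ _) (lexx _)) (lexx _)) _.
  rewrite !cmodM cmod_i cNi cN1; move: m1 m2 m3 m4; rewrite !mul1r; lra.
have HD z : z != 0 -> in_square r z -> exists d, is_cderiv H z d.
  move=> z0 /sq[s1 s2 s3 s4].
  have [d1 g1] := fi _ z (cmod1 R) s1; have [d2 g2] := fi _ z (cmod_i R) s2.
  have [d3 g3] := fi _ z cNi s3; have [d4 g4] := fi _ z cN1 s4.
  eexists; apply: is_cderivM; last exact: is_cderivV.
  apply: is_cderivD; last by apply: is_cderivM g4; exact: is_cderiv_cst.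
  apply: is_cderivD; last by apply: is_cderivM g3; exact: is_cderiv_cst.
  by apply: is_cderivD g1 _; apply: is_cderivM g2; exact: is_cderiv_cst.
have := @rot_invariant_side H (4 * d) r r0 HD.
have -> : cmod (4 * d) = 4 * cmod d by rewrite cmodM natr_complex_mod.
move=> /(_ _ _)/le_trans K.
have {}K : 4 * cmod d * r <= 4 * M / r * (r - - r).
  apply: K.
  - move=> z; rewrite /H /h1 invfM invci.
    have -> : 1 * ('i%C * z) = 'i%C * z by ring.
    have -> : 'i%C * ('i%C * z) = -1 * z by rewrite mulrA -expr2 sqr_i.
    have -> : - 'i%C * ('i%C * z) = 1 * z by rewrite mulrA mulNr -expr2 sqr_i opprK.
    have -> : -1 * ('i%C * z) = - 'i%C * z by ring.
    rewrite mulrA; congr (_ * _); set u := f _; set v := f _; set w := f _; set t := f _.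
    have i2 : 'i%C ^+ 2 = -1 :> C := sqr_i R.
    transitivity (- 'i%C * u - ('i%C ^+ 2) * - v - ('i%C ^+ 2) * w + 'i%C * t); first by ring.
    by rewrite i2; ring.
  - move=> e e0.
    have e4 : 0 < e / 4 by rewrite divr_gt0.
    have [del del0 {}Hd] := Hd _ e4; exists del => // z z0 zd.
    have h (a b : C) : cmod a = 1 -> cmod b = 1 -> b * a = 1 ->
        cmod (b * f (a * z) - b * f 0 - d * z) <= e / 4 * cmod z.
      move=> a1 b1 ab; have := Hd (a * z).
      rewrite subr0 cmodM a1 mul1r => /(_ zd); apply: le_trans.
      rewrite -[leRHS]mul1r -b1 -cmodM le_eqVlt; apply/orP; left; apply/eqP.
      congr cmod; rewrite -[in LHS](mul1r (d * z)) -ab; ring.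
    have k1 := h 1 1 (cmod1 R) (cmod1 R) (mulr1 1).
    have k2 := h 'i%C (- 'i%C) (cmod_i R) cNi; have k3 := h (- 'i%C) 'i%C cNi (cmod_i R).
    have k4 := h (-1) (-1) cN1 cN1.
    rewrite mulNr -expr2 sqr_i opprK in k2; rewrite mulrN -expr2 sqr_i opprK in k3.
    rewrite mulrNN mulr1 in k4.
    have {}k2 := k2 erefl; have {}k3 := k3 erefl; have {}k4 := k4 erefl.
    rewrite (_ : H z - 4 * d = (1 * f (1 * z) - 1 * f 0 - d * z +
      (- 'i%C * f ('i%C * z) - - 'i%C * f 0 - d * z) +
      ('i%C * f (- 'i%C * z) - 'i%C * f 0 - d * z) +
      (-1 * f (-1 * z) - -1 * f 0 - d * z)) * z^-1); last first.
      rewrite /H /h1; field; exact: z0.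
    rewrite cmodM cmodV ler_pdivrMr ?cmod_gt0//.
    apply: le_trans (cmodD _ _) _; apply: le_trans (lerD (cmodD _ _) (lexx _)) _.
    apply: le_trans (lerD (lerD (cmodD _ _) (lexx _)) (lexx _)) _.
    lra.
  - have ry y : - r <= y <= r -> in_square r (r +i* y)%C.
      by move=> yr; split => /=; [rewrite ger0_norm// ltW|rewrite ler_norml].
    rewrite -int_itv_cst; last by lra.
    apply: le_int_itv; [|exact: cts_on_cst|].
    + apply: cts_on_side => y /ry yr; apply: HD => //.
      by rewrite eq_complex /= negb_and gt_eqF.
    + move=> y /ry yr; rewrite /H cmodM cmodV.
      apply: ler_pM; rewrite ?cmod_ge0 ?invr_ge0 ?cmod_ge0//; first exact: h1M.
      have rz : r <= cmod (r +i* y)%C by apply: le_trans (ReleC _).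
      by rewrite lef_pV2 ?posrE// (lt_le_trans r0).
rewrite ler_pdivlMr//.
have : 4 * M / r * (r - - r) = 4 * (2 * M) by field; rewrite gt_eqF.
lra.
Qed.

Lemma cmod_in_square r z : in_square r z -> cmod z <= 2 * r.
Proof. by case=> h1 h2; apply: le_trans (cmod_ReIm z) _; lra. Qed.

Lemma cauchy_estimate (f : C -> C) (a : C) (r M : R) (d : C) : 0 < r ->
  (forall z : C, cmod (z - a) <= r -> exists d, is_cderiv f z d) ->
  is_cderiv f a d -> (forall z : C, cmod (z - a) <= r -> cmod (f z) <= M) ->
  cmod d <= 4 * M / r.
Proof.
move=> r0 Hf Hd fM.
have shift z e : is_cderiv f (a + z) e -> is_cderiv (fun w => f (a + w)) z e.
  move=> H eps /H[del del0 {}H]; exists del => // w wd.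
  by have := H (a + w); rewrite opprD addrACA subrr add0r; apply.
have r2 : 0 < r / 2 by rewrite divr_gt0.
have sq z : in_square (r / 2) z -> cmod (a + z - a) <= r.
  by move=> /cmod_in_square; rewrite addrAC subrr add0r => /le_trans; apply; lra.
have -> : 4 * M / r = 2 * M / (r / 2) by field; rewrite gt_eqF.
apply: (@cauchy_estimate0 (fun w => f (a + w)) _ _ d r2).
- by move=> z /sq/Hf[e /shift]; exists e.
- by apply: shift; rewrite addr0.
- by move=> z /sq/fM.
Qed.

End square_estimates.

(** * Holomorphic functions of several variables *)

Section real_line_calculus.
Variable R : realType.

Lemma is_derive_eps (f : R -> R) (x d : R) :
  (forall eps : R, 0 < eps -> exists2 del : R, 0 < del & forall h : R,
     `|h| < del -> `|f (x + h) - f x - d * h| <= eps * `|h|) ->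
  is_derive x 1 f d.
Proof.
move=> H.
have cv : h^-1 *: ((f \o shift x) (h *: 1) - f x) @[h --> 0^'] --> d.
  apply/cvgrPdist_le => e e0; have [del d0 Hd] := H _ e0.
  near=> h.
  have h0 : h != 0 by near: h; exact: nbhs_dnbhs_neq.
  have hd : `|h| < del.
    by near: h; apply: dnbhs0_lt.
  rewrite /= distrC /GRing.scale /= mulr1 (addrC h).
  have -> : h^-1 * (f (x + h) - f x) - d = (f (x + h) - f x - d * h) / h by field.
  by rewrite normrM normfV ler_pdivrMr ?normr_gt0//; exact: Hd.
by split; [apply/cvg_ex; exists d|exact: cvg_lim cv].
Unshelve. all: by end_near. Qed.

End real_line_calculus.

Section mean_value_inequality.
Variable R : realType.
Local Notation C := R[i].

Lemma is_cderiv_derive_Re (f : C -> C) (a b c d : C) (t : R) :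
  is_cderiv f (a + (t%:C)%C * b) d ->
  is_derive t 1 (fun s : R => complex.Re (c * f (a + (s%:C)%C * b)))
    (complex.Re (c * (d * b))).
Proof.
move=> H; apply: is_derive_eps => e e0.
pose K := 1 + cmod c * cmod b + cmod b.
have K0 : 0 < K by rewrite /K; have := cmod_ge0 b; have := mulr_ge0 (cmod_ge0 c) (cmod_ge0 b); lra.
have [del d0 Hd] := H _ (divr_gt0 e0 K0).
exists (del / K); first by rewrite divr_gt0.
move=> h; rewrite ltr_pdivlMr// => hd.
have E : a + ((t + h)%:C)%C * b - (a + (t%:C)%C * b) = (h%:C)%C * b.
  by rewrite rmorphD /=; ring.
have := Hd (a + ((t + h)%:C)%C * b); rewrite E cmodM cmod_real.
have bK : cmod b <= K by rewrite /K; have := mulr_ge0 (cmod_ge0 c) (cmod_ge0 b); lra.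
have cbK : cmod c * cmod b <= K by rewrite /K; have := cmod_ge0 b; lra.
move=> /(_ (le_lt_trans (ler_wpM2l (normr_ge0 h) bK) hd)) {}Hd.
set u := f _; set v := f _.
have -> : complex.Re (c * u) - complex.Re (c * v) - complex.Re (c * (d * b)) * h =
   complex.Re (c * (u - v - d * ((h%:C)%C * b))).
  move: (c) (u) (v) (d) (b) => [? ?] [? ?] [? ?] [? ?] [? ?] /=; ring.
apply: le_trans (ler_Re_cmod _) _; rewrite cmodM.
apply: le_trans (ler_wpM2l (cmod_ge0 c) Hd) _.
have -> : cmod c * (e / K * (`|h| * cmod b)) = (e * `|h|) * ((cmod c * cmod b) / K).
  by clear -K0; clearbody K; field; rewrite gt_eqF.
by apply: ler_piMr; rewrite ?mulr_ge0 ?(ltW e0)// ler_pdivrMr ?mul1r.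
Qed.

(** The real mean value theorem for [Re (c f)], where [c] has modulus 1 and makes
    [c (f (a + b) - f a)] real and nonnegative. *)
Lemma mean_value_bound (f : C -> C) (a b : C) (M : R) :
  (forall t : R, 0 <= t <= 1 ->
     exists2 d, is_cderiv f (a + (t%:C)%C * b) d & cmod d <= M) ->
  cmod (f (a + b) - f a) <= M * cmod b.
Proof.
move=> H; have [c c1 cE] := cmod_phase (f (a + b) - f a).
pose g := fun s : R => complex.Re (c * f (a + (s%:C)%C * b)).
have Hg (t : R) : 0 <= t <= 1 -> exists2 k : R, is_derive t 1 g k & k <= M * cmod b.
  move=> /H[d Hd dM]; exists (complex.Re (c * (d * b))).
    exact: is_cderiv_derive_Re Hd.
  by apply: le_trans (ReleC _) _; rewrite !cmodM c1 mul1r ler_wpM2r ?cmod_ge0.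
have [|||t t01] := @MVT_segment R g (derive1 g) 0 1.
- by [].
- move=> x; rewrite in_itv /= => x01; have [|k Hk _] := Hg x; first lra.
  by split; [exact: ex_derive|rewrite derive1E].
- apply: continuous_in_subspaceT => x /set_mem/=; rewrite in_itv/= => x01.
  have [k Hk _] := Hg x x01.
  by apply: differentiable_continuous; apply/derivable1_diffP; exact: ex_derive.
have [k Hk kM] : exists2 k : R, is_derive t 1 g k & k <= M * cmod b.
  by apply: Hg; move: t01; rewrite in_itv.
rewrite subr0 mulr1 derive1E derive_val => E.
have : g 1 - g 0 = cmod (f (a + b) - f a).
  by rewrite /g !mul1r mul0r addr0 -raddfB -mulrBr cE.
by move=> <-; rewrite E.
Qed.

End mean_value_inequality.

Section max_norm.
Variables (R : realType) (n : nat).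
Local Notation C := R[i].
Local Notation Cn := 'rV[R[i]]_n.+1.
Implicit Types (z w v : Cn).

(** The norm of the library with values in [R] instead of [R[i]], see
    [normE_nrm]. *)
Definition nrm z : R := \big[Num.max/0]_k cmod (z ord0 k).

Lemma nrm_ge0 z : 0 <= nrm z.
Proof. by rewrite /nrm; apply/bigmax_geP; left. Qed.

Lemma cmod_le_nrm z k : cmod (z ord0 k) <= nrm z.
Proof. exact: le_bigmax. Qed.

Lemma nrm_leP z (e : R) : 0 <= e -> (forall k, cmod (z ord0 k) <= e) -> nrm z <= e.
Proof. by move=> e0 H; apply/bigmax_leP; split. Qed.

Lemma nrm_ltP z (e : R) : 0 < e -> (forall k, cmod (z ord0 k) < e) -> nrm z < e.
Proof. by move=> e0 H; apply/bigmax_ltP; split. Qed.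

Lemma nrmD z w : nrm (z + w) <= nrm z + nrm w.
Proof.
apply: nrm_leP => [|k]; first by rewrite addr_ge0 ?nrm_ge0.
by rewrite mxE (le_trans (cmodD _ _))// lerD ?cmod_le_nrm.
Qed.

Lemma nrmN z : nrm (- z) = nrm z.
Proof. by apply: eq_bigr => k _; rewrite mxE cmodN. Qed.

Lemma nrm_distC z w : nrm (z - w) = nrm (w - z).
Proof. by rewrite -nrmN opprB. Qed.

Lemma nrmZ (a : C) z : nrm (a *: z) = cmod a * nrm z.
Proof.
rewrite /nrm (big_morph (fun x => cmod a * x) (op1 := Num.max) (op2 := Num.max) (id1 := 0) (id2 := 0));
  [|by move=> x y; rewrite maxr_pMr ?cmod_ge0|by rewrite mulr0].
by apply: eq_bigr => k _; rewrite mxE cmodM.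
Qed.

Lemma nrm0 : nrm 0 = 0.
Proof. by apply/le_anti; rewrite nrm_ge0 nrm_leP// => k; rewrite mxE cmod0. Qed.

Lemma nrm_eq0 z : nrm z = 0 -> z = 0.
Proof.
move=> z0; apply/rowP => k; rewrite mxE; apply/eqP.
by rewrite -cmod_eq0; apply/eqP/le_anti; rewrite cmod_ge0 -[in X in _ <= X]z0 cmod_le_nrm.
Qed.

Lemma nrm_delta (k : 'I_n.+1) (a : C) : nrm (a *: delta_mx ord0 k) <= cmod a.
Proof.
apply: nrm_leP => [|j]; first exact: cmod_ge0.
by rewrite !mxE eqxx /= cmodM; case: eqP; rewrite ?cmod1 ?mulr1// cmod0 mulr0 cmod_ge0.
Qed.

Lemma normE_cmod (x : C) : `|x| = ((cmod x)%:C)%C.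
Proof. by case: x. Qed.

Lemma normE_nrm z : `|z| = ((nrm z)%:C)%C.
Proof.
apply/le_anti/andP; split.
  have e0 : (0 : C) <= ((nrm z)%:C)%C by rewrite ler0c nrm_ge0.
  rewrite [`|z|]mx_normE -[leRHS]/((NngNum e0)%:num) num_le; apply/bigmax_leP; split => //=.
  by move=> [i k] _; rewrite -num_le /= ord1 normE_cmod lecR cmod_le_nrm.
rewrite -[leRHS]RRe_real ?normr_real// lecR; apply: nrm_leP.
  by rewrite -ler0c RRe_real ?normr_real.
move=> k; rewrite -lecR RRe_real ?normr_real// -normE_cmod [`|z|]mx_normE.
rewrite -[leLHS]nngE num_le.
exact: (@le_bigmax _ _ _ _ (fun i => `|z i.1 i.2|%:nng) (ord0, k)).
Qed.

Lemma nbhs_nrm z (U : set Cn) :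
  nbhs z U <-> exists2 r : R, 0 < r & forall w, nrm (w - z) < r -> U w.
Proof.
split.
  move=> /nbhs_normP[/= e e0 He]; exists (complex.Re e).
    by move: e0; rewrite ltcE => /andP[].
  move=> w wr; apply: He; rewrite /= distrC normE_nrm.
  by rewrite -(RRe_real (gtr0_real e0)) ltcR.
move=> [r r0 Hr]; apply/nbhs_ballP; exists (r%:C)%C; first by rewrite /= ltcR.
by move=> w; rewrite -ball_normE /= distrC normE_nrm ltcR => /Hr.
Qed.

Lemma nbhs_cmod (x : C) (U : set C) :
  nbhs x U <-> exists2 r : R, 0 < r & forall w : C, cmod (w - x) < r -> U w.
Proof.
split.
  move=> /nbhs_normP[/= e e0 He]; exists (complex.Re e).
    by move: e0; rewrite ltcE => /andP[].
  move=> w wr; apply: He; rewrite /= distrC normE_cmod.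
  by rewrite -(RRe_real (gtr0_real e0)) ltcR.
move=> [r r0 Hr]; apply/nbhs_ballP; exists (r%:C)%C; first by rewrite /= ltcR.
by move=> w; rewrite -ball_normE /= distrC normE_cmod ltcR => /Hr.
Qed.

Lemma open_nrm (U : set Cn) : open U -> forall z, U z ->
  exists2 r : R, 0 < r & forall w, nrm (w - z) < r -> U w.
Proof. by move=> oU z Uz; apply/nbhs_nrm; exact: open_nbhs_nbhs. Qed.

Lemma nrm_open (U : set Cn) : (forall z, U z ->
  exists2 r : R, 0 < r & forall w, nrm (w - z) < r -> U w) -> open U.
Proof. by move=> H; rewrite openE => z /H/nbhs_nrm. Qed.

End max_norm.

Lemma differentiable_approx (K : numFieldType) (V W : normedModType K)
    (f : V -> W) (df : {linear V -> W}) (x : V) : continuous df ->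
  (forall e : K, 0 < e -> \forall v \near (0 : V),
     `|f (v + x) - (f x + df v)| <= e * `|v|) ->
  differentiable f x /\ 'd f x = df :> (V -> W).
Proof.
move=> cdf H; have HE : f \o shift x = cst (f x) + df +o_ (0 : V) id.
  by apply/eqaddoP => e /H.
have dE := diff_unique cdf HE; split=> //.
by apply/diff_locallyP; rewrite dE.
Qed.

Section gradient.
Variables (R : realType) (n : nat).
Local Notation C := R[i].
Local Notation Cn := 'rV[R[i]]_n.+1.
Implicit Types (z w v p : Cn) (f g : Cn -> C) (d : 'I_n.+1 -> C).

Definition lin d v : C := \sum_k v ord0 k * d k.

Lemma linD d v w : lin d (v + w) = lin d v + lin d w.
Proof. by rewrite -big_split; apply: eq_bigr => k _; rewrite mxE mulrDl. Qed.

Lemma linZ d a v : lin d (a *: v) = a * lin d v.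
Proof. by rewrite /lin mulr_sumr; apply: eq_bigr => k _; rewrite mxE mulrA. Qed.

Lemma lin_delta d k : lin d (delta_mx ord0 k) = d k.
Proof.
rewrite /lin (bigD1 k)//= mxE !eqxx mul1r big1 ?addr0// => j jk.
by rewrite mxE (negbTE jk) andbF mul0r.
Qed.

Lemma cmod_sum (I : Type) (s : seq I) (P : pred I) (F : I -> C) :
  cmod (\sum_(i <- s | P i) F i) <= \sum_(i <- s | P i) cmod (F i).
Proof.
elim/big_rec2: _ => [|i x y _ IH]; first by rewrite cmod0.
by apply: le_trans (cmodD _ _) _; rewrite lerD2l.
Qed.

Lemma cmod_lin d v : cmod (lin d v) <= nrm v * \sum_k cmod (d k).
Proof.
apply: le_trans (cmod_sum _ _ _) _; rewrite mulr_sumr; apply: ler_sum => k _.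
by rewrite cmodM ler_wpM2r ?cmod_ge0// cmod_le_nrm.
Qed.

(** Differentiability as a real estimate: see [differentiable_is_grad] and
    [is_grad_diff]. *)
Definition is_grad f z d := forall eps : R, 0 < eps ->
  exists2 del : R, 0 < del & forall v, nrm v < del ->
    cmod (f (z + v) - f z - lin d v) <= eps * nrm v.

Let lin_scalar d : scalar (lin d).
Proof. by move=> a v w; rewrite linD linZ. Qed.

Definition linL d : {linear (Cn : normedModType C) -> (C : normedModType C)} :=
  HB.pack (lin d) (GRing.isLinear.Build _ _ _ _ (lin d) (@lin_scalar d)).

Lemma linL_continuous d : continuous (linL d).
Proof.
move=> v U /nbhs_cmod[r r0 HU]; apply/nbhs_nrm.
pose S := 1 + \sum_k cmod (d k).
have S0 : 0 < S by rewrite ltr_pwDl// sumr_ge0// => *; exact: cmod_ge0.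
exists (r / S); first by rewrite divr_gt0.
move=> w; rewrite ltr_pdivlMr// => wr; apply: HU.
have -> : linL d w - linL d v = lin d (w - v) by rewrite -raddfB.
apply: le_lt_trans (cmod_lin _ _) _; apply: le_lt_trans wr.
by rewrite ler_wpM2l ?nrm_ge0// lerDr.
Qed.

Lemma differentiable_is_grad f z : differentiable f z ->
  is_grad f z (fun k => 'D_(delta_mx ord0 k) f z).
Proof.
move=> df e e0; have := diff_locally df.
move=> /eqaddoP /(_ (e%:C)%C); rewrite ltcR => /(_ e0)/nbhs_nrm[r r0 Hr].
exists r => // v vr; have := Hr v; rewrite subr0 => /(_ vr).
rewrite normE_cmod normE_nrm -rmorphM lecR /= => /(le_trans _)-> //.
rewrite le_eqVlt; apply/orP; left; apply/eqP; congr cmod.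
change (f (z + v) - f z - lin (fun k => 'D_(delta_mx ord0 k) f z) v =
  f (v + z) - (f z + 'd f z v)).
rewrite opprD addrA (addrC v z); congr (_ - _ - _).
rewrite [in RHS](row_sum_delta v) linear_sum /lin; apply: eq_bigr => k _.
by rewrite linearZ /= deriveE.
Qed.

Lemma is_grad_diff f z d : is_grad f z d ->
  differentiable f z /\ forall v, 'D_v f z = lin d v.
Proof.
move=> H; have [|df dE] := @differentiable_approx _ _ _ f (linL d) z (@linL_continuous d).
  move=> e e0.
  have [r r0 er] : exists2 r : R, 0 < r & (r%:C)%C = e.
    exists (complex.Re e); last by rewrite (RRe_real (gtr0_real e0)).
    by move: e0; rewrite ltcE => /andP[].
  have [del d0 Hd] := H _ r0; apply/nbhs_nrm; exists del => // v.
  rewrite subr0 => /Hd; rewrite -er normE_cmod normE_nrm -rmorphM lecR /=.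
  move=> /(le_trans _)-> //; rewrite le_eqVlt; apply/orP; left; apply/eqP; congr cmod.
  by rewrite opprD addrA (addrC v z).
by split=> // v; rewrite deriveE// dE.
Qed.

Lemma is_gradE f z d k : is_grad f z d -> 'D_(delta_mx ord0 k) f z = d k.
Proof. by move=> /is_grad_diff[_ ->]; rewrite lin_delta. Qed.

Lemma is_grad_cts f z d : is_grad f z d -> forall eps : R, 0 < eps ->
  exists2 del : R, 0 < del & forall w, nrm (w - z) < del -> cmod (f w - f z) < eps.
Proof.
move=> H e e0; have [del del0 Hd] := H 1 ltr01.
pose S := 1 + \sum_k cmod (d k).
have S0 : 0 < S by rewrite ltr_pwDl// sumr_ge0// => *; exact: cmod_ge0.
exists (Num.min del (e / S)); first by rewrite lt_min del0 divr_gt0.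
move=> w; rewrite lt_min => /andP[wd]; rewrite ltr_pdivlMr// => we.
have := Hd _ wd; rewrite (addrC z) subrK mul1r => H1.
rewrite (_ : f w - f z = (f w - f z - lin d (w - z)) + lin d (w - z)); last by ring.
apply: le_lt_trans (cmodD _ _) _; apply: le_lt_trans we.
by rewrite /S mulrDr mulr1 lerD// cmod_lin.
Qed.

Lemma is_grad_line f p v (t : C) d : is_grad f (p + t *: v) d ->
  is_cderiv (fun s => f (p + s *: v)) t (lin d v).
Proof.
move=> H e e0.
have k0 : 0 < 1 + nrm v by rewrite ltr_pwDl// nrm_ge0.
have [del d0 Hd] := H _ (divr_gt0 e0 k0).
exists (del / (1 + nrm v)); first by rewrite divr_gt0.
move=> s; rewrite ltr_pdivlMr// => hs.
have hv : nrm ((s - t) *: v) <= cmod (s - t) * (1 + nrm v).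
  by rewrite nrmZ ler_wpM2l ?cmod_ge0// lerDr.
have := Hd _ (le_lt_trans hv hs).
rewrite linZ -[p + _ + _]addrA -scalerDl (addrC t) subrK.
rewrite (mulrC (lin _ _)) => /le_trans; apply.
by rewrite mulrAC ler_pdivrMr// -mulrA ler_wpM2l// ltW.
Qed.

Lemma is_gradD f g z d e : is_grad f z d -> is_grad g z e ->
  is_grad (fun w => f w + g w) z (fun k => d k + e k).
Proof.
move=> Hf Hg eps e0; have e2 : 0 < eps / 2 by rewrite divr_gt0.
have [df df0 {}Hf] := Hf _ e2; have [dg dg0 {}Hg] := Hg _ e2.
exists (Num.min df dg); first by rewrite lt_min df0.
move=> w; rewrite lt_min => /andP[/Hf {}Hf /Hg {}Hg].
have -> : lin (fun k => d k + e k) w = lin d w + lin e w.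
  by rewrite -big_split; apply: eq_bigr => k _; rewrite mulrDr.
rewrite (_ : _ - _ - _ = (f (z + w) - f z - lin d w) + (g (z + w) - g z - lin e w));
  last by ring.
apply: le_trans (cmodD _ _) _; lra.
Qed.

Lemma is_gradZ f z d (a : C) : is_grad f z d ->
  is_grad (fun w => a * f w) z (fun k => a * d k).
Proof.
move=> Hf eps e0; have k0 : 0 < 1 + cmod a by rewrite ltr_pwDl// cmod_ge0.
have [del d0 {}Hf] := Hf _ (divr_gt0 e0 k0); exists del => // w /Hf {}Hf.
have -> : lin (fun k => a * d k) w = a * lin d w.
  by rewrite /lin mulr_sumr; apply: eq_bigr => k _; ring.
rewrite -!mulrBr cmodM; apply: le_trans (ler_wpM2l (cmod_ge0 a) Hf) _.
rewrite mulrA ler_wpM2r ?nrm_ge0// mulrA ler_pdivrMr// mulrC ler_wpM2l//.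
  exact: ltW.
by rewrite lerDr.
Qed.

Lemma is_gradB f g z d e : is_grad f z d -> is_grad g z e ->
  is_grad (fun w => f w - g w) z (fun k => d k - e k).
Proof.
move=> Hf /(is_gradZ (-1)) Hg; have := is_gradD Hf Hg.
have -> : (fun w => f w + -1 * g w) = (fun w => f w - g w).
  by apply/funext => w; rewrite mulN1r.
by have -> : (fun k => d k + -1 * e k) = (fun k => d k - e k)
  by apply/funext => w; rewrite mulN1r.
Qed.

Lemma is_grad_shift f p z d : is_grad f (z + p) d -> is_grad (fun w => f (w + p)) z d.
Proof.
by move=> H e /H[del d0 Hd]; exists del => // v /Hd; rewrite [z + v + p]addrAC.
Qed.

End gradient.

Section several_variables.
Variables (R : realType) (n : nat).
Local Notation C := R[i].
Local Notation Cn := 'rV[R[i]]_n.+1.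
Implicit Types (z w v p : Cn) (f g : Cn -> C) (d : 'I_n.+1 -> C).

Definition hol_ball f z (r : R) :=
  forall w, nrm (w - z) <= r -> exists d, is_grad f w d.

Lemma cauchy_estimate_line f p v (r M : R) d : 0 < r ->
  (forall s : C, cmod s <= r -> exists d, is_grad f (p + s *: v) d) ->
  (forall s : C, cmod s <= r -> cmod (f (p + s *: v)) <= M) ->
  is_grad f p d -> cmod (lin d v) <= 4 * M / r.
Proof.
move=> r0 Hf fM Hd.
apply: (@cauchy_estimate _ (fun s => f (p + s *: v)) 0 r M _ r0).
- by move=> s; rewrite subr0 => /Hf[e /is_grad_line]; exists (lin e v).
- by apply: is_grad_line; rewrite scale0r addr0.
- by move=> s; rewrite subr0 => /fM.
Qed.

Lemma cauchy_estimate_coord f z (r M : R) d k : 0 < r -> hol_ball f z r ->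
  (forall w, nrm (w - z) <= r -> cmod (f w) <= M) ->
  is_grad f z d -> cmod (d k) <= 4 * M / r.
Proof.
move=> r0 Hf fM Hd; rewrite -(lin_delta d k).
have near (s : C) : cmod s <= r -> nrm (z + s *: delta_mx ord0 k - z) <= r.
  by move=> sr; rewrite addrAC subrr add0r (le_trans (nrm_delta _ _)).
by apply: cauchy_estimate_line Hd => // s /near; [exact: Hf|exact: fM].
Qed.

(** On the line [u s = f (z + s v)], Cauchy's estimate makes [u] Lipschitz; applied
    once more, to the differences [u (s + a) - u s], it makes [u'] Lipschitz, and
    the mean value inequality for [u s - u' 0 * s] concludes. *)
Lemma taylor2 f z (r M : R) d v : 0 < r -> hol_ball f z r ->
  (forall w, nrm (w - z) <= r -> cmod (f w) <= M) ->
  is_grad f z d -> nrm v <= r / 4 ->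
  cmod (f (z + v) - f z - lin d v) <= 128 * M / r ^+ 2 * nrm v ^+ 2.
Proof.
move=> r0 Hf fM Hd vr.
have M0 : 0 <= M by apply: le_trans (fM z _); rewrite ?cmod_ge0// subrr nrm0 ltW.
have [v0|/eqP v0] := eqVneq (nrm v) 0.
  rewrite v0 expr0n mulr0 (nrm_eq0 v0) addr0 subrr.
  by rewrite /lin big1 ?subrr ?cmod0// => k _; rewrite mxE mul0r.
have {}v0 : 0 < nrm v by rewrite lt_def nrm_ge0 andbT; apply/eqP.
pose u (s : C) := f (z + s *: v).
(* [u] is holomorphic for |s| <= rho, with rho >= 4. *)
pose rho := r / nrm v.
have rho4 : 4 <= rho by rewrite ler_pdivlMr//; lra.
have rhoE : rho * nrm v = r by rewrite divfK// gt_eqF.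
have inb (s : C) : cmod s <= rho -> nrm (z + s *: v - z) <= r.
  by move=> sr; rewrite addrAC subrr add0r nrmZ -rhoE ler_wpM2r// ltW.
have Hu (s : C) : cmod s <= rho -> exists e, is_cderiv u s e.
  by move=> /inb/Hf[e /is_grad_line]; exists (lin e v).
have uM (s : C) : cmod s <= rho -> cmod (u s) <= M by move=> /inb/fM.
have rho0 : 0 < rho by lra.
have Hu1 (s e : C) : cmod s <= rho / 2 -> is_cderiv u s e -> cmod e <= 8 * M / rho.
  move=> sr He; have -> : 8 * M / rho = 4 * M / (rho / 2) by field; lra.
  have near (t : C) : cmod (t - s) <= rho / 2 -> cmod t <= rho.
    by move=> ts; rewrite -(subrK s t); apply: le_trans (cmodD _ _) _; lra.
  by apply: (@cauchy_estimate _ u s _ _ e _ _ He) => [|t /near/Hu //|t /near/uM //]; lra.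
have lipu (a s : C) : cmod a <= 1 -> cmod s <= rho / 4 ->
    cmod (u (s + a) - u s) <= 8 * M / rho * cmod a.
  move=> a1 sr; apply: mean_value_bound => t t01.
  have st : cmod (s + (t%:C)%C * a) <= rho / 2.
    apply: le_trans (cmodD _ _) _; rewrite cmodM cmod_real ger0_norm; last by case/andP: t01.
    have : t * cmod a <= 1 * 1 by apply: ler_pM; rewrite ?cmod_ge0//; case/andP: t01.
    lra.
  have [|e He] := Hu (s + (t%:C)%C * a); first lra.
  by exists e => //; exact: Hu1 He.
have u0 : is_cderiv u 0 (lin d v) by apply: is_grad_line; rewrite scale0r addr0.
have lipu' (a e : C) : cmod a <= 1 -> is_cderiv u a e ->
    cmod (e - lin d v) <= 128 * M / rho ^+ 2.
  move=> a1 He; pose g s := u (s + a) - u s.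
  have shift (s c : C) : is_cderiv u (s + a) c -> is_cderiv (fun t => u (t + a)) s c.
    move=> H eps /H[del del0 {}H]; exists del => // w wd.
    by have := H (w + a); rewrite opprD addrACA subrr addr0; apply.
  have Hg (s c c' : C) : is_cderiv u (s + a) c -> is_cderiv u s c' ->
      is_cderiv g s (c - c').
    move=> /shift H1 H2; have := is_cderivD H1 (is_cderivM (is_cderiv_cst (-1) s) H2).
    rewrite mul0r add0r mulN1r; congr (is_cderiv _ _ _).
    by apply/funext => t; rewrite mulN1r.
  have -> : 128 * M / rho ^+ 2 = 4 * (8 * M / rho) / (rho / 4) by field; lra.
  apply: (@cauchy_estimate _ g 0).
  - by lra.
  - move=> s; rewrite subr0 => sr.
    have [|c Hc] := Hu (s + a); first by apply: le_trans (cmodD _ _) _; lra.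
    have [|c' Hc'] := Hu s; first by lra.
    by exists (c - c'); exact: Hg.
  - by apply: Hg => //; rewrite add0r.
  - move=> s; rewrite subr0 => sr; apply: le_trans (lipu _ _ a1 sr) _.
    by apply: ler_piMr => //; apply: divr_ge0; [exact: mulr_ge0|exact: ltW].
pose h s := u s + (- lin d v) * s.
have Hh (s c : C) : is_cderiv u s c -> is_cderiv h s (c - lin d v).
  move=> H; have := is_cderivD H (is_cderivM (is_cderiv_cst (- lin d v) s) (is_cderiv_id s)).
  by rewrite mul0r add0r mulr1.
have := @mean_value_bound _ h 0 1 (128 * M / rho ^+ 2).
rewrite cmod1 mulr1 add0r /h mulr0 addr0 mulr1 /u scale1r scale0r addr0.
have -> : 128 * M / rho ^+ 2 = 128 * M / r ^+ 2 * nrm v ^+ 2.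
  by rewrite /rho; field; rewrite !gt_eqF.
have -> : f (z + v) + - lin d v - f z = f (z + v) - f z - lin d v by ring.
apply=> t t01; have t1 : cmod (0 + (t%:C)%C * 1 : C) <= 1.
  by rewrite add0r mulr1 cmod_real ger0_norm; case/andP: t01.
have [|e He] := Hu (0 + (t%:C)%C * 1); first lra.
exists (e - lin d v); first exact: Hh.
have := lipu' _ _ t1 He; have -> // : 128 * M / rho ^+ 2 = 128 * M / r ^+ 2 * nrm v ^+ 2.
by rewrite /rho; field; rewrite !gt_eqF.
Qed.

Definition cconv (u : nat -> C) (l : C) := forall eps : R, 0 < eps ->
  exists N, forall m, (N <= m)%N -> cmod (u m - l) <= eps.

Lemma cconv_complete (u : nat -> C) :
  (forall eps : R, 0 < eps -> exists N, forall i j, (N <= i)%N -> (N <= j)%N ->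
     cmod (u i - u j) <= eps) -> exists l, cconv u l.
Proof.
move=> H.
have real_case (x : nat -> R) : (forall eps : R, 0 < eps -> exists N, forall i j,
    (N <= i)%N -> (N <= j)%N -> `|x i - x j| <= eps) -> exists l : R, forall eps : R, 0 < eps ->
    exists N, forall i, (N <= i)%N -> `|x i - l| <= eps.
  move=> Hx; have cx : cvgn x.
    apply/cauchy_cvgP; apply: cauchy_exP => e e0.
    have [N HN] := Hx _ (divr_gt0 e0 (ltr0n _ 2)).
    exists (x N), N => // i /= Ni; rewrite -ball_normE /=.
    by apply: le_lt_trans (HN _ _ (leqnn N) Ni) _; rewrite ltr_pdivrMr// ltr_pMr// ltr1n.
  exists (limn x) => e e0; move/cvgrPdist_le: cx => /(_ _ e0)[N _ HN].
  by exists N => i /HN; rewrite distrC.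
have [e e0|a Ha] := real_case (fun i => complex.Re (u i)).
  have [N HN] := H _ e0; exists N => i j Ni Nj; rewrite -raddfB.
  exact: le_trans (ler_Re_cmod _) (HN _ _ Ni Nj).
have [e e0|b Hb] := real_case (fun i => complex.Im (u i)).
  have [N HN] := H _ e0; exists N => i j Ni Nj; rewrite -raddfB.
  exact: le_trans (ler_Im_cmod _) (HN _ _ Ni Nj).
exists (a +i* b)%C => e e0; have e2 : 0 < e / 2 by rewrite divr_gt0.
have [N HN] := Ha _ e2; have [M HM] := Hb _ e2.
exists (maxn N M) => i; rewrite geq_max => /andP[/HN h1 /HM h2].
apply: le_trans (cmod_ReIm _) _; rewrite !raddfB /=; lra.
Qed.

Lemma cconv_le (u : nat -> C) (l c : C) (B : R) : cconv u l ->
  (exists N, forall m, (N <= m)%N -> cmod (u m - c) <= B) -> cmod (l - c) <= B.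
Proof.
move=> ul [N HN]; apply/ler_addgt0Pr => e /ul[N' HN'].
have h1 := HN _ (leq_maxl N N'); have h2 := HN' _ (leq_maxr N N').
rewrite -[l - c](subrK (u (maxn N N'))) -addrA addrACA addrC.
rewrite (_ : _ + _ = (u (maxn N N') - c) + (l - u (maxn N N'))); last by ring.
by apply: le_trans (cmodD _ _) _; rewrite lerD// cmod_distC.
Qed.

Lemma cconvD (u u' : nat -> C) (l l' : C) : cconv u l -> cconv u' l' ->
  cconv (fun m => u m + u' m) (l + l').
Proof.
move=> H H' e e0; have e2 : 0 < e / 2 by rewrite divr_gt0.
have [N HN] := H _ e2; have [M HM] := H' _ e2.
exists (maxn N M) => i; rewrite geq_max => /andP[/HN h1 /HM h2].
rewrite opprD addrACA; apply: le_trans (cmodD _ _) _; lra.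
Qed.

Lemma cconvZ (a : C) (u : nat -> C) (l : C) : cconv u l ->
  cconv (fun m => a * u m) (a * l).
Proof.
move=> H e e0; have k0 : 0 < 1 + cmod a by rewrite ltr_pwDl// cmod_ge0.
have [N HN] := H _ (divr_gt0 e0 k0); exists N => m /HN h.
rewrite -mulrBr cmodM; apply: le_trans (ler_wpM2l (cmod_ge0 a) h) _.
by rewrite mulrA ler_pdivrMr// mulrC ler_wpM2l ?ltW// ltrDr.
Qed.

Lemma cconv_cst (c : C) : cconv (fun=> c) c.
Proof. by move=> e e0; exists 0%N => m _; rewrite subrr cmod0 ltW. Qed.

Lemma cconv_unique (u : nat -> C) (l l' : C) : cconv u l -> cconv u l' -> l = l'.
Proof.
move=> H H'; apply/eqP; rewrite -subr_eq0 -cmod_eq0; apply/eqP/le_anti.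
rewrite cmod_ge0 andbT; apply/ler_addgt0Pr => e e0; rewrite add0r.
exact: cconv_le H (H' _ e0).
Qed.

(** Locally uniform limits of holomorphic functions are holomorphic: the
    second-order Taylor bound is uniform along the sequence and passes to the
    limit. *)
Theorem weierstrass (f_ : nat -> Cn -> C) f z (r : R) : 0 < r ->
  (forall m, hol_ball (f_ m) z r) ->
  (forall eps : R, 0 < eps -> exists N, forall m, (N <= m)%N ->
     forall w, nrm (w - z) <= r -> cmod (f_ m w - f w) <= eps) ->
  exists2 d, is_grad f z d &
    forall (d_ : nat -> 'I_n.+1 -> C) k, (forall m, is_grad (f_ m) z (d_ m)) -> cconv (fun m => d_ m k) (d k).
Proof.
move=> r0 Hf Hu.
have zz : nrm (z - z) <= r by rewrite subrr nrm0 ltW.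
have /choice[D HD] : forall m, exists d, is_grad (f_ m) z d by move=> m; exact: (Hf m z zz).
have /choice[d Hd] : forall k, exists l, cconv (fun m => D m k) l.
  move=> k; apply: cconv_complete => e e0.
  have er : 0 < e * r / 8 by rewrite !mulr_gt0.
  have [N HN] := Hu _ er; exists N => i j Ni Nj.
  have -> : e = 4 * (2 * (e * r / 8)) / r by field; rewrite gt_eqF.
  apply: (@cauchy_estimate_coord (fun w => f_ i w - f_ j w) z r _ (fun k => D i k - D j k)) => //.
  - move=> w wr; have [di hi] := Hf i w wr; have [dj hj] := Hf j w wr.
    by eexists; exact: is_gradB hi hj.
  - move=> w wr; rewrite (_ : f_ i w - f_ j w = (f_ i w - f w) - (f_ j w - f w)); last by ring.
    by apply: le_trans (cmodB _ _) _; have := HN _ Ni _ wr; have := HN _ Nj _ wr; lra.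
  - exact: is_gradB.
exists d; last first.
  move=> d_ k Hd_; have -> // : (fun m => d_ m k) = (fun m => D m k).
  by apply/funext => m; rewrite -(is_gradE _ (Hd_ m)) -(is_gradE _ (HD m)).
have [N HN] := Hu 1 ltr01.
have [dN HdN] := Hf N z zz.
have [s0 s00 Hs0] := is_grad_cts HdN ltr01.
pose s := Num.min r (s0 / 2).
have s_gt0 : 0 < s by rewrite lt_min r0 divr_gt0.
have sr : s <= r by rewrite ge_min lexx.
pose M := cmod (f_ N z) + 3.
have fM m w : (N <= m)%N -> nrm (w - z) <= s -> cmod (f_ m w) <= M.
  move=> Nm ws; have wr := le_trans ws sr.
  have h1 := HN _ Nm _ wr; have h2 := HN _ (leqnn N) _ wr.
  have h3 : cmod (f_ N w - f_ N z) < 1.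
    apply: Hs0; apply: (le_lt_trans ws); rewrite gt_min; apply/orP; right.
    by rewrite ltr_pdivrMr// ltr_pMr// ltr1n.
  rewrite (_ : f_ m w = (f_ m w - f w) - (f_ N w - f w) + (f_ N w - f_ N z) + f_ N z);
    last by ring.
  apply: le_trans (cmodD _ _) _; apply: le_trans (lerD (cmodD _ _) (lexx _)) _.
  apply: le_trans (lerD (lerD (cmodB _ _) (lexx _)) (lexx _)) _.
  rewrite /M; lra.
have M0 : 0 <= M by rewrite addr_ge0 ?cmod_ge0.
pose K := 128 * M / s ^+ 2.
have K0 : 0 <= K by rewrite divr_ge0 ?mulr_ge0 ?exprn_ge0 ?(ltW s_gt0).
have bound v : nrm v <= s / 4 -> cmod (f (z + v) - f z - lin d v) <= K * nrm v ^+ 2.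
  move=> vs; rewrite -[X in cmod X]subr0.
  apply: (@cconv_le (fun m => f_ m (z + v) - f_ m z - lin (D m) v)); last first.
    exists N => m Nm; rewrite subr0; apply: taylor2 => //.
    - by move=> w ws; apply: Hf; exact: le_trans ws sr.
    - by move=> w; apply: fM.
  have fc w : nrm (w - z) <= r -> cconv (fun m => f_ m w) (f w).
    by move=> wr e /Hu[N' HN']; exists N' => m /HN'; apply.
  have zvr : nrm (z + v - z) <= r by rewrite addrAC subrr add0r; have := sr; lra.
  have c1 := fc _ zvr; have c2 := cconvZ (-1) (fc _ zz).
  have c3 : cconv (fun m => lin (D m) v) (lin d v).
    rewrite /lin; elim: (index_enum _) => [|k t IH].
      by under eq_fun do rewrite big_nil; rewrite big_nil; exact: cconv_cst.
    by under eq_fun do rewrite big_cons; rewrite big_cons; apply: cconvD IH; exact: cconvZ.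
  have := cconvD (cconvD c1 c2) (cconvZ (-1) c3); rewrite !mulN1r; congr (cconv _ _).
  by apply/funext => m; rewrite !mulN1r.
move=> e e0; have k0 : 0 < 1 + K by rewrite ltr_pwDl.
exists (Num.min (s / 4) (e / (1 + K))); first by rewrite lt_min !divr_gt0.
move=> v; rewrite lt_min => /andP[/ltW/bound vb ve].
apply: (le_trans vb); rewrite expr2 mulrA ler_wpM2r ?nrm_ge0//.
move: ve; rewrite ltr_pdivlMr// => ve; have := nrm_ge0 v; lra.
Qed.

(** By [taylor2], difference quotients converge to the derivative locally
    uniformly. *)
Lemma pderiv_hol f z (r : R) k : 0 < r -> hol_ball f z r ->
  exists d, is_grad (fun w => 'D_(delta_mx ord0 k) f w) z d.
Proof.
move=> r0 Hf.
have zz : nrm (z - z) <= r by rewrite subrr nrm0 ltW.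
have [dz Hdz] := Hf z zz; have [s0 s00 Hs0] := is_grad_cts Hdz ltr01.
pose s := Num.min r (s0 / 2).
have s_gt0 : 0 < s by rewrite lt_min r0 divr_gt0.
have sr : s <= r by rewrite ge_min lexx.
pose M := cmod (f z) + 1.
have M0 : 0 <= M by rewrite addr_ge0 ?cmod_ge0.
have fM w : nrm (w - z) <= s -> cmod (f w) <= M.
  move=> ws; have h3 : cmod (f w - f z) < 1.
    apply: Hs0; apply: (le_lt_trans ws); rewrite gt_min; apply/orP; right.
    by rewrite ltr_pdivrMr// ltr_pMr// ltr1n.
  rewrite -(subrK (f z) (f w)); apply: le_trans (cmodD _ _) _; rewrite /M; lra.
pose K := 128 * M / (s / 2) ^+ 2.
have K0 : 0 <= K by rewrite divr_ge0 ?mulr_ge0 ?exprn_ge0 ?divr_ge0 ?(ltW s_gt0).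
pose t (m : nat) : R := s / 8 / m.+1%:R.
have t0 m : 0 < t m by rewrite !divr_gt0.
have ts m : t m <= s / 8 by rewrite ler_pdivrMr// ler_peMr ?ler1n// divr_ge0// ltW.
pose dk := delta_mx ord0 k : Cn.
pose f_ m w := ((t m)^-1%:C)%C * (f (w + ((t m)%:C)%C *: dk) - f w).
have tk m : nrm (((t m)%:C)%C *: dk) <= t m.
  by apply: le_trans (nrm_delta _ _) _; rewrite cmod_real ger0_norm// ltW.
have [|m w ws|e e0|d Hd _] := @weierstrass f_ (fun w => 'D_dk f w) z (s / 4).
- by rewrite divr_gt0.
- have h1 : nrm (w - z) <= r by lra.
  have h2 : nrm (w + ((t m)%:C)%C *: dk - z) <= r.
    by rewrite addrAC; apply: le_trans (nrmD _ _) _; have := tk m; have := ts m; lra.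
  have [d1 H1] := Hf _ h1; have [d2 H2] := Hf _ h2.
  by eexists; apply: is_gradZ; apply: is_gradB H1; apply: is_grad_shift; exact: H2.
- have e' : 0 < e / (1 + K) / (s / 8) by rewrite !divr_gt0// ltr_pwDl.
  exists (Num.bound (e / (1 + K) / (s / 8))^-1) => m hm w ws.
  have tm : t m <= e / (1 + K).
    have E0 : 0 < e / (1 + K) by rewrite divr_gt0// ltr_pwDl.
    have : (e / (1 + K) / (s / 8))^-1 < m.+1%:R.
      apply: lt_le_trans (archi_boundP _) _; first by rewrite invr_ge0 ltW.
      by rewrite ler_nat (leq_trans hm).
    by move=> /ltW; rewrite invf_div ler_pdivrMr// /t => h; rewrite ler_pdivrMr// [leRHS]mulrC.
  have h1 : nrm (w - z) <= r by lra.
  have [d1 H1] := Hf _ h1.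
  rewrite (is_gradE k H1).
  have Ht : 0 < t m := t0 m.
  have -> : f_ m w - d1 k = ((t m)^-1%:C)%C *
     (f (w + ((t m)%:C)%C *: dk) - f w - lin d1 (((t m)%:C)%C *: dk)).
    by rewrite linZ lin_delta mulrBr [in X in _ = _ - X]mulrA -rmorphM mulVf ?gt_eqF// mul1r.
  rewrite cmodM cmod_real ger0_norm ?invr_ge0 ?(ltW Ht)// mulrC ler_pdivrMr//.
  have h4 v : nrm (v - w) <= s / 2 -> nrm (v - z) <= s.
    by move=> vw; rewrite -(subrK w v) -addrA; apply: le_trans (nrmD _ _) _; lra.
  have kt := tk m; have tss := ts m.
  apply: le_trans (@taylor2 f w (s / 2) M d1 _ _ _ _ H1 _) _.
  + by rewrite divr_gt0.
  + by move=> v /h4 vs; apply: Hf; exact: le_trans vs sr.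
  + by move=> v /h4; exact: fM.
  + lra.
  + apply: (@le_trans _ _ (K * t m ^+ 2)).
      by rewrite ler_wpM2l// ler_pXn2r ?nnegrE ?nrm_ge0 ?(ltW Ht).
    rewrite expr2 mulrA ler_wpM2r ?(ltW Ht)//.
    move: tm; rewrite ler_pdivlMr ?ltr_pwDl// => tm; have := ltW Ht; lra.
by exists d.
Qed.

End several_variables.

(** * Lebesgue measure on C^n and mean value inequalities *)

Lemma integral_mulEl d (T : measurableType d) (R : realType)
    (m : {measure set T -> \bar R}) (k : R) (f : T -> \bar R) : 0 <= k ->
  measurable_fun setT f -> (forall x, 0 <= f x)%E ->
  (\int[m]_x (k%:E * f x) = k%:E * \int[m]_x f x)%E.
Proof. by move=> k0 mf f0; apply: ge0_integralZl_EFin. Qed.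

Section affine_change_of_variable.
Variable R : realType.
Local Notation leb := (@lebesgue_measure R).

Lemma measurable_affine (c b : R) :
  measurable_fun setT (fun x : measurableTypeR R => c * x + b : measurableTypeR R).
Proof.
by apply: measurable_funD => //; apply: measurable_funM.
Qed.

Lemma lebesgue_affine_preimage (c b : R) (X : set R) : c != 0 -> ocitv X ->
  leb X = (`|c|%:E * leb ((fun x => (c * x + b)%R) @^-1` X))%E.
Proof.
move=> c0 /ocitvP[->|[[u v] /= uv ->]]; first by rewrite preimage_set0 measure0 mule0.
have [cp|cn|c00] := ltrgt0P c; last by rewrite c00 eqxx in c0.
- have -> : (fun x => (c * x + b)%R) @^-1` `]u, v] = `](u - b) / c, (v - b) / c]%classic.
    by apply/seteqP; split => x /=; rewrite !in_itv /= ltr_pdivrMr// ler_pdivlMr// mulrC;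
      move=> /andP[? ?]; apply/andP; split; lra.
  rewrite !lebesgue_measure_itv /= !lte_fin uv ltr_pM2r ?invr_gt0// ltrD2r uv.
  by rewrite -!EFinD -EFinM; congr (_%:E); field; rewrite gt_eqF.
- have -> : (fun x => (c * x + b)%R) @^-1` `]u, v] = `[(v - b) / c, (u - b) / c[%classic.
    by apply/seteqP; split => x /=; rewrite !in_itv /= ltr_ndivlMr// ler_ndivrMr// mulrC;
      move=> /andP[? ?]; apply/andP; split; lra.
  rewrite !lebesgue_measure_itv /= !lte_fin uv ltr_nM2r ?invr_lt0// ltrD2r uv.
  by rewrite -!EFinD -EFinM; congr (_%:E); field; rewrite lt_eqF.
Qed.

(** The image of Lebesgue measure under [x |-> c x + b], multiplied by [`|c|],
    agrees with it on intervals. *)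
Lemma integral_affine (c b : R) (f : R -> \bar R) : c != 0 ->
  measurable_fun setT f -> (forall x, 0 <= f x)%E ->
  (\int[leb]_x f (c * x + b)%R = (`|c|^-1)%:E * \int[leb]_x f x)%E.
Proof.
move=> c0 mf f0.
pose m' := measure_function_pushforward__canonical__measure_function_Measure
  leb (measurable_affine c b).
have cpos : 0 < `|c| by rewrite normr_gt0.
pose k : {nonneg R} := NngNum (ltW cpos).
have E : (\int[leb]_x f x = \int[mscale k m']_x f x)%E.
  apply: eq_measure_integral => A mA _.
  apply: (@lebesgue_measure_unique R (mscale k m')) => // X oX.
  exact: lebesgue_affine_preimage.
rewrite E ge0_integral_mscale// /m' /=.
rewrite (@ge0_integral_pushforward _ _ _ _ _ _ (measurable_affine c b))//.
by rewrite muleA -EFinM mulVf ?gt_eqF// mul1e preimage_setT.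
Qed.

End affine_change_of_variable.

Section tuple_integrals.
Variable R : realType.
Local Notation leb := (@lebesgue_measure R).
Local Notation plane := (plane R).
Local Notation lplane := (@lebesgue_plane R).
Local Notation mu := (@lebesgue_tuple R).

Lemma plane_integral (f : plane -> \bar R) : measurable_fun setT f ->
  (forall p, 0 <= f p)%E ->
  (\int[lplane]_p f p = \int[leb]_x \int[leb]_y f (x, y))%E.
Proof. by move=> mf f0; exact: (@fubini_tonelli1 _ _ _ _ _ leb leb f mf f0). Qed.

Lemma plane_integral_swap (f : plane -> \bar R) : measurable_fun setT f ->
  (forall p, 0 <= f p)%E ->
  (\int[lplane]_p f p = \int[leb]_y \int[leb]_x f (x, y))%E.
Proof. by move=> mf f0; exact: (@fubini_tonelli2 _ _ _ _ _ leb leb f mf f0). Qed.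

Lemma tuple_integral n (f : n.+1.-tuple plane -> \bar R) : measurable_fun setT f ->
  (forall p, 0 <= f p)%E ->
  (\int[mu n.+1]_x f x = \int[lplane]_p \int[mu n]_t f (tuple_cons (p, t)))%E.
Proof.
move=> mf f0.
have mc := @measurable_tuple_cons _ plane n.
rewrite (_ : (\int[mu n.+1]_x f x)%E =
  (\int[pushforward (product_sigma_finite lplane (mu n)) (@tuple_cons _ plane n)]_x f x)%E)//.
rewrite (ge0_integral_pushforward mc)// preimage_setT.
apply: (@fubini_tonelli1 _ _ _ _ _ lplane (mu n) (f \o @tuple_cons _ plane n)) => //=.
exact: measurableT_comp.
Qed.

Lemma tuple_integral0 (f : 0.-tuple plane -> \bar R) : (\int[mu 0]_x f x = f [tuple])%E.
Proof.
rewrite (_ : f = fun=> f [tuple]); last by apply/funext => x; rewrite [x]tuple0.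
rewrite integral_cst//= diracE in_setT mule1 //.
Qed.

Lemma measurable_tuple_section n (f : n.+1.-tuple plane -> \bar R) (p : plane) :
  measurable_fun setT f -> measurable_fun setT (fun t => f (tuple_cons (p, t))).
Proof.
move=> mf; apply: measurableT_comp => //.
by apply: (measurable_cons (measurable_cst _)); exact: measurable_id.
Qed.

Lemma measurable_tuple_cons_l n (x : n.-tuple plane) :
  measurable_fun setT (fun p => tuple_cons (p, x)).
Proof. exact: measurableT_comp (@measurable_tuple_cons _ _ _) (measurable_pair2 x). Qed.

Lemma measurable_tuple_integral n (f : n.+1.-tuple plane -> \bar R) :
  measurable_fun setT f -> (forall p, 0 <= f p)%E ->
  measurable_fun setT (fun p => \int[mu n]_t f (tuple_cons (p, t)))%E.
Proof.
move=> mf f0.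
apply: (@measurable_fun_fubini_tonelli_F _ _ _ _ _ (mu n) (f \o @tuple_cons _ plane n)) => //=.
by apply: measurableT_comp => //; exact: measurable_tuple_cons.
Qed.

Definition scale_plane (t : R) (p : plane) : plane := (t * p.1, t * p.2).

Definition scale_tuple n (t : R) (x : n.-tuple plane) : n.-tuple plane :=
  [tuple of map (scale_plane t) x].

Lemma measurable_scale_plane t : measurable_fun setT (scale_plane t).
Proof.
apply/measurable_fun_pairP; split => /=; rewrite /comp /=.
  by apply: measurable_funM => //; exact: measurable_fst.
by apply: measurable_funM => //; exact: measurable_snd.
Qed.

Lemma measurable_scale_tuple n t : measurable_fun setT (@scale_tuple n t).
Proof.
apply/measurable_fun_tnthP => i; rewrite (_ : _ \o _ = scale_plane t \o (@tnth n plane ^~ i)).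
  by apply: measurableT_comp; [exact: measurable_scale_plane|exact: measurable_tnth].
by apply/funext => x /=; rewrite tnth_map.
Qed.

Lemma scale_tuple_cons n t p (x : n.-tuple plane) :
  scale_tuple t (tuple_cons (p, x)) = tuple_cons (scale_plane t p, scale_tuple t x).
Proof. exact: val_inj. Qed.

Definition affine_plane (c b c' b' : R) (p : plane) : plane :=
  (c * p.1 + b, c' * p.2 + b').

Lemma measurable_affine_plane c b c' b' :
  measurable_fun setT (affine_plane c b c' b').
Proof.
apply/measurable_fun_pairP; split => /=; rewrite /comp /=.
- exact: measurableT_comp (measurable_affine c b) measurable_fst.
- exact: measurableT_comp (measurable_affine c' b') measurable_snd.
Qed.

Lemma integral_affine_plane (c b c' b' : R) (f : plane -> \bar R) : c != 0 -> c' != 0 ->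
  measurable_fun setT f -> (forall p, 0 <= f p)%E ->
  (\int[lplane]_p f (affine_plane c b c' b' p)
     = (`|c|^-1 * `|c'|^-1)%:E * \int[lplane]_p f p)%E.
Proof.
move=> c0 c'0 mf f0.
have mfs : measurable_fun setT (fun p => f (affine_plane c b c' b' p)).
  by apply: measurableT_comp mf _; exact: measurable_affine_plane.
have ti : 0 <= `|c'|^-1 by rewrite invr_ge0.
rewrite plane_integral// [in RHS]plane_integral//.
pose F (x : R) := (\int[leb]_y f (x, y))%E.
have mF : measurable_fun setT F.
  exact: (@measurable_fun_fubini_tonelli_F _ _ _ _ _ leb f).
have F0 x : (0 <= F x)%E by apply: integral_ge0.
transitivity (\int[leb]_x ((`|c'|^-1)%:E * F (c * x + b)%R))%E.
  apply: eq_integral => x _.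
  rewrite /F -(@integral_affine R c' b' (fun y => f ((c * x + b)%R, y)))//.
  by apply: measurableT_comp mf _; exact: measurable_pair1.
rewrite integral_mulEl; [|exact: ti| |by move=> x; apply: F0]; last first.
  exact: (measurableT_comp mF (measurable_affine c b)).
by rewrite (integral_affine b c0 mF F0) muleA -EFinM mulrC.
Qed.

Lemma integral_scale_plane (t : R) (f : plane -> \bar R) : 0 < t ->
  measurable_fun setT f -> (forall p, 0 <= f p)%E ->
  (\int[lplane]_p f (scale_plane t p) = ((t^-1) ^+ 2)%:E * \int[lplane]_p f p)%E.
Proof.
move=> t0 mf f0; have tn : t != 0 by rewrite gt_eqF.
have := integral_affine_plane 0 0 tn tn mf f0.
rewrite (gtr0_norm t0) -expr2 => <-; apply: eq_integral => p _.
by rewrite /affine_plane !addr0.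
Qed.

Lemma measurable_swap_plane : measurable_fun setT (fun p : plane => (p.2, p.1) : plane).
Proof.
by apply/measurable_fun_pairP; split => /=; [exact: measurable_snd|exact: measurable_fst].
Qed.

Lemma integral_swap_plane (f : plane -> \bar R) :
  measurable_fun setT f -> (forall p, 0 <= f p)%E ->
  (\int[lplane]_p f (p.2, p.1) = \int[lplane]_p f p)%E.
Proof.
move=> mf f0; rewrite plane_integral; last by [].
  by rewrite [RHS]plane_integral_swap.
exact: measurableT_comp mf measurable_swap_plane.
Qed.

Lemma integral_scale_tuple n (t : R) (f : n.-tuple plane -> \bar R) : 0 < t ->
  measurable_fun setT f -> (forall p, 0 <= f p)%E ->
  (\int[mu n]_x f (scale_tuple t x) = ((t^-1) ^+ (2 * n))%:E * \int[mu n]_x f x)%E.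
Proof.
move=> t0; elim: n f => [|n IH] f mf f0.
  by rewrite !tuple_integral0 muln0 expr0 mul1e (tuple0 (scale_tuple _ _)).
have mfs : measurable_fun setT (fun x => f (scale_tuple t x)).
  by apply: measurableT_comp mf _; exact: measurable_scale_tuple.
rewrite tuple_integral// [in RHS]tuple_integral//.
have mF := measurable_tuple_integral mf f0.
transitivity (\int[lplane]_p (((t^-1) ^+ (2 * n))%:E *
    \int[mu n]_s f (tuple_cons (scale_plane t p, s))))%E.
  apply: eq_integral => p _; rewrite -IH//; last exact: measurable_tuple_section.
  by apply: eq_integral => s _; rewrite scale_tuple_cons.
have ti : 0 <= t^-1 by rewrite invr_ge0 ltW.
rewrite integral_mulEl; [|exact: exprn_ge0| |by move=> x; apply: integral_ge0]; last first.
  exact: (measurableT_comp mF (measurable_scale_plane t)).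
rewrite (integral_scale_plane t0 mF); last by move=> p; apply: integral_ge0.
by rewrite muleA -EFinM -exprD mulnS addnC.
Qed.

Definition sq (a : plane) (r : R) : set plane :=
  [set p | `|p.1 - a.1| < r /\ `|p.2 - a.2| < r].

Definition box n (a : n.-tuple plane) (r : R) : set (n.-tuple plane) :=
  [set x | forall k, sq (tnth a k) r (tnth x k)].

Lemma sqE a r : sq a r = ball (a.1 : R) r `*` ball (a.2 : R) r.
Proof.
by apply/seteqP; split => -[u v] /= [h1 h2]; split; move: h1 h2;
  rewrite /ball /= distrC ?(distrC v).
Qed.

Lemma measurable_sq a r : measurable (sq a r).
Proof. by rewrite sqE; apply: measurableX; exact: measurable_ball. Qed.

Lemma measurable_box n (a : n.-tuple plane) r : measurable (box a r).
Proof.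
rewrite (_ : box a r = \big[setI/setT]_(k < n) ((@tnth n plane ^~ k) @^-1` sq (tnth a k) r)).
  apply: big_rec => // k A _ mA; apply: measurableI => //.
  rewrite -[X in measurable X]setTI.
  by apply: measurable_tnth => //; exact: measurable_sq.
apply/seteqP; split => x; rewrite -bigcap_seq => H k; first by move=> _; exact: H.
exact: (H k (mem_index_enum k)).
Qed.

Lemma measure_sq a r : 0 < r -> lplane (sq a r) = ((2 * r) ^+ 2)%:E.
Proof.
move=> r0; rewrite sqE.
have := @product_measure1E _ _ _ _ _ leb leb (ball (a.1 : R) r) (ball (a.2 : R) r).
rewrite /lebesgue_plane /= /product_sigma_finite => ->; try exact: measurable_ball.
rewrite !lebesgue_measure_ball ?(ltW r0)// -EFinM expr2 mulr_natl; congr (_%:E).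
Qed.

Lemma box_cons n (a0 p : plane) (a x : n.-tuple plane) r :
  box (tuple_cons (a0, a)) r (tuple_cons (p, x)) <-> sq a0 r p /\ box a r x.
Proof.
split.
- move=> H; split; first by have := H ord0; rewrite !tnth0.
  by move=> k; have := H (lift ord0 k); rewrite !tnthS.
- move=> [H0 H] k; case: (unliftP ord0 k) => [j ->|->]; rewrite ?tnthS ?tnth0//.
Qed.

Lemma tuple_consP n (x : n.+1.-tuple plane) : exists p t, x = tuple_cons (p, t).
Proof.
by exists (thead x), [tuple of behead x]; rewrite [LHS]tuple_eta; exact: val_inj.
Qed.

Lemma measure_box n (a : n.-tuple plane) r : 0 < r -> mu n (box a r) = ((2 * r) ^+ (2 * n))%:E.
Proof.
move=> r0; elim: n a => [|n IH] a.
  rewrite /= diracE mem_set ?muln0 ?expr0// => -[].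
  by [].
have [a0 [a' ->]] := tuple_consP a.
rewrite (_ : mu n.+1 _ = (lplane \x mu n)%E (sq a0 r `*` box a' r)); last first.
  rewrite /= /tuple_measure_step /pushforward /product_sigma_finite; congr (_ _).
  by apply/seteqP; split => -[p x] /=; rewrite box_cons.
rewrite product_measure1E; [|exact: measurable_sq|exact: measurable_box].
transitivity (((2 * r) ^+ 2)%:E * ((2 * r) ^+ (2 * n))%:E)%E.
  by congr (_ * _)%E; [exact: measure_sq|exact: IH].
by rewrite -EFinM -exprD mulnS.
Qed.

End tuple_integrals.

Section measurability_on_Cn.
Variables (R : realType) (n : nat).
Local Notation C := R[i].
Local Notation Cn := 'rV[R[i]]_n.+1.
Local Notation plane := (plane R).
Local Notation pt := (@point_of R n.+1).
Implicit Types (U : set Cn).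

Lemma box_nrm (a x : n.+1.-tuple plane) r : box a r x -> nrm (pt x - pt a) <= 2 * r.
Proof.
move=> H; have [h1 h2] := H ord0; have r0 : 0 <= r by apply: le_trans (ltW h1).
apply: nrm_leP => [|k]; first by rewrite mulr_ge0.
rewrite !mxE; apply: le_trans (cmod_ReIm _) _ => /=.
by have [/ltW k1 /ltW k2] := H k; lra.
Qed.

Lemma nrm_box (a x : n.+1.-tuple plane) r : nrm (pt x - pt a) < r -> box a r x.
Proof.
move=> H k; have {}H := le_lt_trans (cmod_le_nrm _ k) H.
rewrite !mxE in H; split.
- by apply: le_lt_trans H; apply: le_trans (ler_Re_cmod _).
- by apply: le_lt_trans H; apply: le_trans (ler_Im_cmod _).
Qed.

Definition plane_of (z : Cn) : n.+1.-tuple plane :=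
  [tuple (complex.Re (z ord0 k), complex.Im (z ord0 k)) | k < n.+1].

Lemma plane_ofK z : pt (plane_of z) = z.
Proof. by apply/rowP => k; rewrite mxE tnth_mktuple /=; case: (z ord0 k). Qed.

(** An open set is a countable union of boxes with rational centres. *)
Lemma measurable_open U : open U -> measurable (pt @^-1` U).
Proof.
move=> oU.
pose I := ((n.+1.-tuple (rat * rat)) * nat)%type.
pose ctr (q : n.+1.-tuple (rat * rat)) : n.+1.-tuple plane :=
  [tuple of map (fun q : rat * rat => (ratr q.1, ratr q.2) : plane) q].
pose B (i : I) : set (n.+1.-tuple plane) := box (ctr i.1) (i.2.+1%:R^-1).
pose F (i : I) := if `[< B i `<=` pt @^-1` U >] then B i else set0.
have -> : pt @^-1` U = \bigcup_i F i.
  apply/seteqP; split => [x /= Ux|x [i _]]; last first.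
    by rewrite /F; case: ifPn => // /asboolP; apply.
  have [r r0 Hr] := open_nrm oU Ux.
  pose m := Num.bound (4 / r).
  have m0 : 0 < m.+1%:R^-1 :> R by rewrite invr_gt0.
  have mr : 4 * m.+1%:R^-1 < r.
    rewrite ltr_pdivrMr// -ltr_pdivrMl// mulrC.
    apply: lt_le_trans (archi_boundP _) _; first by rewrite divr_ge0// ltW.
    by rewrite ler_nat.
  move: m0 mr; set em := m.+1%:R^-1 => m0 mr.
  have approx (u : R) : exists q : rat, `|u - ratr q| < em.
    have [|q] := @rat_in_itvoo R (u - em) (u + em); first by lra.
    by rewrite in_itv /= => hq; exists q; rewrite ltr_norml; lra.
  have [q1 Hq1] := choice approx.
  pose q := [tuple (q1 (tnth x k).1, q1 (tnth x k).2) | k < n.+1].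
  have Bx : B (q, m) x.
    by move=> k; rewrite tnth_map tnth_mktuple; split; exact: Hq1.
  exists (q, m) => //; rewrite /F ifT//; apply/asboolP => y By; apply: Hr.
  rewrite -[pt y](subrK (pt (ctr q))) -addrA; apply: le_lt_trans (nrmD _ _) _.
  have h1 := box_nrm By; have := box_nrm Bx; rewrite nrm_distC => h2.
  by apply: (@le_lt_trans _ _ (2 * em + 2 * em)); [exact: lerD h1 h2|lra].
apply: countable_bigcupT_measurable; first exact: countableP.
move=> i; rewrite /F; case: ifP => _; [exact: measurable_box|exact: measurable0].
Qed.

Definition cts_at (f : Cn -> R) z := forall e : R, 0 < e -> exists2 del : R, 0 < del &
  forall w, nrm (w - z) < del -> `|f w - f z| < e.

Lemma measurable_cts (U : set Cn) (f : Cn -> R) : open U ->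
  (forall z, U z -> cts_at f z) ->
  measurable_fun (pt @^-1` U) (fun x => f (pt x) : measurableTypeR R).
Proof.
move=> oU cf mU; apply: (measurability _ (RGenOInfty.measurableE R)) => //.
move=> _ [_ [a ->] <-].
rewrite (_ : _ `&` _ = pt @^-1` (U `&` [set z | a < f z])); last first.
  by apply/seteqP; split => x [/= h1]; rewrite in_itv /= andbT.
apply: measurable_open; apply: nrm_open => z [Uz /= az].
have [r r0 Hr] := open_nrm oU Uz.
have fz : 0 < f z - a by rewrite subr_gt0.
have [s s0 Hs] := cf z Uz _ fz.
exists (Num.min r s); first by rewrite lt_min r0.
move=> w; rewrite lt_min => /andP[/Hr Uw /Hs]; rewrite ltr_norml => ws; split => //=; lra.
Qed.

End measurability_on_Cn.

Section area_mean_value.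
Variable R : realType.
Local Notation C := R[i].
Local Notation plane := (plane R).
Local Notation lplane := (@lebesgue_plane R).
Local Notation leb := (@lebesgue_measure R).

Definition cpx (p : plane) : C := (p.1 +i* p.2)%C.

(** [measurable_cts] in dimension one, carried over to the plane. *)
Lemma measurable_cmod_sq (f : C -> C) (a : plane) (r : R) :
  (forall p, sq a r p -> exists d, is_cderiv f (cpx p) d) ->
  measurable_fun (sq a r) (fun p => cmod (f (cpx p)) : measurableTypeR R).
Proof.
move=> Hf.
pose U : set 'rV[C]_1 := [set z | sq a r (complex.Re (z ord0 ord0), complex.Im (z ord0 ord0))].
pose g (z : 'rV[C]_1) := cmod (f (z ord0 ord0)).
have oU : open U.
  apply: nrm_open => z [/= h1 h2].
  pose e := Num.min (r - `|complex.Re (z ord0 ord0) - a.1|) (r - `|complex.Im (z ord0 ord0) - a.2|).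
  exists e; first by rewrite lt_min !subr_gt0 h1.
  move=> w; rewrite lt_min => /andP[w1 w2].
  have h := cmod_le_nrm (w - z) ord0; rewrite !mxE in h.
  have k1 := le_lt_trans (le_trans (ler_Re_cmod _) h) w1.
  have k2 := le_lt_trans (le_trans (ler_Im_cmod _) h) w2.
  rewrite raddfB in k1; rewrite raddfB in k2.
  split => /=.
  - rewrite -[X in X - a.1](subrK (complex.Re (z ord0 ord0))) -addrA.
    by apply: le_lt_trans (ler_normD _ _) _; rewrite -ltrBrDr.
  - rewrite -[X in X - a.2](subrK (complex.Im (z ord0 ord0))) -addrA.
    by apply: le_lt_trans (ler_normD _ _) _; rewrite -ltrBrDr.
have mg : measurable_fun (@point_of R 1 @^-1` U) (fun x => g (point_of x) : measurableTypeR R).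
  apply: measurable_cts => // z Uz e e0.
  have [d Hd] := Hf _ Uz; rewrite /cpx /= in Hd.
  have zE : (complex.Re (z ord0 ord0) +i* complex.Im (z ord0 ord0))%C = z ord0 ord0.
    by case: (z ord0 ord0).
  rewrite zE in Hd; have [del d0 H] := is_cderiv_cts Hd e0.
  exists del => // w wz.
  have /H : cmod (w ord0 ord0 - z ord0 ord0) < del.
    by apply: le_lt_trans wz; have := cmod_le_nrm (w - z) ord0; rewrite !mxE.
  apply: le_lt_trans; rewrite /g ler_norml.
  have k1 := cmodD (f (w ord0 ord0) - f (z ord0 ord0)) (f (z ord0 ord0)).
  have k2 := cmodD (f (z ord0 ord0) - f (w ord0 ord0)) (f (w ord0 ord0)).
  by rewrite !subrK in k1 k2; rewrite (cmod_distC (f (z _ _))) in k2; lra.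
have mt : measurable_fun (sq a r) (fun p : plane => tuple_cons (p, [tuple]) : 1.-tuple plane).
  by apply: measurable_funTS; exact: measurable_tuple_cons_l.
have E p : point_of (tuple_cons (p, [tuple]) : 1.-tuple plane) ord0 ord0 = cpx p.
  by rewrite mxE tnth0.
rewrite (_ : (fun p => _) = (fun x => g (point_of x)) \o
    (fun p : plane => tuple_cons (p, [tuple]) : 1.-tuple plane)); last first.
  by apply/funext => p; rewrite /g /= E.
apply: measurable_comp mg mt; first exact: measurable_open.
by move=> _ [p ap <-]; rewrite /U /= E.
Qed.

(** The bound by the sides of the square is integrated over the squares of
    half-side between [r / 2] and [r]; each of the four sides sweeps a part of
    the large square. *)
Lemma area_mean_value (f : C -> C) (a : plane) (r : R) : 0 < r ->
  (forall p, sq a r p -> exists d, is_cderiv f (cpx p) d) ->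
  ((cmod (f (cpx a)))%:E <=
   (4 / r ^+ 2)%:E * \int[lplane]_(p in sq a r) (cmod (f (cpx p)))%:E)%E.
Proof.
move=> r0 Hf; set c0 := cpx a.
pose F : plane -> \bar R := (fun p => (cmod (f (cpx p)))%:E) \_ (sq a r).
have mF : measurable_fun setT F.
  apply/(measurable_restrictT _ _).1; first exact: measurable_sq.
  by apply/measurable_EFinP; exact: measurable_cmod_sq.
have F0 p : (0 <= F p)%E.
  by rewrite /F patchE; case: ifP => // _; rewrite lee_fin cmod_ge0.
rewrite integral_mkcond -/F.
have n1 : (1 : R) != 0 := oner_neq0 R.
have nN1 : (-1 : R) != 0 by rewrite oppr_eq0 oner_eq0.
have nrm11 : (`|1 : R|^-1 * `|1 : R|^-1) = 1 by rewrite normr1 invr1 mulr1.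
have nrmN1 : (`|-1 : R|^-1 * `|1 : R|^-1) = 1 by rewrite normrN1 normr1 invr1 mulr1.
have nrmNN : (`|-1 : R|^-1 * `|-1 : R|^-1) = 1 by rewrite normrN1 invr1 mulr1.
(* The four rotations by right angles around [a]; those by a quarter turn are a
   reflection after the exchange [sw] of coordinates.  The sum [G] of the
   rotated functions has four times the integral of [F]. *)
pose A1 := affine_plane 1 a.1 1 a.2.
pose A2 := affine_plane (-1) a.1 1 a.2.
pose A4 := affine_plane (-1) a.1 (-1) a.2.
pose A3 := affine_plane 1 a.1 (-1) a.2.
pose sw (p : plane) : plane := (p.2, p.1).
have mA c b c' b' : measurable_fun setT (fun p => F (affine_plane c b c' b' p)).
  by apply: measurableT_comp mF _; exact: measurable_affine_plane.
have mAs c b c' b' : measurable_fun setT (fun p => F (affine_plane c b c' b' (sw p))).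
  by apply: measurableT_comp (mA _ _ _ _) _; exact: measurable_swap_plane.
have [F1 [m1 p1 I1 E1]] : exists F1 : plane -> \bar R, [/\ measurable_fun setT F1,
    forall p, (0 <= F1 p)%E, (\int[lplane]_p F1 p = \int[lplane]_p F p)%E &
    forall p, F1 p = F (A1 p)].
  exists (fun p => F (A1 p)); split=> //; first exact: mA.
  by rewrite (integral_affine_plane _ _ n1 n1 mF F0) nrm11 mul1e.
have [F4 [m4 p4 I4 E4]] : exists F1 : plane -> \bar R, [/\ measurable_fun setT F1,
    forall p, (0 <= F1 p)%E, (\int[lplane]_p F1 p = \int[lplane]_p F p)%E &
    forall p, F1 p = F (A4 p)].
  exists (fun p => F (A4 p)); split=> //; first exact: mA.
  by rewrite (integral_affine_plane _ _ nN1 nN1 mF F0) nrmNN mul1e.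
have [F2 [m2 p2 I2 E2]] : exists F1 : plane -> \bar R, [/\ measurable_fun setT F1,
    forall p, (0 <= F1 p)%E, (\int[lplane]_p F1 p = \int[lplane]_p F p)%E &
    forall p, F1 p = F (A2 (sw p))].
  exists (fun p => F (A2 (sw p))); split=> //; first exact: mAs.
  rewrite (integral_swap_plane (mA _ _ _ _)) //.
  by rewrite (integral_affine_plane _ _ nN1 n1 mF F0) nrmN1 mul1e.
have [F3 [m3 p3 I3 E3]] : exists F1 : plane -> \bar R, [/\ measurable_fun setT F1,
    forall p, (0 <= F1 p)%E, (\int[lplane]_p F1 p = \int[lplane]_p F p)%E &
    forall p, F1 p = F (A3 (sw p))].
  exists (fun p => F (A3 (sw p))); split=> //; first exact: mAs.
  rewrite (integral_swap_plane (mA _ _ _ _)) //.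
  by rewrite (integral_affine_plane _ _ n1 nN1 mF F0) mulrC nrmN1 mul1e.
pose G12 p := (F1 p + F2 p)%E; pose G123 p := (G12 p + F3 p)%E.
pose G p := (G123 p + F4 p)%E.
have mG12 : measurable_fun setT G12 by exact: emeasurable_funD m1 m2.
have mG123 : measurable_fun setT G123 by exact: emeasurable_funD mG12 m3.
have mG : measurable_fun setT G by exact: emeasurable_funD mG123 m4.
have G120 p : (0 <= G12 p)%E by rewrite adde_ge0.
have G1230 p : (0 <= G123 p)%E by rewrite adde_ge0.
have G0 p : (0 <= G p)%E by rewrite adde_ge0.
have IG : (\int[lplane]_p G p = 4%:E * \int[lplane]_p F p)%E.
  have iF0 : (0 <= \int[lplane]_p F p)%E by apply: integral_ge0.
  rewrite (ge0_integralD _ measurableT (fun p _ => G1230 p) mG123 (fun p _ => p4 p) m4).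
  rewrite (ge0_integralD _ measurableT (fun p _ => G120 p) mG12 (fun p _ => p3 p) m3).
  rewrite (ge0_integralD _ measurableT (fun p _ => p1 p) m1 (fun p _ => p2 p) m2).
  rewrite I1 I2 I3 I4; move: (integral _ _ _) iF0 => I iF0.
  have -> : 4%:E = (1%:E + 1%:E + 1%:E + 1%:E : \bar R)%E by rewrite -!EFinD; congr (_%:E); ring.
  by rewrite !ge0_muleDl ?mul1e// ?adde_ge0.
have side (s : R) : r / 2 <= s < r ->
    ((2 * cmod (f c0) * r)%:E <= \int[leb]_y G (s, y))%E.
  move=> /andP[rs sr]; have s0 : 0 < s by apply: lt_le_trans rs; rewrite divr_gt0.
  have Hg (z : C) : in_square s z -> exists d, is_cderiv (fun w => f (c0 + w)) z d.
    move=> [h1 h2]; have [|d Hd] := Hf (a.1 + complex.Re z, a.2 + complex.Im z).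
      by split; rewrite /= addrAC subrr add0r; [exact: le_lt_trans h1 sr|exact: le_lt_trans h2 sr].
    exists d => e /Hd[del d0 H]; exists del => // w wd.
    have E : cpx (a.1 + complex.Re z, a.2 + complex.Im z) = c0 + z.
      by rewrite /c0 /cpx /=; case: (z) => u v; simpc.
    by rewrite E in H; have := H (c0 + w); rewrite opprD addrACA subrr add0r; apply.
  have cs : cts_on (- s) s (fun y => cmod (rot_sum (fun w => f (c0 + w)) (s +i* y)%C)).
    apply: cts_on_side => y yr; apply: (is_cderiv_rot_sum Hg).
    by split => /=; [rewrite ger0_norm// ltW|rewrite ler_norml].
  apply: (@le_trans _ _ (int_itv (- s) s
      (fun y => cmod (rot_sum (fun w => f (c0 + w)) (s +i* y)%C)))%:E).
    rewrite lee_fin; apply: le_trans (value_le_sides s0 Hg).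
    rewrite addr0 [leRHS](_ : _ = cmod (f c0) * (4 * s)); last by ring.
    rewrite [leLHS](_ : _ = cmod (f c0) * (2 * r)); last by ring.
    by rewrite ler_wpM2l ?cmod_ge0//; clear -rs; lra.
  have ics := cts_on_integrable cs.
  rewrite /int_itv /Rintegral fineK; last exact: integrable_fin_num ics.
  apply: (@le_trans _ _ (\int[leb]_(y in `[(- s)%R, s]) G (s, y))%E); last first.
    apply: ge0_subset_integral => //.
    by apply: measurableT_comp mG _; exact: measurable_pair1.
  have mics := measurable_int leb ics.
  apply: ge0_le_integral => //.
  - by move=> y _; rewrite lee_fin cmod_ge0.
  - by apply: measurable_funTS; apply: measurableT_comp mG _; exact: measurable_pair1.
  move=> y /=; rewrite in_itv /= => ys.
  have inF (u v : R) : `|u| < r -> `|v| < r ->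
      F (a.1 + u, a.2 + v) = (cmod (f (c0 + (u +i* v)%C)))%:E.
    move=> ur vr; rewrite /F patchE mem_set; last by split; rewrite /= addrAC subrr add0r.
    by congr (cmod (f _))%:E; rewrite /c0 /cpx; simpc.
  have yr : `|y| < r by apply: le_lt_trans sr; rewrite ler_norml.
  have sr' : `|s| < r by rewrite ger0_norm// ltW.
  have -> : G (s, y) = (cmod (f (c0 + (s +i* y)%C)) + cmod (f (c0 + ('i%C * (s +i* y)%C)))
      + cmod (f (c0 + (- 'i%C * (s +i* y)%C))) + cmod (f (c0 + - (s +i* y)%C)))%:E.
    rewrite /G /G123 /G12 E1 E2 E3 E4 /A1 /A2 /A3 /A4 /sw /affine_plane /= !mul1r !mulN1r.
    rewrite !(addrC _ a.1) !(addrC _ a.2) !inF ?normrN// -!EFinD; congr (_%:E).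
    by congr (_ + _ + _ + _); congr (cmod (f (_ + _))); simpc.
  rewrite lee_fin /rot_sum; apply: le_trans (cmodD _ _) _; rewrite lerD2r.
  by apply: le_trans (cmodD _ _) _; rewrite lerD2r; exact: cmodD.
have main : ((cmod (f c0) * r ^+ 2)%:E <= 4%:E * \int[lplane]_p F p)%E.
  rewrite -IG (plane_integral mG G0).
  apply: (@le_trans _ _ (\int[leb]_(s in `[(r / 2)%R, r[) \int[leb]_y G (s, y))%E); last first.
    apply: ge0_subset_integral => //.
    - exact: (@measurable_fun_fubini_tonelli_F _ _ _ _ _ leb G).
    - by move=> s _; apply: integral_ge0.
  have -> : (cmod (f c0) * r ^+ 2)%:E =
      (\int[leb]_(s in `[(r / 2)%R, r[) (2 * cmod (f c0) * r)%:E)%E.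
    rewrite integral_cst//= lebesgue_measure_itv /= lte_fin ltr_pdivrMr// ltr_pMr// ltr1n.
    by rewrite -EFinD -EFinM; congr (_%:E); field.
  apply: ge0_le_integral => //.
  - by move=> s _; rewrite lee_fin !mulr_ge0 ?cmod_ge0// ltW.
  - apply: measurable_funTS.
    exact: (@measurable_fun_fubini_tonelli_F _ _ _ _ _ leb G).
have r2 : 0 < r ^+ 2 by rewrite exprn_gt0.
rewrite mulrC EFinM -muleA -[X in (X <= _)%E](_ : (r ^- 2)%:E * (cmod (f c0) * r ^+ 2)%:E = _)%E.
  by rewrite lee_wpmul2l// lee_fin invr_ge0 ltW.
by rewrite -EFinM; congr (_%:E); field; rewrite gt_eqF.
Qed.

End area_mean_value.

Section iterated_mean_value.
Variable R : realType.
Local Notation plane := (plane R).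
Local Notation lplane := (@lebesgue_plane R).
Local Notation mu := (@lebesgue_tuple R).

Definition tset n (x : n.-tuple plane) (k : 'I_n) (p : plane) : n.-tuple plane :=
  [tuple if j == k then p else tnth x j | j < n].

Lemma tset_cons0 n (q p : plane) (x : n.-tuple plane) :
  tset (tuple_cons (q, x)) ord0 p = tuple_cons (p, x).
Proof.
apply: eq_from_tnth => j; rewrite tnth_mktuple.
by case: (unliftP ord0 j) => [i ->|->]; rewrite ?tnthS ?tnth0// eqxx.
Qed.

Lemma tset_consS n (q p : plane) (x : n.-tuple plane) k :
  tset (tuple_cons (q, x)) (lift ord0 k) p = tuple_cons (q, tset x k p).
Proof.
apply: eq_from_tnth => j; rewrite tnth_mktuple.
case: (unliftP ord0 j) => [i ->|->]; by rewrite ?tnthS ?tnth0 ?tnth_mktuple// (inj_eq lift_inj).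
Qed.

(** Sub-mean-value property in each variable separately. *)
Definition separate_smv c n (G : n.-tuple plane -> \bar R) a r :=
  forall x k, box a r x -> tnth x k = tnth a k ->
  (G x <= c%:E * \int[lplane]_(p in sq (tnth a k) r) G (tset x k p))%E.

(** Induction on the dimension: the first variable is averaged for the others
    fixed, then Tonelli's theorem merges the two integrals. *)
Lemma iterated_mean_value c n (G : n.-tuple plane -> \bar R) a r : 0 <= c -> 0 < r ->
  measurable_fun setT G -> (forall x, 0 <= G x)%E -> separate_smv c G a r ->
  (G a <= (c ^+ n)%:E * \int[mu n]_(x in box a r) G x)%E.
Proof.
move=> c0 r0; elim: n G a => [|n IH] G a mG G0 smv.
  rewrite expr0 mul1e integral_mkcond tuple_integral0 patchE mem_set; last by case.
  by rewrite (tuple0 a).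
have [a0 [a' aE]] := tuple_consP a; subst a.
have aa (m : nat) (b : m.-tuple plane) : box b r b.
  by move=> k; split; rewrite subrr normr0.
have := smv (tuple_cons (a0, a')) ord0 (aa _ _) erefl; rewrite tnth0.
under eq_integral do rewrite tset_cons0.
move=> /le_trans; apply.
pose H : n.+1.-tuple plane -> \bar R := G \_ (box (tuple_cons (a0, a')) r).
have mH : measurable_fun setT H.
  apply/(measurable_restrictT _ _).1; first exact: measurable_box.
  exact: measurable_funTS.
have H0 x : (0 <= H x)%E by apply: erestrict_ge0.
have cn0 : 0 <= c ^+ n by rewrite exprn_ge0.
rewrite (integral_mkcond (box _ _)) -/H tuple_integral//.
rewrite exprS EFinM -muleA; apply: lee_wpmul2l; first by rewrite lee_fin.
rewrite -integral_mulEl//; last 2 first.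
- exact: measurable_tuple_integral.
- by move=> p; apply: integral_ge0.
rewrite integral_mkcond; apply: ge0_le_integral => //.
- by move=> p _; apply: erestrict_ge0.
- apply/(measurable_restrictT _ _).1; first exact: measurable_sq.
  by apply: measurable_funTS; exact: measurableT_comp mG (measurable_tuple_cons_l a').
- apply: measurable_funeM; exact: measurable_tuple_integral.
move=> p _; rewrite patchE; case: ifPn => [/set_mem ap|_]; last first.
  by rewrite mule_ge0 ?lee_fin// integral_ge0.
have := IH (fun t => G (tuple_cons (p, t))) a' (measurable_tuple_section p mG).
move=> /(_ (fun x => G0 _)) /(_ _)/le_trans -> //.
  move=> x k bx xk.
  have := smv (tuple_cons (p, x)) (lift ord0 k).
  rewrite !tnthS => /(_ _ xk)/le_trans -> //; first by apply/box_cons.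
  by under eq_integral do rewrite tset_consS.
rewrite lee_wpmul2l ?lee_fin// integral_mkcond; apply: ge0_le_integral => //.
- by move=> t _; apply: erestrict_ge0.
- apply/(measurable_restrictT _ _).1; first exact: measurable_box.
  by apply: measurable_funTS; exact: measurable_tuple_section.
- exact: measurable_tuple_section.
move=> t _; rewrite /H !patchE; case: ifPn => [/set_mem at_|_].
  by rewrite mem_set//; apply/box_cons.
by case: ifP.
Qed.

End iterated_mean_value.

Section domain_geometry.
Variables (R : realType) (n : nat) (Omega : set 'rV[R[i]]_n.+1).
Local Notation C := R[i].
Local Notation Cn := 'rV[R[i]]_n.+1.
Implicit Types (z w v : Cn).

Hypothesis Omega_open : open Omega.
Hypothesis Omega_convex : convex_set Omega.
Hypothesis Omega_bounded : bounded_set Omega.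
Hypothesis Omega0 : Omega 0.

(** * The distance to the boundary of a convex domain *)

Lemma convexE z w (t : R) : 0 <= t <= 1 -> Omega z -> Omega w ->
  Omega ((t%:C)%C *: z + ((1 - t)%:C)%C *: w).
Proof.
move=> /andP[t0 t1] Oz Ow.
have t01 : (0 : C) <= (t%:C)%C <= 1 by rewrite ler0c t0 -[1]/((1 : R)%:C)%C lecR.
have [l lE] : exists l : {i01 C}, l%:num = (t%:C)%C.
  by exists (Itv01 (proj1 (andP t01)) (proj2 (andP t01))).
have := @Omega_convex z w l; rewrite !inE => /(_ Oz Ow) H.
have E : (t%:C)%C *: z + ((1 - t)%:C)%C *: w = l%:num *: z + (1 - l%:num) *: w.
  by rewrite lE rmorphB.
by rewrite E; exact: H.
Qed.

Lemma bounded_nrm : exists2 B : R, 0 < B & forall z, Omega z -> nrm z <= B.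
Proof.
have [M [Mr HM]] := Omega_bounded.
exists (Num.max (complex.Re M) 0 + 1); first by rewrite ltr_wpDl// le_max lexx orbT.
move=> z Oz; have := HM (((Num.max (complex.Re M) 0 + 1))%:C)%C.
move=> /(_ _ z Oz) /=; rewrite normE_nrm lecR; apply.
rewrite -(RRe_real Mr) ltcR; apply: le_lt_trans (_ : _ <= Num.max (complex.Re M) 0) _.
  by rewrite le_max lexx.
by rewrite ltrDl.
Qed.

(** Comparable to [delta] ([dist_le_delta], [delta_le_dist]).  As an infimum over all
    the points outside [Omega] it gives [dist_in] and [dist_concave] without going
    through boundary points, and [nrm] suits the boxes over which mean values are
    taken. *)
Definition dist z : R := inf [set nrm (z - w) | w in ~` Omega].

Lemma compl_nonempty : exists w, ~ Omega w.
Proof.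
have [B B0 HB] := bounded_nrm.
exists (const_mx ((B + 1)%:C)%C) => /HB.
have := cmod_le_nrm (const_mx ((B + 1)%:C)%C : Cn) ord0.
rewrite mxE cmod_real ger0_norm ?addr_ge0 ?(ltW B0)// => h1 h2.
have := le_trans h1 h2; lra.
Qed.

Let dset z := [set nrm (z - w) | w in ~` Omega].

Let dset_lb z : lbound (dset z) 0.
Proof. by move=> _ [w _ <-]; exact: nrm_ge0. Qed.

Let dset_n0 z : dset z !=set0.
Proof. by have [w nw] := compl_nonempty; exists (nrm (z - w)), w. Qed.

Lemma dist_ge0 z : 0 <= dist z.
Proof. by apply: lb_le_inf; [exact: dset_n0|exact: dset_lb]. Qed.

Lemma dist_le z w : ~ Omega w -> dist z <= nrm (z - w).
Proof. by move=> nw; apply: ge_inf; [exists 0; exact: dset_lb|exists w]. Qed.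

Lemma dist_ge z (e : R) : (forall w, ~ Omega w -> e <= nrm (z - w)) -> e <= dist z.
Proof. by move=> H; apply: lb_le_inf; [exact: dset_n0|move=> _ [w nw <-]; exact: H]. Qed.

Lemma dist_in z w : nrm (w - z) < dist z -> Omega w.
Proof.
move=> wz; apply: contrapT => /(dist_le z); rewrite nrm_distC; lra.
Qed.

Lemma dist_gt0 z : Omega z -> 0 < dist z.
Proof.
move=> /(open_nrm Omega_open)[r r0 Hr]; apply: lt_le_trans r0 _; apply: dist_ge => w nw.
by rewrite leNgt; apply/negP; rewrite nrm_distC => /Hr.
Qed.

Lemma dist_lip z w : dist z <= dist w + nrm (z - w).
Proof.
rewrite -lerBlDr; apply: dist_ge => v nv; have := dist_le z nv.
have := nrmD (z - w) (w - v); rewrite addrA subrK; lra.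
Qed.

(** A vector shorter than [t dist z + (1 - t) dist 0] is the combination with
    weights [t] and [1 - t] of vectors shorter than [dist z] and [dist 0], and
    these do not move [z] and [0] out of [Omega]. *)
Lemma dist_concave z (t : R) : Omega z -> 0 <= t <= 1 ->
  t * dist z + (1 - t) * dist 0 <= dist ((t%:C)%C *: z).
Proof.
move=> Oz t01; apply: dist_ge => w nw; rewrite leNgt; apply/negP => H; apply: nw.
set S := t * dist z + (1 - t) * dist 0 in H.
have S0 : 0 < S by apply: le_lt_trans H; exact: nrm_ge0.
pose k := w - (t%:C)%C *: z.
have kS : nrm k < S by rewrite /k nrm_distC.
pose a := dist z / S; pose b := dist 0 / S.
have ab : t * a + (1 - t) * b = 1 by rewrite /a /b !mulrA -mulrDl divff// gt_eqF.
have small (x : R) : 0 < x -> nrm (((x / S)%:C)%C *: k) < x.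
  move=> x0; rewrite nrmZ cmod_real ger0_norm; last by rewrite divr_ge0// ltW.
  by rewrite -mulrA -[ltRHS]mulr1 ltr_pM2l// mulrC ltr_pdivrMr// mul1r.
have O1 : Omega (z + (a%:C)%C *: k).
  by apply: (@dist_in z); rewrite addrAC subrr add0r small// dist_gt0.
have O2 : Omega ((b%:C)%C *: k).
  by apply: (@dist_in 0); rewrite subr0 small// dist_gt0.
have := convexE t01 O1 O2; congr Omega.
rewrite scalerDr !scalerA -addrA -scalerDl -!rmorphM -rmorphD ab scale1r.
by rewrite /k addrC subrK.
Qed.

Lemma dist_scale z (t : R) : Omega z -> 0 <= t <= 1 -> (1 - t) * dist 0 <= dist ((t%:C)%C *: z).
Proof.
move=> Oz t01; apply: le_trans (dist_concave Oz t01).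
by rewrite lerDr mulr_ge0 ?dist_ge0//; case/andP: t01.
Qed.

Lemma dist_scale_min z (t : R) : Omega z -> 0 <= t <= 1 ->
  Num.min (dist z) (dist 0) <= dist ((t%:C)%C *: z).
Proof.
move=> Oz t01; apply: le_trans (dist_concave Oz t01).
set m := Num.min _ _; have -> : m = t * m + (1 - t) * m by ring.
case/andP: t01 => t0 t1.
by apply: lerD; rewrite ler_wpM2l ?subr_ge0// ge_min lexx ?orbT.
Qed.

Lemma scale_in z (t : R) : Omega z -> 0 <= t <= 1 -> Omega ((t%:C)%C *: z).
Proof.
by move=> Oz t01; have := convexE t01 Oz Omega0; rewrite scaler0 addr0.
Qed.

Lemma nrm_le_euclid z : nrm z <= euclid_norm z.
Proof.
apply: nrm_leP; first exact: sqrtr_ge0.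
move=> k; rewrite -[leLHS]ger0_norm ?cmod_ge0// -sqrtr_sqr ler_wsqrtr//.
by rewrite (bigD1 k)//= lerDl sumr_ge0// => *; exact: sqr_ge0.
Qed.

Lemma euclid_le_nrm z : euclid_norm z <= n.+1%:R * nrm z.
Proof.
rewrite -[leRHS]ger0_norm ?mulr_ge0 ?nrm_ge0// -sqrtr_sqr ler_wsqrtr//.
apply: (@le_trans _ _ (\sum_(k < n.+1) nrm z ^+ 2)).
  by apply: ler_sum => k _; rewrite ler_pXn2r ?nnegrE ?cmod_ge0 ?nrm_ge0 ?cmod_le_nrm.
rewrite sumr_const card_ord -[leLHS]mulr_natl exprMn ler_wpM2r ?sqr_ge0//.
by rewrite -natrX ler_nat expnS expn1 leq_pmulr.
Qed.

(** The boundary point sits at the supremum of the parameters of the segment at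
    which it is in [Omega]. *)
Lemma segment_meets_bdry z w : Omega z -> ~ Omega w ->
  exists2 b, bdry Omega b & nrm (z - b) <= nrm (z - w).
Proof.
move=> Oz nw.
pose p (t : R) := z + (t%:C)%C *: (w - z).
pose T := [set t : R | 0 <= t <= 1 /\ Omega (p t)].
have p1 : p 1 = w by rewrite /p scale1r addrC subrK.
have T0 : T 0 by split; rewrite ?lexx ?ler01// /p scale0r addr0.
have Tub : ubound T 1 by move=> t [/andP[]].
have hs : has_sup T by split; [exists 0|exists 1].
pose s := sup T.
have s0 : 0 <= s by apply: sup_upper_bound.
have s1 : s <= 1 by apply: ge_sup => //; exists 0.
have pd (t u : R) : p t - p u = ((t - u)%:C)%C *: (w - z).
  by rewrite /p opprD addrACA subrr add0r -scalerBl -rmorphB.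
have W0 : 0 < 1 + nrm (w - z) by rewrite ltr_pwDl// nrm_ge0.
have near (t u r : R) : `|t - u| < r / (1 + nrm (w - z)) -> nrm (p t - p u) < r.
  rewrite ltr_pdivlMr// => h; apply: le_lt_trans h.
  by rewrite pd nrmZ cmod_real ler_wpM2l// lerDr.
exists (p s).
  split.
    move=> B /nbhs_nrm[r r0 Hr].
    have [|t Tt ts] := @sup_adherent _ T (r / (1 + nrm (w - z))) _ hs; first exact: divr_gt0.
    exists (p t); split; first by case: Tt.
    apply: Hr; apply: near.
    have : t <= s by apply: sup_upper_bound.
    rewrite -/s in ts; move=> ?; rewrite ler0_norm; lra.
  move=> /interior_subset Os.
  have [r r0 Hr] := open_nrm Omega_open Os.
  have sn1 : s < 1 by rewrite lt_neqAle s1 andbT; apply/eqP => E; apply: nw; rewrite -p1 -E.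
  pose h := Num.min (1 - s) (r / (1 + nrm (w - z)) / 2).
  have h0 : 0 < h by rewrite lt_min subr_gt0 sn1 !divr_gt0.
  have hr : h < r / (1 + nrm (w - z)).
    rewrite gt_min; apply/orP; right; rewrite ltr_pdivrMr// ltr_pMr ?ltr1n// divr_gt0//.
  have : T (s + h).
    split; last by apply/Hr/near; rewrite addrAC subrr add0r gtr0_norm.
    have : h <= 1 - s by rewrite ge_min lexx.
    move=> ?; apply/andP; split; lra.
  move=> /(sup_upper_bound hs); rewrite -/s; lra.
rewrite -[z in z - p s](_ : p 0 = z); last by rewrite /p scale0r addr0.
rewrite pd nrmZ cmod_real sub0r normrN (ger0_norm s0) nrm_distC.
by rewrite -[leRHS]mul1r ler_wpM2r// nrm_ge0.
Qed.

Lemma bdry_notin w : bdry Omega w -> ~ Omega w.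
Proof. by move=> [_ nw] Ow; apply: nw; exact: open_nbhs_nbhs. Qed.

Lemma dist_le_delta z : Omega z -> dist z <= delta Omega z.
Proof.
move=> Oz; apply: lb_le_inf.
  by have [w /(segment_meets_bdry Oz)[b bb _]] := compl_nonempty; exists (euclid_norm (z - b)), b.
by move=> _ [w /bdry_notin/(dist_le z) h <-]; apply: le_trans h _; exact: nrm_le_euclid.
Qed.

Lemma delta_le_dist z : Omega z -> delta Omega z <= n.+1%:R * dist z.
Proof.
move=> Oz; rewrite -ler_pdivrMl//; apply: dist_ge => w /(segment_meets_bdry Oz)[b bb zb].
rewrite ler_pdivrMl//; apply: le_trans (_ : n.+1%:R * nrm (z - b) <= _).
  apply: le_trans (euclid_le_nrm _); apply: ge_inf; last by exists b.
  by exists 0 => _ [v _ <-]; exact: sqrtr_ge0.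
by rewrite ler_wpM2l.
Qed.

Lemma delta_ge0 z : Omega z -> 0 <= delta Omega z.
Proof. by move=> /dist_le_delta; apply: le_trans; exact: dist_ge0. Qed.

(** * Integrals over the domain *)

Local Notation pt := (@point_of R n.+1).
Local Notation mu := (@lebesgue_tuple R n.+1).
Local Notation Ot := (@point_of R n.+1 @^-1` Omega).
Implicit Types (f h g : Cn -> C) (F G : Cn -> R).

Lemma cts_atP F z : cts_at F z <-> {for z, continuous F}.
Proof.
have FF : Filter (nbhs z) := nbhs_filter z.
split=> H.
  apply/cvgrPdist_lt => e /H[d d0 Hd]; apply/nbhs_nrm; exists d => // w /Hd.
  by rewrite distrC.
move=> e e0; move/cvgrPdist_lt: H => /(_ _ e0)/nbhs_nrm[r r0 Hr].
by exists r => // w /Hr; rewrite distrC.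
Qed.

Definition ctsO F := forall z, Omega z -> cts_at F z.

Lemma ctsOD F G : ctsO F -> ctsO G -> ctsO (fun z => F z + G z).
Proof.
move=> cF cG z Oz; have FF : Filter (nbhs z) := nbhs_filter z; apply/cts_atP.
have /cts_atP f1 := cF _ Oz; have /cts_atP f2 := cG _ Oz.
exact: cvgD f1 f2.
Qed.

Lemma ctsOM F G : ctsO F -> ctsO G -> ctsO (fun z => F z * G z).
Proof.
move=> cF cG z Oz; have FF : Filter (nbhs z) := nbhs_filter z; apply/cts_atP.
have /cts_atP f1 := cF _ Oz; have /cts_atP f2 := cG _ Oz.
exact: cvgM f1 f2.
Qed.

Lemma ctsO_cst (c : R) : ctsO (fun=> c).
Proof. by move=> z _ e e0; exists 1 => // w _; rewrite subrr normr0. Qed.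

Lemma ctsOX F m : ctsO F -> ctsO (fun z => F z ^+ m).
Proof.
move=> cF; elim: m => [|m IH]; first by under eq_fun do rewrite expr0; exact: ctsO_cst.
by under eq_fun do rewrite exprS; exact: ctsOM.
Qed.

Lemma ctsOV F : ctsO F -> (forall z, Omega z -> F z != 0) -> ctsO (fun z => (F z)^-1).
Proof.
move=> cF F0 z Oz; have FF : Filter (nbhs z) := nbhs_filter z; apply/cts_atP.
have /cts_atP f1 := cF _ Oz.
exact: cvgV (F0 _ Oz) f1.
Qed.

Lemma cts_dist z : cts_at dist z.
Proof.
move=> e e0; exists e => // w we; rewrite ltr_norml.
have := dist_lip w z; have := dist_lip z w; rewrite (nrm_distC z); lra.
Qed.

Lemma ctsO_dist : ctsO dist.
Proof. by move=> z _; exact: cts_dist. Qed.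

Lemma ctsO_comp (s : R) F : 0 <= s <= 1 -> ctsO F -> ctsO (fun z => F ((s%:C)%C *: z)).
Proof.
move=> /andP[s0 s1] cF z Oz e e0.
have [|del d0 Hd] := cF ((s%:C)%C *: z) _ e e0; first by apply: scale_in => //; apply/andP.
exists del => // w wz; apply: Hd; rewrite -scalerBr nrmZ cmod_real ger0_norm//.
by apply: le_lt_trans wz; rewrite ler_piMl ?nrm_ge0.
Qed.

Lemma measurable_Ot : measurable Ot.
Proof. exact: measurable_open. Qed.

Lemma ctsO_meas F : ctsO F -> measurable_fun Ot (fun x => F (pt x) : measurableTypeR R).
Proof. exact: measurable_cts. Qed.

Lemma ctsO_measE F : ctsO F -> measurable_fun Ot (fun x => (F (pt x))%:E).
Proof. by move=> cF; apply/measurable_EFinP; exact: ctsO_meas. Qed.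

Definition iO F : \bar R := vintegral Omega (fun z => (F z)%:E).

Lemma iO_ge0 F : (forall z, Omega z -> 0 <= F z) -> (0 <= iO F)%E.
Proof. by move=> F0; apply: integral_ge0 => x Ox; rewrite lee_fin; exact: F0. Qed.

Lemma le_iO F G : ctsO F -> ctsO G -> (forall z, Omega z -> 0 <= F z <= G z) ->
  (iO F <= iO G)%E.
Proof.
move=> cF cG FG; apply: ge0_le_integral; first exact: measurable_Ot.
- by move=> x /FG/andP[]; rewrite lee_fin.
- exact: ctsO_measE.
- exact: ctsO_measE.
- by move=> x /FG/andP[_]; rewrite lee_fin.
Qed.

Lemma iOD F G : ctsO F -> ctsO G -> (forall z, Omega z -> 0 <= F z) ->
  (forall z, Omega z -> 0 <= G z) -> iO (fun z => F z + G z) = (iO F + iO G)%E.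
Proof.
move=> cF cG F0 G0; rewrite /iO /vintegral -ge0_integralD.
- by [].
- exact: measurable_Ot.
- by move=> x /F0; rewrite lee_fin.
- exact: ctsO_measE.
- by move=> x /G0; rewrite lee_fin.
- exact: ctsO_measE.
Qed.

Lemma iOZ (c : R) F : 0 <= c -> ctsO F -> (forall z, Omega z -> 0 <= F z) ->
  iO (fun z => c * F z) = (c%:E * iO F)%E.
Proof.
move=> c0 cF F0; rewrite /iO /vintegral -ge0_integralZl_EFin.
- by [].
- exact: measurable_Ot.
- by move=> x /F0; rewrite lee_fin.
- exact: ctsO_measE.
- by [].
Qed.

Lemma eq_iO F G : (forall z, Omega z -> F z = G z) -> iO F = iO G.
Proof. by move=> FG; apply: eq_integral => x /set_mem/FG ->. Qed.

Definition vol : \bar R := iO (fun=> 1).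

Lemma vol_fin : (vol < +oo)%E.
Proof.
have [B B0 HB] := bounded_nrm.
rewrite /vol /iO /vintegral integral_cst; last exact: measurable_Ot.
rewrite mul1e; apply: le_lt_trans (_ : mu (box (plane_of 0) (B + 1)) < +oo)%E.
  apply: le_measure; rewrite ?inE; [exact: measurable_Ot|exact: measurable_box|].
  move=> x Ox; apply: nrm_box; rewrite plane_ofK subr0.
  by apply: le_lt_trans (HB _ Ox) _; rewrite ltrDl.
by rewrite measure_box ?ltry// addr_gt0.
Qed.

Lemma iO_bound F (M : R) : ctsO F -> (forall z, Omega z -> 0 <= F z <= M) ->
  (iO F <= M%:E * vol)%E.
Proof.
move=> cF FM; have M0 : 0 <= M by have /andP[] := FM _ Omega0; exact: le_trans.
rewrite /vol -iOZ//; last exact: ctsO_cst.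
apply: le_iO => //; first exact: ctsO_cst.
by move=> z /FM; rewrite mulr1.
Qed.

Lemma scale_tuple_pt (t : R) x : pt (scale_tuple t x) = (t%:C)%C *: pt x.
Proof.
by apply/rowP => k; rewrite !mxE tnth_map /=; simpc.
Qed.

(** Change of variables; a dilation by [t] maps [Omega] into itself. *)
Lemma iO_dilate F (t : R) : 0 < t <= 1 -> ctsO F -> (forall z, Omega z -> 0 <= F z) ->
  (iO (fun z => F ((t%:C)%C *: z)) <= ((t^-1) ^+ (2 * n.+1))%:E * iO F)%E.
Proof.
move=> /andP[t0 t1] cF F0; have t01 : 0 <= t <= 1 by rewrite (ltW t0).
pose Fe : n.+1.-tuple (plane R) -> \bar R := (fun x => (F (pt x))%:E) \_ Ot.
have mFe : measurable_fun setT Fe.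
  by apply/(measurable_restrictT _ _).1; [exact: measurable_Ot|exact: ctsO_measE].
have Fe0 x : (0 <= Fe x)%E.
  by apply: erestrict_ge0 => y Oy; rewrite lee_fin; exact: F0.
rewrite [iO F]/iO /vintegral integral_mkcond -/Fe -integral_scale_tuple//.
rewrite /iO /vintegral integral_mkcond; apply: ge0_le_integral => //.
- by move=> x _; apply: erestrict_ge0 => y Oy; rewrite lee_fin; apply: F0; exact: scale_in.
- apply/(measurable_restrictT _ _).1; first exact: measurable_Ot.
  exact: (ctsO_measE (ctsO_comp t01 cF)).
- by apply: measurableT_comp mFe _; exact: measurable_scale_tuple.
move=> x _; rewrite /Fe !patchE scale_tuple_pt; case: ifPn => [/set_mem Ox|_].
  by rewrite mem_set//= scale_tuple_pt; exact: scale_in.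
by case: ifPn => // /set_mem; rewrite /= scale_tuple_pt => Ox; rewrite lee_fin F0.
Qed.

Definition grad f z : 'I_n.+1 -> C := fun k => 'D_(delta_mx ord0 k) f z.

Lemma hol_grad f z : holomorphic_on Omega f -> Omega z -> is_grad f z (grad f z).
Proof. by move=> hf Oz; apply: differentiable_is_grad; exact: hf. Qed.

Lemma grad_hol f : (forall z, Omega z -> exists d, is_grad f z d) -> holomorphic_on Omega f.
Proof. by move=> H z /H[d /is_grad_diff[]]. Qed.

Lemma is_grad_grad f z d : is_grad f z d -> grad f z = d.
Proof. by move=> H; apply/funext => k; exact: is_gradE. Qed.

Lemma radialE f z : radial f z = lin (grad f z) z.
Proof. by []. Qed.

Lemma hol_ball_dist f z (r : R) : holomorphic_on Omega f -> r < dist z -> hol_ball f z r.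
Proof.
move=> hf rz w wr; exists (grad f w); apply: hol_grad => //.
by apply: (@dist_in z); exact: le_lt_trans rz.
Qed.

Lemma ctsO_cmod f : holomorphic_on Omega f -> ctsO (fun z => cmod (f z)).
Proof.
move=> hf z Oz e e0; have [del d0 Hd] := is_grad_cts (hol_grad hf Oz) e0.
exists del => // w /Hd; apply: le_lt_trans; rewrite ler_norml.
have k1 := cmodD (f w - f z) (f z); have k2 := cmodD (f z - f w) (f w).
by rewrite !subrK in k1 k2; rewrite (cmod_distC (f z)) in k2; lra.
Qed.

Lemma hol_pderiv f k : holomorphic_on Omega f ->
  holomorphic_on Omega (fun w => 'D_(delta_mx ord0 k) f w : C).
Proof.
move=> hf; apply: grad_hol => z Oz; have d0 := dist_gt0 Oz.
apply: (@pderiv_hol _ _ f z (dist z / 2)); first by rewrite divr_gt0.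
by apply: hol_ball_dist => //; rewrite ltr_pdivrMr// ltr_pMr// ltr1n.
Qed.

Lemma hol_radial f : holomorphic_on Omega f -> holomorphic_on Omega (radial f).
Proof.
move=> hf z Oz.
have -> : radial f = \sum_k (fun w : Cn => w ord0 k * 'D_(delta_mx ord0 k) f w).
  by apply/funext => w; rewrite fct_sumE.
apply: differentiable_sum => k; apply: differentiableM; first exact: differentiable_coord.
exact: hol_pderiv.
Qed.

(** * Mean values on boxes and the bound on the radial derivative *)

(** The square of [f] restricted to coordinate lines is holomorphic, so the mean
    value inequality applies one variable at a time. *)
Lemma box_mean_value f (a : n.+1.-tuple (plane R)) (r : R) :
  holomorphic_on Omega f -> 0 < r -> (forall w, nrm (w - pt a) <= 2 * r -> Omega w) ->
  ((cmod (f (pt a)) ^+ 2)%:E <= ((4 / r ^+ 2) ^+ n.+1)%:E *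
     \int[mu]_(x in box a r) (cmod (f (pt x)) ^+ 2)%:E)%E.
Proof.
move=> hf r0 Ha.
pose G : n.+1.-tuple (plane R) -> \bar R := (fun x => (cmod (f (pt x)) ^+ 2)%:E) \_ Ot.
have mG : measurable_fun setT G.
  apply/(measurable_restrictT _ _).1; first exact: measurable_Ot.
  by apply: (ctsO_measE (F := fun z => cmod (f z) ^+ 2)); apply/ctsOX/ctsO_cmod.
have G0 x : (0 <= G x)%E by apply: erestrict_ge0 => y _; rewrite lee_fin sqr_ge0.
have boxO x : box a r x -> Omega (pt x) by move=> /box_nrm; exact: Ha.
have GE x : box a r x -> G x = (cmod (f (pt x)) ^+ 2)%:E.
  by move=> /boxO Ox; rewrite /G patchE mem_set.
have aa : box a r a by move=> k; split; rewrite subrr normr0.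
have c0 : 0 <= 4 / r ^+ 2 by rewrite divr_ge0 ?exprn_ge0 ?(ltW r0).
have := @iterated_mean_value R (4 / r ^+ 2) n.+1 G a r c0 r0 mG G0.
rewrite (GE _ aa); have -> : (\int[mu]_(x in box a r) G x =
    \int[mu]_(x in box a r) (cmod (f (pt x)) ^+ 2)%:E)%E.
  by apply: eq_integral => x /set_mem/GE.
apply=> x k bx xk.
pose ek : Cn := delta_mx ord0 k.
pose q := pt x - cpx (tnth x k) *: ek.
have qE p : q + cpx p *: ek = pt (tset x k p).
  apply/rowP => j; rewrite !mxE eqxx /= tnth_mktuple; have [->|jk] := eqVneq j k.
    by rewrite /cpx !mulr1 subrr add0r.
  by rewrite !mulr0 subr0 addr0.
have bt p : sq (tnth a k) r p -> box a r (tset x k p).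
  by move=> ap j; rewrite tnth_mktuple; case: eqP => [->|_]; [exact: ap|exact: bx].
pose u (s : C) := f (q + s *: ek) * f (q + s *: ek).
have Hu p : sq (tnth a k) r p -> exists d, is_cderiv u (cpx p) d.
  move=> /bt/boxO; rewrite -qE => Op; have Hl := is_grad_line (hol_grad hf Op).
  by eexists; exact: (is_cderivM Hl Hl).
have := area_mean_value r0 Hu; rewrite -xk /u qE.
have -> : tset x k (tnth x k) = x.
  by apply: eq_from_tnth => j; rewrite tnth_mktuple; case: eqP => [->|].
rewrite cmodM -expr2 (GE _ bx) => /le_trans; apply; rewrite le_eqVlt; apply/orP; left.
apply/eqP; congr (_ * _)%E; apply: eq_integral => p /set_mem ap.
by rewrite qE cmodM -expr2 GE//; apply: bt; rewrite -xk.
Qed.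

Lemma box_sub_iO F (a : n.+1.-tuple (plane R)) (r : R) : ctsO F ->
  (forall z, Omega z -> 0 <= F z) -> (forall w, nrm (w - pt a) <= 2 * r -> Omega w) ->
  (\int[mu]_(x in box a r) (F (pt x))%:E <= iO F)%E.
Proof.
move=> cF F0 Ha; apply: ge0_subset_integral.
- exact: measurable_box.
- exact: measurable_Ot.
- exact: ctsO_measE.
- by move=> x Ox; rewrite lee_fin F0.
- by move=> x /box_nrm; exact: Ha.
Qed.

Lemma sqr_cmod_ctsO f : holomorphic_on Omega f -> ctsO (fun z => cmod (f z) ^+ 2).
Proof. by move=> hf; apply/ctsOX/ctsO_cmod. Qed.

(** Point evaluations are bounded on A2, with a constant depending only on the
    distance to the boundary. *)
Lemma point_bound f z (r : R) : holomorphic_on Omega f -> 0 < r -> Omega z ->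
  2 * r < dist z ->
  ((cmod (f z) ^+ 2)%:E <= ((4 / r ^+ 2) ^+ n.+1)%:E * iO (fun w => (cmod (f w) ^+ 2)%R))%E.
Proof.
move=> hf r0 Oz rz; rewrite -(plane_ofK z).
have Ha w : nrm (w - pt (plane_of z)) <= 2 * r -> Omega w.
  by rewrite plane_ofK => wz; apply: (@dist_in z); exact: le_lt_trans rz.
apply: le_trans (box_mean_value hf r0 Ha) _; apply: lee_wpmul2l.
  by rewrite lee_fin exprn_ge0// divr_ge0// exprn_ge0// ltW.
by apply: box_sub_iO => //; [exact: sqr_cmod_ctsO|move=> *; exact: sqr_ge0].
Qed.

Lemma sqr_le_cmod (x y : R) : 0 <= x -> 0 <= y -> x ^+ 2 <= y -> x <= Num.sqrt y.
Proof. by move=> x0 y0 xy; rewrite -[leLHS]ger0_norm// -sqrtr_sqr ler_wsqrtr. Qed.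

(** The mean value inequality on boxes of half-side [dist / 8] bounds [f] near the
    point by its mean over the box of half-side [dist / 4], and Cauchy's estimate
    along the ray through the point turns this into a bound on [radial f]. *)
Lemma radial_box_bound : exists2 K : R, 0 < K & forall f (a : n.+1.-tuple (plane R)),
  holomorphic_on Omega f -> Omega (pt a) ->
  ((dist (pt a) ^+ 2 * cmod (radial f (pt a)) ^+ 2)%:E <=
   (K * (dist (pt a) ^- 2) ^+ n.+1)%:E *
     \int[mu]_(x in box a (dist (pt a) / 4)%R) (cmod (f (pt x)) ^+ 2)%:E)%E.
Proof.
have [B B0 HB] := bounded_nrm.
(* 256 = 4 * 8 ^ 2 and 1024 = 4 ^ 2 * 8 ^ 2 come from the half-side [dist / 8];
   they are kept abstract because numerals of [R] are unary. *)
have [p [p0 pE]] : exists p : R, 0 < p /\ p = 256.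
  by exists 256; split; [rewrite ltr0n|reflexivity].
have [q [q0 qE]] : exists q : R, 0 < q /\ q = 1024.
  by exists 1024; split; [rewrite ltr0n|reflexivity].
have K1 : 0 < q * B ^+ 2 * p ^+ n.+1.
  exact: mulr_gt0 (mulr_gt0 q0 (exprn_gt0 _ B0)) (exprn_gt0 _ p0).
exists (q * B ^+ 2 * p ^+ n.+1) => //.
move=> f a hf Oz; set z := pt a; set d := dist z.
have d0 : 0 < d by exact: dist_gt0.
pose r := d / 8; have r0 : 0 < r by rewrite divr_gt0.
have -> : d / 4 = 2 * r by rewrite /r; field.
set X := (\int[mu]_(x in _) _)%E.
have X0 : (0 <= X)%E by apply: integral_ge0 => x _; rewrite lee_fin sqr_ge0.
have K0 : 0 < q * B ^+ 2 * p ^+ n.+1 * (d ^- 2) ^+ n.+1.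
  by apply: (mulr_gt0 K1); rewrite exprn_gt0// invr_gt0 exprn_gt0.
have [Xy|Xfin] := eqVneq X +oo%E; first by rewrite Xy mulry gtr0_sg// mul1e leey.
have XE : X = (fine X)%:E by rewrite fineK// ge0_fin_numE// lt_neqAle Xfin leey.
set x := fine X in XE; have x0 : 0 <= x by rewrite -lee_fin -XE.
pose c := (4 / r ^+ 2) ^+ n.+1.
have c0 : 0 <= c by rewrite exprn_ge0// divr_ge0// exprn_ge0// ltW.
have bound w : nrm (w - z) <= r -> cmod (f w) <= Num.sqrt (c * x).
  move=> wz; apply: sqr_le_cmod; rewrite ?cmod_ge0 ?mulr_ge0//.
  have -> : (cmod (f w) ^+ 2 <= c * x) = ((cmod (f w) ^+ 2)%:E <= c%:E * X)%E.
    by rewrite XE -EFinM lee_fin.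
  rewrite -(plane_ofK w).
  have Ha v : nrm (v - pt (plane_of w)) <= 2 * r -> Omega v.
    rewrite plane_ofK => vw; apply: (@dist_in z); rewrite -(subrK w v) -addrA.
    by apply: le_lt_trans (nrmD _ _) _; rewrite -/d /r in vw wz *; lra.
  apply: le_trans (box_mean_value hf r0 Ha) _; apply: lee_wpmul2l; first by rewrite lee_fin.
  have sub : box (plane_of w) r `<=` box a (2 * r).
    move=> y yw k; have [h1 h2] := yw k.
    have h3 := cmod_le_nrm (w - z) k; rewrite -(plane_ofK w) in wz h3.
    rewrite !mxE in h3.
    have k1 := le_trans (le_trans (ler_Re_cmod _) h3) wz.
    have k2 := le_trans (le_trans (ler_Im_cmod _) h3) wz.
    have {}k1 : `|(tnth (plane_of w) k).1 - (tnth a k).1| <= r := k1.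
    have {}k2 : `|(tnth (plane_of w) k).2 - (tnth a k).2| <= r := k2.
    split.
    - rewrite -(subrK (tnth (plane_of w) k).1 (tnth y k).1) -addrA.
      by apply: le_lt_trans (ler_normD _ _) _; lra.
    - rewrite -(subrK (tnth (plane_of w) k).2 (tnth y k).2) -addrA.
      by apply: le_lt_trans (ler_normD _ _) _; lra.
  apply: ge0_subset_integral => //.
  - exact: measurable_box.
  - exact: measurable_box.
  - apply: measurable_funS (ctsO_measE (sqr_cmod_ctsO hf)); first exact: measurable_Ot.
    by move=> y /box_nrm yz; apply: (@dist_in z); apply: (le_lt_trans yz); rewrite -/d /r; lra.
  - by move=> y _; rewrite lee_fin sqr_ge0.
have rB0 : 0 < r / B by rewrite divr_gt0.
have near (s : C) : cmod s <= r / B -> nrm (z + s *: z - z) <= r.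
  move=> sr; rewrite addrAC subrr add0r nrmZ.
  apply: (@le_trans _ _ (r / B * B)); last by rewrite divfK// gt_eqF.
  by apply: ler_pM; rewrite ?cmod_ge0 ?nrm_ge0//; exact: HB.
have dr : r < dist z by rewrite -/d /r ltr_pdivrMr// ltr_pMr// ltr1n.
have := @cauchy_estimate_line _ _ f z z (r / B) (Num.sqrt (c * x)) (grad f z) rB0.
move=> /(_ _ _ _)/le_trans H.
have {H} : cmod (radial f z) <= 4 * Num.sqrt (c * x) / (r / B).
  rewrite radialE; apply: H; last exact: lexx.
  - by move=> s /near; exact: (hol_ball_dist hf dr).
  - by move=> s /near; exact: bound.
  - exact: hol_grad.
move=> H; rewrite XE -EFinM lee_fin.
have {}H : cmod (radial f z) ^+ 2 <= (4 * Num.sqrt (c * x) / (r / B)) ^+ 2.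
  by rewrite ler_pXn2r ?nnegrE ?cmod_ge0// divr_ge0 ?(ltW rB0)// mulr_ge0 ?sqrtr_ge0.
apply: le_trans (ler_wpM2l (sqr_ge0 d) H) _.
rewrite !exprMn sqr_sqrtr ?mulr_ge0// /c.
have -> : 4 / r ^+ 2 = p * d ^- 2 by rewrite pE /r; field; rewrite gt_eqF.
rewrite exprMn le_eqVlt; apply/orP; left; apply/eqP.
have -> : r = d / 8 by [].
rewrite qE; move: (p ^+ n.+1) ((d ^- 2) ^+ n.+1) => p1 p2.
by field; rewrite !gt_eqF.
Qed.

Lemma measurable_lt_set d (T : measurableType d) (f g : T -> measurableTypeR R) :
  measurable_fun setT f -> measurable_fun setT g -> measurable [set x | (f x < g x)%R].
Proof.
move=> mf mg; have := measurable_fun_ltr mf mg => /(_ measurableT [set true] I).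
by rewrite setTI; congr (measurable _); apply/seteqP; split.
Qed.

(** The pairs over which [lp_lower] integrates [|h|^2]: the second point is in the
    box around the first one given by [radial_box_bound]. *)
Definition near_set : set (n.+1.-tuple (plane R) * n.+1.-tuple (plane R)) :=
  [set p | box p.1 (dist (pt p.1) / 4) p.2].

Lemma measurable_near_set : measurable near_set.
Proof.
pose D (p : n.+1.-tuple (plane R) * n.+1.-tuple (plane R)) : measurableTypeR R :=
  dist (pt p.1) / 4.
have mD : measurable_fun setT D.
  have m1 : measurable_fun setT (fun x => dist (pt x) : measurableTypeR R).
    have -> : setT = pt @^-1` setT by rewrite preimage_setT.
    by apply: measurable_cts => [|z _]; [exact: openT|exact: cts_dist].
  apply: (measurableT_comp (f := fun t : measurableTypeR R => t / 4 : measurableTypeR R)).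
    exact: mulrr_measurable.
  exact: measurableT_comp m1 measurable_fst.
pose A k (p : n.+1.-tuple (plane R) * n.+1.-tuple (plane R)) : measurableTypeR R :=
  `|(tnth p.2 k).1 - (tnth p.1 k).1|.
pose B k (p : n.+1.-tuple (plane R) * n.+1.-tuple (plane R)) : measurableTypeR R :=
  `|(tnth p.2 k).2 - (tnth p.1 k).2|.
have mt k : measurable_fun setT
    (fun p : n.+1.-tuple (plane R) * n.+1.-tuple (plane R) => tnth p.1 k).
  exact: measurableT_comp (measurable_tnth k) measurable_fst.
have mt' k : measurable_fun setT
    (fun p : n.+1.-tuple (plane R) * n.+1.-tuple (plane R) => tnth p.2 k).
  exact: measurableT_comp (measurable_tnth k) measurable_snd.
have mA k : measurable_fun setT (A k).
  apply: measurableT_comp; first exact: normr_measurable.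
  by apply: measurable_funB; apply: measurableT_comp => //; exact: measurable_fst.
have mB k : measurable_fun setT (B k).
  apply: measurableT_comp; first exact: normr_measurable.
  by apply: measurable_funB; apply: measurableT_comp => //; exact: measurable_snd.
rewrite (_ : near_set = \big[setI/setT]_(k < n.+1) ([set p | A k p < D p] `&` [set p | B k p < D p])).
  apply: big_rec => // k E _ mE; apply: measurableI => //.
  by apply: measurableI; exact: measurable_lt_set.
apply/seteqP; split => p; rewrite -bigcap_seq.
  by move=> H k _; exact: H.
by move=> H k; exact: (H k (mem_index_enum k)).
Qed.

(** One half of the Littlewood-Paley equivalence: the bound on boxes of size
    comparable to [dist], integrated by Tonelli's theorem.  For a given [y], the
    points [x] whose box contains [y] fill at most a box of half-side
    [dist y / 2], which compensates the weight [dist x ^- 2]. *)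
Lemma lp_lower : exists2 c : R, 0 < c & forall h, holomorphic_on Omega h ->
  (iO (fun z => dist z ^+ 2 * cmod (radial h z) ^+ 2)%R <=
     c%:E * iO (fun z => cmod (h z) ^+ 2)%R)%E.
Proof.
have [K K0 HK] := radial_box_bound.
have q0 : 0 < (9 / 4 : R) by rewrite divr_gt0 ?ltr0n.
(* [dist y <= (3 / 2) dist x] when [y] is in the box around [x]. *)
exists (K * (9 / 4) ^+ n.+1) => [|h hh]; first by rewrite mulr_gt0// exprn_gt0.
pose W z := K * (dist z ^- 2) ^+ n.+1.
have dn z : Omega z -> dist z ^+ 2 != 0 by move=> Oz; rewrite expf_neq0// gt_eqF// dist_gt0.
have cW : ctsO W.
  apply: ctsOM; first exact: ctsO_cst.
  by apply: ctsOX; apply: ctsOV => //; apply: ctsOX; exact: ctsO_dist.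
have W0 z : 0 <= W z by rewrite mulr_ge0 ?(ltW K0)// exprn_ge0// invr_ge0 sqr_ge0.
pose We : n.+1.-tuple (plane R) -> \bar R := (fun x => (W (pt x))%:E) \_ Ot.
pose He : n.+1.-tuple (plane R) -> \bar R := (fun x => (cmod (h (pt x)) ^+ 2)%:E) \_ Ot.
have mWe : measurable_fun setT We.
  by apply/(measurable_restrictT _ _).1; [exact: measurable_Ot|exact: ctsO_measE].
have mHe : measurable_fun setT He.
  apply/(measurable_restrictT _ _).1; first exact: measurable_Ot.
  exact: ctsO_measE (sqr_cmod_ctsO hh).
have We0 x : (0 <= We x)%E by apply: erestrict_ge0 => y _; rewrite lee_fin.
have He0 x : (0 <= He x)%E by apply: erestrict_ge0 => y _; rewrite lee_fin sqr_ge0.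
have ind0 p : (0 <= (\1_near_set p)%:E :> \bar R)%E by rewrite lee_fin.
pose Psi p := (We p.1 * He p.2 * (\1_near_set p)%:E)%E.
have Psi0 p : (0 <= Psi p)%E by rewrite /Psi; apply: mule_ge0 => //; exact: mule_ge0.
have mPsi : measurable_fun setT Psi.
  apply: emeasurable_funM; last first.
    apply/measurable_EFinP; apply: measurable_indic; exact: measurable_near_set.
  apply: emeasurable_funM.
    exact: measurableT_comp mWe measurable_fst.
  exact: measurableT_comp mHe measurable_snd.
have boxO x y : Ot x -> box x (dist (pt x) / 4) y -> nrm (pt y - pt x) <= dist (pt x) / 2.
  move=> Ox /box_nrm yx; apply: le_trans yx _.
  by have := dist_gt0 Ox; lra.
apply: (@le_trans _ _ (\int[mu]_x \int[mu]_y Psi (x, y))%E).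
  rewrite /iO /vintegral integral_mkcond; apply: ge0_le_integral => //.
  - by move=> x _; apply: erestrict_ge0 => y _; rewrite lee_fin mulr_ge0// sqr_ge0.
  - apply/(measurable_restrictT _ _).1; first exact: measurable_Ot.
    apply: (ctsO_measE (F := fun z => dist z ^+ 2 * cmod (radial h z) ^+ 2)).
    by apply: ctsOM; [apply: ctsOX ctsO_dist|apply: sqr_cmod_ctsO; exact: hol_radial].
  - exact: (@measurable_fun_fubini_tonelli_F _ _ _ _ _ mu Psi).
  move=> x _; rewrite patchE; case: ifPn => [/set_mem Ox|_]; last exact: integral_ge0.
  apply: le_trans (HK h x hh Ox) _; rewrite -/(W (pt x)).
  rewrite [X in (_ * X)%E]integral_mkcond -integral_mulEl//; last 2 first.
  - apply/(measurable_restrictT _ _).1; first exact: measurable_box.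
    apply: measurable_funS (ctsO_measE (sqr_cmod_ctsO hh)); first exact: measurable_Ot.
    move=> y /(boxO _ _ Ox) yx; apply: (@dist_in (pt x)); apply: (le_lt_trans yx).
    by have := dist_gt0 Ox; lra.
  - by move=> y; apply: erestrict_ge0 => z _; rewrite lee_fin sqr_ge0.
  rewrite le_eqVlt; apply/orP; left; apply/eqP; apply: eq_integral => y _.
  rewrite /Psi /= /We /He !patchE (mem_set Ox) indicE -muleA; congr (_ * _)%E.
  have [bxy|bxy] := boolP (y \in box x (dist (pt x) / 4)%R).
    rewrite (mem_set (set_mem bxy : near_set (x, y))) mule1 mem_set//.
    apply: (@dist_in (pt x)); apply: (le_lt_trans (boxO _ _ Ox (set_mem bxy))).
    by have := dist_gt0 Ox; lra.
  rewrite [(x, y) \in near_set](_ : _ = false) ?mule0//.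
  by apply/negbTE; apply: contra bxy => /set_mem bxy; exact: mem_set.
rewrite (@fubini_tonelli _ _ _ _ _ mu mu Psi)//.
rewrite -iOZ//; [|by rewrite mulr_ge0 ?(ltW K0)// exprn_ge0// ltW|exact: sqr_cmod_ctsO|
  by move=> *; exact: sqr_ge0].
rewrite /iO /vintegral [X in (_ <= X)%E]integral_mkcond; apply: ge0_le_integral => //.
- by move=> y _; apply: integral_ge0.
- exact: (@measurable_fun_fubini_tonelli_G _ _ _ _ _ mu Psi).
- apply/(measurable_restrictT _ _).1; first exact: measurable_Ot.
  apply: (ctsO_measE (F := fun z => K * (9 / 4) ^+ n.+1 * cmod (h z) ^+ 2)).
  by apply: ctsOM; [exact: ctsO_cst|exact: sqr_cmod_ctsO].
move=> y _; rewrite patchE; case: ifPn => [/set_mem Oy|yO]; last first.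
  rewrite integral0_eq// => x _.
  by rewrite /Psi /= /He patchE (negbTE yO) mule0 mul0e.
have dy := dist_gt0 Oy; set dd := dist (pt y) in dy *.
pose c := K * ((9 / 4) * dd ^- 2) ^+ n.+1 * cmod (h (pt y)) ^+ 2.
have c0 : 0 <= c.
  apply: mulr_ge0; last exact: sqr_ge0.
  apply: mulr_ge0; first exact: ltW.
  by apply: exprn_ge0; apply: mulr_ge0; [exact: ltW|rewrite invr_ge0 sqr_ge0].
apply: (@le_trans _ _ (\int[mu]_(x in box y (dd / 2)%R) (c%:E))%E).
  rewrite [X in (_ <= X)%E]integral_mkcond; apply: ge0_le_integral => //.
  - by apply: measurableT_comp mPsi _; exact: measurable_pair2.
  - apply/(measurable_restrictT _ _).1; first exact: measurable_box.
    exact: measurable_cst.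
  move=> x _; rewrite /Psi /= indicE.
  have [xy|_] := boolP ((x, y) \in near_set); last first.
    by rewrite mule0; apply: erestrict_ge0 => *; rewrite lee_fin.
  rewrite mule1 /We patchE; case: ifPn => [/set_mem Ox|_]; last first.
    by rewrite mul0e; apply: erestrict_ge0 => *; rewrite lee_fin.
  have yx := boxO _ _ Ox (set_mem xy); have dx := dist_gt0 Ox.
  have d1 := dist_lip (pt x) (pt y); have d2 := dist_lip (pt y) (pt x).
  rewrite nrm_distC -/dd in d1; rewrite -/dd in d2.
  have d5 : dist (pt x) / 4 <= dd / 2 by lra.
  rewrite patchE mem_set; last first.
    move=> k; have [h1 h2] := set_mem xy k; move: h1 h2; rewrite /= => h1 h2.
    by split; rewrite distrC; [exact: lt_le_trans h1 d5|exact: lt_le_trans h2 d5].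
  rewrite /He patchE (mem_set Oy) -EFinM lee_fin /c ler_wpM2r ?sqr_ge0//.
  rewrite /W ler_wpM2l ?(ltW K0)// lerXn2r ?nnegrE ?invr_ge0 ?sqr_ge0//.
    by rewrite mulr_ge0 ?(ltW q0)// invr_ge0 sqr_ge0.
  rewrite -div1r ler_pdivrMr ?exprn_gt0//.
  have d3 : dd <= 3 / 2 * dist (pt x) by lra.
  rewrite mulrAC ler_pdivlMr ?exprn_gt0// mul1r.
  apply: le_trans (_ : (3 / 2 * dist (pt x)) ^+ 2 <= _).
    by rewrite lerXn2r// nnegrE; [exact: ltW|rewrite mulr_ge0// ltW].
  by rewrite le_eqVlt; apply/orP; left; apply/eqP; field.
rewrite integral_cst; last exact: measurable_box.
rewrite [X in (_ * X)%E]measure_box ?divr_gt0// -EFinM lee_fin /c.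
have -> : 2 * (dd / 2) = dd by field.
rewrite exprM exprMn le_eqVlt; apply/orP; left; apply/eqP.
rewrite exprVn; have : dd ^+ 2 ^+ n.+1 != 0 by rewrite !expf_neq0// gt_eqF.
move: (dd ^+ 2 ^+ n.+1) ((9 / 4) ^+ n.+1) => p1 p2 p1n.
by field.
Qed.

(** * Interior estimates along rays *)

Lemma is_cderiv_ray h z (s : C) : holomorphic_on Omega h -> Omega (s *: z) ->
  is_cderiv (fun w : C => h (w *: z)) s (lin (grad h (s *: z)) z).
Proof.
move=> hh Os; have E : (fun w : C => h (0 + w *: z)) = (fun w : C => h (w *: z)).
  by apply/funext => w; rewrite add0r.
have := @is_grad_line R n h 0 z s (grad h (s *: z)); rewrite add0r E; apply.
exact: hol_grad.
Qed.

(** Schwarz lemma along a ray: a holomorphic function vanishing at the origin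
    stays divisible by the parameter, with control of the quotient. *)
Lemma origin_quotient f z (rho M t : R) : holomorphic_on Omega f -> f 0 = 0 -> 0 < rho ->
  (forall s : C, cmod s <= rho -> Omega (s *: z) /\ cmod (f (s *: z)) <= M) ->
  (forall s : R, 0 <= s <= 1 -> cmod (f ((s%:C)%C *: z)) <= M) -> 0 <= t <= 1 ->
  cmod (f ((t%:C)%C *: z)) <= 8 * M / rho * t.
Proof.
move=> hv v0 r0 Hs Ht t01; have [t0 t1] := andP t01.
have M0 : 0 <= M by apply: le_trans (Ht _ t01); exact: cmod_ge0.
have [tr|tr] := lerP t (rho / 2); last first.
  apply: le_trans (Ht _ t01) _; rewrite mulrAC ler_pdivlMr//.
  have -> : 8 * M * t = M * (8 * t) by ring.
  by rewrite ler_wpM2l//; lra.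
have := @mean_value_bound R (fun s : C => f (s *: z)) 0 (t%:C)%C (8 * M / rho).
rewrite add0r scale0r v0 subr0 cmod_real ger0_norm//; apply => s /andP[s0 s1].
rewrite add0r; set q := (s%:C)%C * (t%:C)%C.
have q1 : cmod q <= rho / 2.
  rewrite cmodM !cmod_real !ger0_norm//; apply: le_trans tr.
  by rewrite ler_piMl.
have qr : cmod q <= rho by apply: (le_trans q1); lra.
exists (lin (grad f (q *: z)) z).
  exact: (is_cderiv_ray hv (Hs _ qr).1).
have -> : 8 * M / rho = 4 * M / (rho / 2) by field; rewrite gt_eqF.
apply: (@cauchy_estimate_line _ _ f (q *: z) z (rho / 2) M) => //.
- by rewrite divr_gt0.
- move=> s' s'r; rewrite -scalerDl; eexists; apply: hol_grad => //.
  by apply: (Hs _ _).1; apply: le_trans (cmodD _ _) _; lra.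
- move=> s' s'r; rewrite -scalerDl.
  by apply: (Hs _ _).2; apply: le_trans (cmodD _ _) _; lra.
- exact: hol_grad hv (Hs _ qr).1.
Qed.

Lemma ray_to0 h z : holomorphic_on Omega h -> forall e : R, 0 < e ->
  exists2 d : R, 0 < d & forall s : C, cmod s < d -> cmod (h (s *: z) - h 0) < e.
Proof.
move=> hh e e0; have [d d0 Hd] := is_grad_cts (hol_grad hh Omega0) e0.
have k0 : 0 < 1 + nrm z by rewrite ltr_pwDl// nrm_ge0.
exists (d / (1 + nrm z)); first by rewrite divr_gt0.
move=> s; rewrite ltr_pdivlMr// => sd; apply: Hd; rewrite subr0 nrmZ.
by apply: le_lt_trans sd; rewrite ler_wpM2l ?cmod_ge0// lerDr.
Qed.

(** Along the ray, [h (t z)] has derivative [radial h (t z) / t], bounded by [L].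
    The mean value inequality is applied on [[eta, 1]] for small [eta]. *)
Lemma ray_bound h z (L : R) : holomorphic_on Omega h -> Omega z ->
  (forall t : R, 0 < t <= 1 -> cmod (radial h ((t%:C)%C *: z)) <= L * t) ->
  cmod (h z - h 0) <= L.
Proof.
move=> hh Oz HL.
have L0 : 0 <= L.
  by have := HL 1; rewrite lexx ltr01 mulr1 => /(_ isT); apply: le_trans; exact: cmod_ge0.
apply/ler_addgt0Pr => e e0; have [d d0 Hd] := ray_to0 z hh e0.
pose eta := Num.min (d / 2) (1 / 2).
have eta0 : 0 < eta by rewrite lt_min !divr_gt0.
have eta1 : eta <= 1 / 2 by rewrite ge_min lexx orbT.
have etad : eta <= d / 2 by rewrite ge_min lexx.
have h1 : cmod (h (((eta%:C)%C) *: z) - h 0) < e.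
  by apply: Hd; rewrite cmod_real ger0_norm ?(ltW eta0)//; lra.
have := @mean_value_bound R (fun s : C => h (s *: z)) (eta%:C)%C ((1 - eta)%:C)%C L.
have -> : (eta%:C)%C + ((1 - eta)%:C)%C = 1 by rewrite -rmorphD addrC subrK.
rewrite scale1r cmod_real ger0_norm; last by lra.
move=> H; have {H} : cmod (h z - h ((eta%:C)%C *: z)) <= L * (1 - eta).
  apply: H => t /andP[t0 t1]; rewrite -rmorphM -rmorphD.
  set s := eta + t * (1 - eta).
  have te : 0 <= t * (1 - eta) by rewrite mulr_ge0//; lra.
  have te1 : t * (1 - eta) <= 1 - eta by rewrite ler_piMl//; lra.
  have s0 : 0 < s by rewrite /s; lra.
  have s1 : s <= 1 by rewrite /s; lra.
  have Os : Omega ((s%:C)%C *: z) by apply: scale_in => //; rewrite (ltW s0).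
  eexists; first exact: (is_cderiv_ray hh Os).
  have := HL s; rewrite s0 s1 => /(_ isT); rewrite radialE linZ cmodM cmod_real.
  by rewrite gtr0_norm// mulrC ler_pM2r.
have L1 : L * (1 - eta) <= L by rewrite ler_piMr//; lra.
have := cmodD (h z - h ((eta%:C)%C *: z)) (h ((eta%:C)%C *: z) - h 0).
by rewrite addrA subrK; lra.
Qed.

(** The mean value inequality on a box of size comparable to [e], where [dist] is
    at least [e / 2]. *)
Lemma interior_sup (e : R) : 0 < e -> exists2 K : R, 0 < K & forall f z,
  holomorphic_on Omega f -> Omega z -> e <= dist z ->
  ((cmod (f z) ^+ 2)%:E <= K%:E * iO (fun w => dist w ^+ 2 * cmod (f w) ^+ 2)%R)%E.
Proof.
move=> e0; pose r := e / 8; have r0 : 0 < r by rewrite divr_gt0.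
pose c := (4 / r ^+ 2) ^+ n.+1.
have c0 : 0 < c by rewrite exprn_gt0// divr_gt0// exprn_gt0.
have k0 : 0 < 4 / e ^+ 2 by rewrite divr_gt0// exprn_gt0.
exists (c * (4 / e ^+ 2)) => [|v z hv Oz ez]; first by rewrite mulr_gt0.
have Fc : ctsO (fun w => dist w ^+ 2 * cmod (v w) ^+ 2).
  by apply: ctsOM; [apply: ctsOX ctsO_dist|exact: sqr_cmod_ctsO].
have F0 w : 0 <= dist w ^+ 2 * cmod (v w) ^+ 2 by rewrite mulr_ge0 ?sqr_ge0.
rewrite [(c * _)%:E]EFinM -muleA -iOZ ?(ltW k0)//.
pose a := plane_of z; have az : pt a = z by exact: plane_ofK.
have Ha w : nrm (w - pt a) <= 2 * r -> Omega w.
  by rewrite az => wz; apply: (@dist_in z); rewrite /r in wz; lra.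
rewrite -az; apply: le_trans (box_mean_value hv r0 Ha) _.
apply: lee_wpmul2l; first by rewrite lee_fin ltW.
have kc : ctsO (fun w => 4 / e ^+ 2 * (dist w ^+ 2 * cmod (v w) ^+ 2)).
  by apply: ctsOM => //; exact: ctsO_cst.
apply: le_trans (box_sub_iO kc _ Ha); last by move=> w _; rewrite mulr_ge0// ltW.
have bO : box a r `<=` Ot by move=> x /box_nrm; exact: Ha.
apply: ge0_le_integral; first exact: measurable_box.
- by move=> x _; rewrite lee_fin sqr_ge0.
- exact: measurable_funS measurable_Ot bO (ctsO_measE (sqr_cmod_ctsO hv)).
- exact: measurable_funS measurable_Ot bO (ctsO_measE kc).
move=> x /box_nrm; rewrite az => xz; rewrite lee_fin mulrA ler_peMl ?sqr_ge0//.
have dx : e / 2 <= dist (pt x).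
  by have := dist_lip z (pt x); rewrite nrm_distC /r in xz *; lra.
rewrite mulrAC ler_pdivlMr ?exprn_gt0// mul1r.
have -> : 4 * dist (pt x) ^+ 2 = (2 * dist (pt x)) ^+ 2 by ring.
by rewrite lerXn2r// ?nnegrE; lra.
Qed.

(** At distance [e] from the boundary [radial h] is controlled by
    [interior_sup].  It vanishes at the origin, and the segment to the origin stays
    away from the boundary by concavity of [dist], so that integrating it along the
    ray controls [h]. *)
Lemma interior_bound (e : R) : 0 < e <= dist 0 -> exists2 K : R, 0 < K &
  forall h (x : R), holomorphic_on Omega h -> h 0 = 0 ->
  (iO (fun w => dist w ^+ 2 * cmod (radial h w) ^+ 2)%R <= x%:E)%E ->
  forall z, Omega z -> e <= dist z ->
  cmod (radial h z) ^+ 2 <= K * x /\ cmod (h z) ^+ 2 <= K * x.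
Proof.
move=> /andP[e0 e1]; have [B B0 HB] := bounded_nrm.
have [K K0 HK] := @interior_sup (e / 2) (divr_gt0 e0 (ltr0n _ 2)).
pose rho := e / (2 * B); have rho0 : 0 < rho by rewrite divr_gt0// mulr_gt0.
have rB : rho * B = e / 2 by rewrite /rho; field; rewrite gt_eqF.
clearbody rho.
have q0 : 0 <= 64 / rho ^+ 2 by rewrite divr_ge0// sqr_ge0.
exists (K * (1 + 64 / rho ^+ 2)) => [|h x hh h0 Hx z Oz ez].
  by rewrite mulr_gt0// ltr_pwDl.
have x0 : 0 <= x.
  rewrite -lee_fin; apply: le_trans Hx; apply: iO_ge0 => w _.
  by rewrite mulr_ge0 ?sqr_ge0.
have hR := hol_radial hh.
have sup w : Omega w -> e / 2 <= dist w -> cmod (radial h w) ^+ 2 <= K * x.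
  move=> Ow ew; rewrite -lee_fin; apply: (le_trans (HK _ _ hR Ow ew)).
  by rewrite EFinM lee_wpmul2l// lee_fin ltW.
have Kx : K * x <= K * (1 + 64 / rho ^+ 2) * x.
  by rewrite -mulrA ler_wpM2l ?(ltW K0)// ler_peMl// lerDl.
split; first by apply: le_trans Kx; apply: sup => //; lra.
set M := Num.sqrt (K * x).
have supM w : Omega w -> e / 2 <= dist w -> cmod (radial h w) <= M.
  move=> Ow ew; apply: sqr_le_cmod; rewrite ?cmod_ge0 ?mulr_ge0// ?(ltW K0)//.
  exact: sup.
have Rh0 : radial h 0 = 0.
  by rewrite radialE /lin big1// => k _; rewrite mxE mul0r.
have : cmod (h z - h 0) <= 8 * M / rho.
  apply: ray_bound => // t /andP[t0 t1]; apply: origin_quotient => //.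
  - move=> s sr; have sz : nrm (s *: z) <= e / 2.
      rewrite nrmZ -rB; apply: ler_pM; rewrite ?cmod_ge0 ?nrm_ge0//; exact: HB.
    have Os : Omega (s *: z) by apply: (@dist_in 0); rewrite subr0; lra.
    split=> //; apply: supM => //.
    by have := dist_lip 0 (s *: z); rewrite sub0r nrmN; lra.
  - move=> s s01; apply: supM; first exact: scale_in.
    apply: le_trans (dist_scale_min Oz s01); rewrite le_min; apply/andP; split; lra.
  - by rewrite (ltW t0).
rewrite h0 subr0 => hM; apply: (@le_trans _ _ ((8 * M / rho) ^+ 2)).
  by rewrite lerXn2r// nnegrE ?cmod_ge0// (le_trans (cmod_ge0 _) hM).
rewrite !exprMn sqr_sqrtr ?mulr_ge0 ?(ltW K0)//.
have -> : 8 ^+ 2 * (K * x) * rho^-1 ^+ 2 = K * (64 / rho ^+ 2) * x by field; rewrite gt_eqF.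
by rewrite -mulrA -[leRHS]mulrA ler_wpM2l ?(ltW K0)// ler_wpM2r// lerDr.
Qed.

(** * Hardy's inequality and the converse bound *)

Lemma bernoulli (t : R) m : 0 <= t <= 1 -> 1 - m%:R * (1 - t) <= t ^+ m.
Proof.
move=> /andP[t0 t1]; elim: m => [|m IH]; first by rewrite mul0r subr0 expr0.
rewrite exprS; have h := ler_wpM2l t0 IH; apply: le_trans h.
have : 0 <= m%:R * (1 - t) * (1 - t) by rewrite !mulr_ge0// subr_ge0.
rewrite -natr1; nra.
Qed.

(** The cost of a change of variables by a dilation is of first order in
    [1 - t]. *)
Lemma dilation_factor (t : R) m : 1 / 2 <= t <= 1 ->
  (t^-1) ^+ m - t <= (m%:R * 2 ^+ m + 1) * (1 - t).
Proof.
move=> /andP[t0 t1]; have tp : 0 < t by lra.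
have h : m%:R * (1 - t) * (t^-1) ^+ m <= m%:R * (1 - t) * 2 ^+ m.
  rewrite ler_wpM2l ?mulr_ge0 ?subr_ge0// lerXn2r ?nnegrE ?invr_ge0 ?(ltW tp)//.
  by rewrite -div1r ler_pdivrMr//; lra.
have b : 1 - m%:R * (1 - t) <= t ^+ m by apply: bernoulli; rewrite (ltW tp).
have i0 : 0 < (t^-1) ^+ m by rewrite exprn_gt0// invr_gt0.
have := ler_wpM2r (ltW i0) b; rewrite -exprMn mulfV ?gt_eqF// expr1n mulrBl mul1r.
move: h; move: (_ ^+ m) (2 ^+ m) => p q; move: (m%:R) => k; lra.
Qed.

Lemma iO_fin F (M : R) : ctsO F -> (forall z, Omega z -> 0 <= F z <= M) ->
  exists2 x : R, 0 <= x & iO F = x%:E.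
Proof.
move=> cF FM; have F0 : (0 <= iO F)%E by apply: iO_ge0 => z /FM/andP[].
have : (iO F < +oo)%E.
  apply: le_lt_trans (iO_bound cF FM) _.
  by have := vol_fin; rewrite -ge0_fin_numE ?iO_ge0// => /fineK <-; rewrite -EFinM ltry.
rewrite -ge0_fin_numE// => /fineK <-; exists (fine (iO F)) => //.
by rewrite fine_ge0.
Qed.

Lemma dist_max : exists2 D : R, 0 < D & forall z, Omega z -> dist z <= D /\ nrm z <= D.
Proof.
have [B B0 HB] := bounded_nrm; have d0 := dist_gt0 Omega0.
exists (dist 0 + B) => [|z Oz]; first by rewrite addr_gt0.
have := HB _ Oz; have := dist_lip z 0; rewrite subr0; lra.
Qed.

Definition hardy_const : R := (2 * n.+1)%:R * 2 ^+ (2 * n.+1) + 1.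

(** The inequality behind [hardy] at a point: [a], [a'] are [|u|] at [z] and [t z],
    [b] is [|R u|] at [z], and [d], [d'], [dd] are [dist] at [z], [t z] and [0]. *)
Lemma hardy_pointwise (a b a' d d' dd s t D M M2 : R) :
  0 <= s -> 0 <= a -> 0 <= b -> 0 <= a' -> 0 <= d -> 0 <= d' -> 0 <= D -> 0 <= M ->
  0 <= M2 -> t * d + s * dd <= d' -> d' <= d + s * D -> d' <= D ->
  a <= a' + s * b + M2 * s ^+ 2 -> a <= M -> b <= M ->
  t * (d * a ^+ 2) + s * dd * a ^+ 2 <=
    d' * a' ^+ 2 + (s * (2 * (d * (a * b))) + s ^+ 2 * (2 * D * M ^+ 2 + 2 * D * M2 * M)).
Proof.
move=> s0 a0 b0 a'0 d00 d'0 D0 M0 M20 d1 d2 d4 uu hu1 hu2.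
have sq1 : a ^+ 2 <= a' ^+ 2 + 2 * s * (a * b) + 2 * M2 * s ^+ 2 * a.
  have : 0 <= s * b + M2 * s ^+ 2 by rewrite addr_ge0 ?mulr_ge0 ?sqr_ge0.
  have -> : a' ^+ 2 + 2 * s * (a * b) + 2 * M2 * s ^+ 2 * a =
    a' ^+ 2 + 2 * a * (s * b + M2 * s ^+ 2) by ring.
  move: uu; rewrite -addrA; move: (s * b + _); clear s0 d1 d2 d4 hu1 hu2 => c ac c0.
  by have [aa|/ltW aa] := lerP a c; nra.
have e1 : t * (d * a ^+ 2) + s * dd * a ^+ 2 <= d' * a ^+ 2.
  have -> : t * (d * a ^+ 2) + s * dd * a ^+ 2 = (t * d + s * dd) * a ^+ 2 by ring.
  by rewrite ler_wpM2r ?sqr_ge0.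
have e2 := ler_wpM2l d'0 sq1.
have e3 : d' * (2 * s * (a * b)) <= 2 * s * (d * (a * b)) + s ^+ 2 * (2 * D * M ^+ 2).
  have ab : a * b <= M ^+ 2 by rewrite expr2; apply: ler_pM.
  have ab0 : 0 <= a * b by rewrite mulr_ge0.
  have sab : 0 <= 2 * s * (a * b) by rewrite !mulr_ge0.
  apply: le_trans (ler_wpM2r sab d2) _.
  have : s ^+ 2 * (2 * D * (a * b)) <= s ^+ 2 * (2 * D * M ^+ 2).
    by rewrite ler_wpM2l ?sqr_ge0// ler_wpM2l// mulr_ge0.
  lra.
have e4 : d' * (2 * M2 * s ^+ 2 * a) <= s ^+ 2 * (2 * D * M2 * M).
  have -> : s ^+ 2 * (2 * D * M2 * M) = D * (2 * M2 * s ^+ 2 * M) by ring.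
  have k0 : 0 <= 2 * M2 * s ^+ 2 by rewrite mulr_ge0 ?sqr_ge0// mulr_ge0.
  exact: ler_pM d'0 (mulr_ge0 k0 a0) d4 (ler_wpM2l k0 hu1).
lra.
Qed.

(** Hardy's inequality for the radial derivative.  The integral of [dist |u|^2]
    is compared with that of its dilate by [t]: by concavity
    [dist (t z) >= t dist z + (1 - t) dist 0], and [u (t z)] differs from
    [u z - (1 - t) radial u z] by at most [M2 (1 - t)^2].  After division by
    [1 - t], the term [dist 0 |u|^2] survives when [t] tends to [1]. *)
Lemma hardy u (M M2 t0 : R) : holomorphic_on Omega u -> t0 < 1 ->
  (forall z, Omega z -> cmod (u z) <= M /\ cmod (radial u z) <= M) ->
  (forall t, t0 <= t <= 1 -> forall z, Omega z ->
     cmod (u ((t%:C)%C *: z) - u z + ((1 - t)%:C)%C * radial u z) <= M2 * (1 - t) ^+ 2) ->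
  ((dist 0)%:E * iO (fun z => cmod (u z) ^+ 2)%R <=
   hardy_const%:E * iO (fun z => dist z * cmod (u z) ^+ 2)%R +
   iO (fun z => 2 * (dist z * (cmod (u z) * cmod (radial u z))))%R)%E.
Proof.
move=> hu t01 HM HT; set A := hardy_const; have [D D0 HD] := dist_max.
have hR := hol_radial hu.
pose m := (2 * n.+1)%N.
have M0 : 0 <= M by apply: le_trans (HM _ Omega0).1; exact: cmod_ge0.
have cu := ctsO_cmod hu; have cR := ctsO_cmod hR.
have c2 := sqr_cmod_ctsO hu.
pose FU z := cmod (u z) ^+ 2; pose FI z := dist z * cmod (u z) ^+ 2.
pose FV z := 2 * (dist z * (cmod (u z) * cmod (radial u z))).
have cI : ctsO FI by apply: ctsOM => //; exact: ctsO_dist.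
have cV : ctsO FV.
  apply: ctsOM; first exact: ctsO_cst.
  by apply: ctsOM; [exact: ctsO_dist|exact: ctsOM].
have FU0 z : Omega z -> 0 <= FU z by rewrite sqr_ge0.
have FI0 z : Omega z -> 0 <= FI z by rewrite mulr_ge0 ?dist_ge0 ?sqr_ge0.
have FV0 z : Omega z -> 0 <= FV z by rewrite !mulr_ge0 ?dist_ge0 ?cmod_ge0.
have u2M z : Omega z -> cmod (u z) ^+ 2 <= M ^+ 2.
  by move=> /HM[h _]; rewrite lerXn2r// nnegrE ?cmod_ge0.
have [U U0 UE] : exists2 x : R, 0 <= x & iO FU = x%:E.
  by apply: (@iO_fin _ (M ^+ 2)) => // z Oz; rewrite FU0//= u2M.
have [I I0 IE] : exists2 x : R, 0 <= x & iO FI = x%:E.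
  apply: (@iO_fin _ (D * M ^+ 2)) => // z Oz; rewrite FI0//=.
  by apply: ler_pM; rewrite ?dist_ge0 ?sqr_ge0 ?u2M//; case: (HD z Oz).
have [V V0 VE] : exists2 x : R, 0 <= x & iO FV = x%:E.
  apply: (@iO_fin _ (2 * (D * (M * M)))) => // z Oz; rewrite FV0//= /FV ler_wpM2l//.
  have [h1 h2] := HM z Oz; have [h3 _] := HD z Oz.
  apply: ler_pM; rewrite ?dist_ge0 ?mulr_ge0 ?cmod_ge0//.
  by apply: ler_pM; rewrite ?cmod_ge0.
have [v v0 vE] : exists2 x : R, 0 <= x & vol = x%:E.
  by apply: (@iO_fin _ 1) => [|z _]; [exact: ctsO_cst|rewrite ler01 lexx].
rewrite -/FU -/FI -/FV UE IE VE -!EFinM -EFinD lee_fin.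
pose M2' := Num.max M2 0; have M2p : 0 <= M2' by rewrite le_max lexx orbT.
pose K := 2 * D * M ^+ 2 + 2 * D * M2' * M.
have K0 : 0 <= K by rewrite addr_ge0 ?mulr_ge0 ?sqr_ge0// ltW.
apply/ler_addgt0Pr => e e0.
have Kv1 : 0 < 1 + K * v by rewrite ltr_pwDl// mulr_ge0.
pose s := Num.min (Num.min (1 / 2) (1 - t0)) (e / (1 + K * v)).
have s0 : 0 < s by rewrite !lt_min divr_gt0//= subr_gt0 t01 divr_gt0.
have s2 : s <= 1 / 2 by rewrite !ge_min lexx.
have st : s <= 1 - t0 by rewrite !ge_min lexx orbT.
have se : s * (K * v) <= e.
  apply: (@le_trans _ _ (e / (1 + K * v) * (1 + K * v))); last by rewrite divfK// gt_eqF.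
  by apply: ler_pM; rewrite ?(ltW s0) ?mulr_ge0 ?lerDr// ge_min lexx orbT.
clearbody s; pose t := 1 - s; have sE : 1 - t = s by rewrite /t; ring.
have [tI t1 tp tn] : [/\ t0 <= t <= 1, 1 / 2 <= t <= 1, 0 < t <= 1 & 0 <= t <= 1].
  have t1 : t <= 1 by rewrite gerBl ltW.
  have th : 1 / 2 <= t by rewrite /t; lra.
  have tp : 0 < t by apply: lt_le_trans th; rewrite divr_gt0.
  by rewrite t1 th tp (ltW tp) !andbT; split=> //; rewrite lerBrDr addrC -lerBrDr.
clearbody t.
(* The comparison before integration; [K] gathers the errors of second order. *)
have ptw z : Omega z -> t * FI z + s * dist 0 * FU z <=
    FI ((t%:C)%C *: z) + (s * FV z + s ^+ 2 * K * 1).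
  move=> Oz; have := dist_concave Oz tn; rewrite sE => d1.
  have [hu1 hu2] := HM z Oz; have [d3 n3] := HD z Oz.
  have Ot' := scale_in Oz tn; have [d4 _] := HD _ Ot'.
  have d2 : dist ((t%:C)%C *: z) <= dist z + s * D.
    apply: le_trans (dist_lip _ z) _; rewrite lerD2l -{2}[z]scale1r -scalerBl.
    rewrite nrmZ -[1]/((1%:C)%C) -rmorphB cmod_real distrC sE ger0_norm ?(ltW s0)//.
    by rewrite ler_wpM2l// ltW.
  have := HT t tI z Oz; rewrite sE => T1.
  have uu : cmod (u z) <= cmod (u ((t%:C)%C *: z)) + s * cmod (radial u z) + M2' * s ^+ 2.
    have E : u z = u ((t%:C)%C *: z) + (s%:C)%C * radial u z -
      (u ((t%:C)%C *: z) - u z + (s%:C)%C * radial u z) by ring.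
    rewrite {1}E; apply: le_trans (cmodB _ _) _; apply: lerD.
      by apply: le_trans (cmodD _ _) _; rewrite cmodM cmod_real ger0_norm ?(ltW s0).
    by apply: (le_trans T1); rewrite ler_wpM2r ?sqr_ge0// le_max lexx.
  rewrite /FI /FU /FV mulr1; apply: hardy_pointwise => //; try exact: ltW.
  - exact: cmod_ge0.
  - exact: cmod_ge0.
  - exact: cmod_ge0.
  - exact: dist_ge0.
  - exact: dist_ge0.
have d0 := ltW (dist_gt0 Omega0).
have t0' : 0 <= t by case/andP: tn.
have sd : 0 <= s * dist 0 by rewrite mulr_ge0// ltW.
have sK : 0 <= s ^+ 2 * K by rewrite mulr_ge0 ?sqr_ge0.
have s0' := ltW s0.
have cZ (c : R) F : ctsO F -> ctsO (fun z => c * F z).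
  by move=> cF; apply: ctsOM => //; exact: ctsO_cst.
have cIt := ctsO_comp tn cI.
have c1 : ctsO (fun=> 1 : R) := ctsO_cst 1.
have FIt0 z : Omega z -> 0 <= FI ((t%:C)%C *: z) by move=> Oz; apply: FI0; exact: scale_in.
have main : t * I + s * dist 0 * U <= (t^-1) ^+ m * I + (s * V + s ^+ 2 * K * v).
  rewrite -lee_fin !EFinD.
  have -> : (t * I)%:E = iO (fun z => t * FI z) by rewrite iOZ// IE.
  have -> : (s * dist 0 * U)%:E = iO (fun z => s * dist 0 * FU z) by rewrite iOZ// UE.
  have -> : (s * V)%:E = iO (fun z => s * FV z) by rewrite iOZ// VE.
  have -> : (s ^+ 2 * K * v)%:E = iO (fun z => s ^+ 2 * K * 1) by rewrite iOZ// -/vol vE.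
  rewrite -!iOD//; try (by apply: cZ); try (by move=> z Oz; rewrite mulr_ge0 ?FI0 ?FU0 ?FV0).
  apply: (@le_trans _ _ (iO (fun z => FI ((t%:C)%C *: z)) +
    iO (fun z => s * FV z + s ^+ 2 * K * 1)%R)%E); last first.
    by apply: leeD2r; rewrite EFinM -IE; exact: iO_dilate.
  rewrite -iOD//; last 2 first.
  - by apply: ctsOD; exact: cZ.
  - by move=> z Oz; rewrite addr_ge0// mulr_ge0 ?FV0.
  apply: le_iO; [by apply: ctsOD; exact: cZ| |].
    by apply: ctsOD => //; apply: ctsOD; exact: cZ.
  by move=> z Oz; rewrite ptw// andbT addr_ge0// mulr_ge0 ?FI0 ?FU0.
have := dilation_factor m t1; rewrite -/hardy_const -/A sE => /(ler_wpM2r I0).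
rewrite mulrBl => fac.
have : s * (dist 0 * U) <= s * (A * I + V + s * (K * v)) by lra.
rewrite ler_pM2l// => h; apply: (le_trans h); rewrite lerD2l.
exact: se.
Qed.

(** The right-hand side of [hardy] is absorbed: near the boundary [dist |u|^2] is
    a small multiple of [|u|^2], in the interior [interior_bound] applies, and
    [dist |u| |R u|] is at most a small multiple of [|u|^2] plus a large one of
    [dist^2 |R u|^2]. *)
Lemma lp_upper_smooth : exists2 c : R, 0 < c & forall u (M M2 t0 x : R),
  holomorphic_on Omega u -> u 0 = 0 -> t0 < 1 ->
  (forall z, Omega z -> cmod (u z) <= M /\ cmod (radial u z) <= M) ->
  (forall t, t0 <= t <= 1 -> forall z, Omega z ->
     cmod (u ((t%:C)%C *: z) - u z + ((1 - t)%:C)%C * radial u z) <= M2 * (1 - t) ^+ 2) ->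
  (iO (fun w => dist w ^+ 2 * cmod (radial u w) ^+ 2)%R <= x%:E)%E ->
  (iO (fun w => cmod (u w) ^+ 2)%R <= (c * x)%:E)%E.
Proof.
have [D D0 HD] := dist_max; have dl0 := dist_gt0 Omega0.
set A := hardy_const.
have A1 : 1 <= A by rewrite /A /hardy_const lerDr mulr_ge0// exprn_ge0.
have A0 : 0 < A by apply: lt_le_trans A1.
pose e := dist 0 / (4 * A).
have e0 : 0 < e by rewrite divr_gt0// mulr_gt0.
have e1 : e <= dist 0.
  by rewrite ler_pdivrMr ?mulr_gt0// ler_peMr ?(ltW dl0)//; lra.
have Ae : A * e = dist 0 / 4 by rewrite /e; field; rewrite gt_eqF.
have [|K K0 HK] := @interior_bound e; first by rewrite e0.
have [v v0 vE] : exists2 x : R, 0 <= x & vol = x%:E.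
  by apply: (@iO_fin _ 1) => [|z _]; [exact: ctsO_cst|rewrite ler01 lexx].
set d := dist 0; rewrite -/d in dl0 Ae e1.
exists (2 / d * (4 / d + A * D * K * v)).
  by rewrite mulr_gt0 ?divr_gt0// ltr_pwDl ?divr_gt0// !mulr_ge0// ltW.
move=> u M M2 t0 x hu u0 t01 HM HT Hx.
have hR := hol_radial hu.
have M0 : 0 <= M by apply: le_trans (HM _ Omega0).1; exact: cmod_ge0.
have c2 := sqr_cmod_ctsO hu.
have cZ (c : R) F : ctsO F -> ctsO (fun z => c * F z).
  by move=> cF; apply: ctsOM => //; exact: ctsO_cst.
have c1 : ctsO (fun=> 1 : R) := ctsO_cst 1.
have sq0 z : 0 <= cmod (u z) ^+ 2 := sqr_ge0 _.
have cI : ctsO (fun z => dist z * cmod (u z) ^+ 2) by apply: ctsOM => //; exact: ctsO_dist.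
have cV : ctsO (fun z => 2 * (dist z * (cmod (u z) * cmod (radial u z)))).
  by apply: cZ; apply: ctsOM; [exact: ctsO_dist|apply: ctsOM; exact: ctsO_cmod].
have cX : ctsO (fun z => dist z ^+ 2 * cmod (radial u z) ^+ 2).
  by apply: ctsOM; [apply: ctsOX ctsO_dist|exact: sqr_cmod_ctsO].
have X0 z : 0 <= dist z ^+ 2 * cmod (radial u z) ^+ 2 by rewrite mulr_ge0 ?sqr_ge0.
have x0 : 0 <= x by rewrite -lee_fin; apply: le_trans Hx; apply: iO_ge0 => z _; exact: X0.
have [U U0 UE] : exists2 x : R, 0 <= x & iO (fun z => cmod (u z) ^+ 2) = x%:E.
  apply: (@iO_fin _ (M ^+ 2)) => // z /HM[h _].
  by rewrite sqr_ge0 lerXn2r// nnegrE ?cmod_ge0.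
have Kx0 : 0 <= A * D * (K * x) by rewrite !mulr_ge0// ltW.
have d4 : 0 <= d / 4 by rewrite divr_ge0// ltW.
have d4' : 0 <= 4 / d by rewrite divr_ge0// ltW.
have HI : (A%:E * iO (fun z => dist z * cmod (u z) ^+ 2)%R <=
    (d / 4 * U + A * D * (K * x) * v)%:E)%E.
  rewrite -iOZ ?(ltW A0)//; last by move=> z _; rewrite mulr_ge0 ?dist_ge0.
  apply: (@le_trans _ _ (iO (fun z => d / 4 * cmod (u z) ^+ 2 + A * D * (K * x) * 1)%R)).
    apply: le_iO; [exact: cZ|by apply: ctsOD; exact: cZ|move=> z Oz].
    apply/andP; split.
      by apply: mulr_ge0; [exact: ltW|rewrite mulr_ge0 ?dist_ge0].
    rewrite [A * D * _ * 1]mulr1.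
    have [de|ed] := lerP (dist z) e.
      rewrite -[leLHS]addr0 mulrA; apply: lerD => //; rewrite ler_wpM2r// -Ae.
      by rewrite ler_wpM2l// ltW.
    rewrite -[leLHS]add0r; apply: lerD; first by rewrite mulr_ge0.
    have [_ h2] := HK _ _ hu u0 Hx z Oz (ltW ed).
    rewrite -mulrA ler_wpM2l ?(ltW A0)//; apply: ler_pM; rewrite ?dist_ge0//.
    by case: (HD z Oz).
  rewrite iOD; [|exact: cZ|exact: cZ|by move=> z _; rewrite mulr_ge0|by move=> z _; rewrite mulr1].
  by rewrite iOZ// UE iOZ// -/vol vE.
have HV : (iO (fun z => 2 * (dist z * (cmod (u z) * cmod (radial u z))))%R <=
    (d / 4 * U + 4 / d * x)%:E)%E.
  apply: (@le_trans _ _ (iO (fun z => d / 4 * cmod (u z) ^+ 2 +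
      4 / d * (dist z ^+ 2 * cmod (radial u z) ^+ 2))%R)).
    apply: le_iO => //; first by apply: ctsOD; exact: cZ.
    move=> z Oz; rewrite !mulr_ge0 ?dist_ge0 ?cmod_ge0//=.
    move: (cmod (u z)) (cmod (radial u z)) (dist z) => a b dd.
    rewrite -subr_ge0.
    have -> : d / 4 * a ^+ 2 + 4 / d * (dd ^+ 2 * b ^+ 2) - 2 * (dd * (a * b)) =
        4 / d * (d / 4 * a - dd * b) ^+ 2.
      by field; rewrite gt_eqF.
    by rewrite mulr_ge0// sqr_ge0.
  rewrite iOD; [|exact: cZ|exact: cZ|by move=> z _; rewrite mulr_ge0|by move=> z _; rewrite mulr_ge0].
  rewrite iOZ// UE iOZ// EFinD [(4 / d * x)%:E]EFinM; apply: leeD2l.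
  by apply: lee_wpmul2l.
have := hardy hu t01 HM HT; rewrite -/d -/A UE -EFinM => /le_trans/(_ (leeD HI HV)).
rewrite -EFinD !lee_fin => main.
have -> : 2 / d * (4 / d + A * D * K * v) * x =
  2 / d * (4 / d * x + A * D * (K * x) * v) by ring.
rewrite mulrAC ler_pdivlMr//; lra.
Qed.

Lemma is_grad_dilate h (c : C) z d : is_grad h (c *: z) d ->
  is_grad (fun w => h (c *: w)) z (fun k => c * d k).
Proof.
move=> H e e0; have k0 : 0 < 1 + cmod c by rewrite ltr_pwDl// cmod_ge0.
have [del d0 Hd] := H _ (divr_gt0 e0 k0).
exists (del / (1 + cmod c)); first by rewrite divr_gt0.
move=> v; rewrite ltr_pdivlMr// => hv.
have nc : nrm (c *: v) <= nrm v * (1 + cmod c).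
  by rewrite nrmZ mulrC ler_wpM2l ?nrm_ge0// lerDr.
have -> : lin (fun k => c * d k) v = lin d (c *: v).
  by rewrite linZ /lin mulr_sumr; apply: eq_bigr => k _; ring.
rewrite scalerDr; apply: le_trans (Hd _ (le_lt_trans nc hv)) _.
by rewrite mulrAC ler_pdivrMr// -mulrA ler_wpM2l// ltW.
Qed.

Lemma hol_dilate h (r : R) : 0 <= r <= 1 -> holomorphic_on Omega h ->
  holomorphic_on Omega (fun z => h ((r%:C)%C *: z)) /\
  forall z, Omega z -> radial (fun w => h ((r%:C)%C *: w)) z = radial h ((r%:C)%C *: z).
Proof.
move=> r01 hh; pose u z := h ((r%:C)%C *: z).
have Hg z : Omega z -> is_grad u z (fun k => (r%:C)%C * grad h ((r%:C)%C *: z) k).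
  by move=> Oz; apply: is_grad_dilate; apply: hol_grad => //; exact: scale_in.
split; first by apply: grad_hol => z /Hg; eexists; eassumption.
move=> z /Hg/is_grad_grad gE; rewrite !radialE gE linZ /lin mulr_sumr.
by apply: eq_bigr => k _; ring.
Qed.

Lemma limn_einf_le (v : nat -> \bar R) (M : \bar R) :
  (forall k, (v k <= M)%E) -> (limn_einf v <= M)%E.
Proof.
move=> vM; rewrite limn_einf_lim (cvg_lim _ (@cvg_einfs_sup _ v))//.
apply: ge_ereal_sup => _ [k _ <-]; apply: le_trans (vM k).
by apply: ereal_inf_lbound; exists k => /=.
Qed.

Lemma iO_fatou (Fk : nat -> Cn -> R) F (M : \bar R) : (forall k, ctsO (Fk k)) ->
  (forall k z, Omega z -> 0 <= Fk k z) ->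
  (forall z, Omega z -> (fun k => Fk k z) @ \oo --> F z) ->
  (forall k, iO (Fk k) <= M)%E -> (iO F <= M)%E.
Proof.
move=> cF F0 FF FM.
have -> : iO F = (\int[mu]_(x in Ot) limn_einf (fun k => (Fk k (pt x))%:E))%E.
  apply: eq_integral => x /set_mem Ox.
  have cv : (fun k => (Fk k (pt x))%:E) @ \oo --> (F (pt x))%:E.
    by apply: cvg_EFin; [exact: nearW|exact: FF].
  by rewrite is_cvg_limn_einfE ?(cvg_lim _ cv)//; apply: cvgP cv.
apply: le_trans (fatou _ measurable_Ot (fun k => ctsO_measE (cF k)) _) _.
  by move=> k x Ox; rewrite lee_fin F0.
exact: limn_einf_le.
Qed.

Lemma cconv_sqr (u : nat -> C) (l : C) : cconv u l ->
  (fun k => cmod (u k) ^+ 2) @ \oo --> cmod l ^+ 2.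
Proof.
move=> ul; have cu : (fun k => cmod (u k)) @ \oo --> cmod l.
  apply/cvgrPdist_le => e /ul[N HN]; exists N => // k /= /HN.
  apply: le_trans; rewrite ler_norml.
  have k1 := cmodD (u k - l) l; have k2 := cmodD (l - u k) (u k).
  by rewrite !subrK in k1 k2; rewrite (cmod_distC l) in k2; lra.
under eq_fun do rewrite expr2; rewrite expr2; exact: cvgM.
Qed.

(** Dilation ratios between [1 / 2] and [1], tending to [1]. *)
Definition rk k : R := 1 - (k.+2%:R)^-1.

Lemma rk1 k : 1 / 2 <= rk k < 1.
Proof.
rewrite /rk gtrBl invr_gt0 ltr0n andbT.
have : (k.+2%:R)^-1 <= 2^-1 :> R by rewrite lef_pV2 ?posrE ?ltr0n// ler_nat.
move: (k.+2%:R^-1) => q q2; lra.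
Qed.

Lemma rk01 k : 0 <= rk k <= 1.
Proof. by have /andP[a b] := rk1 k; apply/andP; split; lra. Qed.

Lemma rk_conv h z : holomorphic_on Omega h -> Omega z ->
  cconv (fun k => h (((rk k)%:C)%C *: z)) (h z).
Proof.
move=> hh Oz e e0; have [d d0 Hd] := is_grad_cts (hol_grad hh Oz) e0.
have k0 : 0 < 1 + nrm z by rewrite ltr_pwDl// nrm_ge0.
pose N := Num.bound ((1 + nrm z) / d); exists N => k Nk; apply/ltW/Hd.
have -> : ((rk k)%:C)%C *: z - z = ((- k.+2%:R^-1)%:C)%C *: z.
  rewrite -{2}[z]scale1r -scalerBl; congr (_ *: z).
  by rewrite -[1]/((1%:C)%C) -rmorphB; congr (_%:C)%C; rewrite /rk; ring.
rewrite nrmZ cmod_real normrN ger0_norm ?invr_ge0// mulrC ltr_pdivrMr ?ltr0n//.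
have b0 : 0 <= (1 + nrm z) / d by rewrite divr_ge0 ?(ltW k0)// ltW.
have := archi_boundP b0; rewrite ltr_pdivrMr// => h1.
apply: (@lt_le_trans _ _ (N%:R * d)).
  by apply: le_lt_trans h1; rewrite lerDr.
by rewrite mulrC ler_wpM2l ?(ltW d0)// ler_nat (leq_trans Nk)// ltnW// ltnW.
Qed.

(** The converse half of the Littlewood-Paley equivalence.  Dilates [h (r z)] are
    smooth up to the boundary, and Fatou's lemma lets [r] tend to [1]. *)
Lemma lp_upper : exists2 c : R, 0 < c & forall h, holomorphic_on Omega h -> h 0 = 0 ->
  (iO (fun z => cmod (h z) ^+ 2)%R <=
     c%:E * iO (fun z => dist z ^+ 2 * cmod (radial h z) ^+ 2)%R)%E.
Proof.
have [C C0 HC] := lp_upper_smooth; have [D D0 HD] := dist_max.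
(* A dilation by r >= 1 / 2 costs 2 ^ (2 * n.+1) in the change of variables and
   2 ^ 2 in the comparison of [dist z] with [dist (r z)]. *)
exists (C * 2 ^+ (2 * n.+1 + 2)) => [|h hh h0]; first by rewrite mulr_gt0// exprn_gt0.
have hR := hol_radial hh.
set X := iO (fun z => dist z ^+ 2 * _).
have cX : ctsO (fun z => dist z ^+ 2 * cmod (radial h z) ^+ 2).
  by apply: ctsOM; [apply: ctsOX ctsO_dist|exact: sqr_cmod_ctsO].
have F0 z : 0 <= dist z ^+ 2 * cmod (radial h z) ^+ 2 by rewrite mulr_ge0 ?sqr_ge0.
have X0 : (0 <= X)%E by apply: iO_ge0 => z _.
have K0 : 0 < C * 2 ^+ (2 * n.+1 + 2) by rewrite mulr_gt0// exprn_gt0.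
have [Xy|Xfin] := eqVneq X +oo%E; first by rewrite Xy mulry gtr0_sg// mul1e leey.
have XE : X = (fine X)%:E by rewrite fineK// ge0_fin_numE// lt_neqAle Xfin leey.
set x := fine X in XE; have x0 : 0 <= x by rewrite -lee_fin -XE.
have dil (r : R) : 1 / 2 <= r < 1 ->
    (iO (fun z => cmod (h ((r%:C)%C *: z)) ^+ 2)%R <= (C * (2 ^+ (2 * n.+1 + 2) * x))%:E)%E.
  move=> /andP[r1 r2]; have r0 : 0 < r by lra.
  have r01 : 0 <= r <= 1 by rewrite ltW//=; lra.
  pose e := (1 - r) * dist 0 / 2.
  have e0 : 0 < e by rewrite divr_gt0// mulr_gt0 ?dist_gt0// subr_gt0.
  have e1 : e <= dist 0.
    have h1 : (1 - r) * dist 0 <= dist 0 by rewrite ler_piMl ?dist_ge0//; lra.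
    by have := dist_ge0 0; rewrite /e; lra.
  have [|K Kp HK] := @interior_bound e; first by rewrite e0.
  have Hx : (iO (fun w => dist w ^+ 2 * cmod (radial h w) ^+ 2)%R <= x%:E)%E by rewrite -XE.
  pose M := Num.sqrt (K * x); have Kx : 0 <= K * x by rewrite mulr_ge0// ltW.
  have HM z : Omega z -> e <= dist z -> cmod (h z) <= M /\ cmod (radial h z) <= M.
    move=> Oz ez; have [b1 b2] := HK h x hh h0 Hx z Oz ez.
    by split; apply: sqr_le_cmod; rewrite ?cmod_ge0.
  pose u z := h ((r%:C)%C *: z).
  have [hu Ru] := hol_dilate r01 hh; rewrite -/u in hu Ru.
  have er z : Omega z -> 2 * e <= dist ((r%:C)%C *: z).
    by move=> Oz; apply: le_trans (dist_scale Oz r01); rewrite /e; lra.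
  (* For t0 <= t <= 1, [t r z] is within [e / 4] of [r z], as [taylor2] requires. *)
  pose t0 := 1 - Num.min 1 (e / (4 * D)).
  have m0 : 0 < Num.min 1 (e / (4 * D)) by rewrite lt_min ltr01 divr_gt0// mulr_gt0.
  apply: (HC u M (128 * M / e ^+ 2 * D ^+ 2) t0) => //.
  - by rewrite /u scaler0.
  - by rewrite /t0 gtrBl.
  - move=> z Oz; rewrite Ru//; apply: HM; first exact: scale_in.
    by apply: le_trans (er z Oz); lra.
  - move=> t /andP[t1 t2] z Oz.
    have mE1 : Num.min 1 (e / (4 * D)) <= 1 by rewrite ge_min lexx.
    have mE2 : Num.min 1 (e / (4 * D)) <= e / (4 * D) by rewrite ge_min lexx orbT.
    have tt : 1 - t <= e / (4 * D) by rewrite /t0 in t1; lra.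
    have [dz nz] := HD z Oz; have Oz' := scale_in Oz r01.
    pose v := ((t - 1)%:C)%C *: ((r%:C)%C *: z).
    have vE : (r%:C)%C *: z + v = (r%:C)%C *: ((t%:C)%C *: z).
      rewrite /v -{1}[(r%:C)%C *: z]scale1r -scalerDl !scalerA mulrC; congr (_ *: z).
      by rewrite -[1]/((1%:C)%C) -rmorphD addrC subrK.
    have nv : nrm v <= (1 - t) * D.
      rewrite /v !nrmZ !cmod_real distrC !ger0_norm ?(ltW r0) ?subr_ge0//.
      rewrite ler_wpM2l ?subr_ge0//; apply: le_trans nz; rewrite ler_piMl ?nrm_ge0//; exact: ltW.
    have nv4 : nrm v <= e / 4.
      apply: (le_trans nv); apply: (@le_trans _ _ (e / (4 * D) * D)).
        by rewrite ler_wpM2r// ltW.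
      by rewrite le_eqVlt; apply/orP; left; apply/eqP; field; rewrite gt_eqF.
    have HB w : nrm (w - (r%:C)%C *: z) <= e -> Omega w /\ e <= dist w.
      move=> wz; have hz := er z Oz; split.
        by apply: (@dist_in ((r%:C)%C *: z)); lra.
      by have := dist_lip ((r%:C)%C *: z) w; rewrite nrm_distC; lra.
    have := @taylor2 _ _ h ((r%:C)%C *: z) e M _ v e0 _ _ (hol_grad hh Oz') nv4.
    rewrite vE => T.
    have := T _ _; have {T} T : cmod (h ((r%:C)%C *: ((t%:C)%C *: z)) - h ((r%:C)%C *: z)
        - lin (grad h ((r%:C)%C *: z)) v) <= 128 * M / e ^+ 2 * nrm v ^+ 2.
      apply: T => w /HB[Ow ew]; last by case: (HM w Ow ew).
      by exists (grad h w); exact: hol_grad.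
    move=> _; rewrite Ru// /u radialE.
    have -> : ((1 - t)%:C)%C * lin (grad h ((r%:C)%C *: z)) ((r%:C)%C *: z) =
        - lin (grad h ((r%:C)%C *: z)) v.
      by rewrite /v [in RHS]linZ -mulNr -rmorphN opprB.
    apply: (le_trans T); rewrite -[leRHS]mulrA -exprMn.
    apply: ler_wpM2l; first by apply: divr_ge0; [apply: mulr_ge0; [exact: ler0n|exact: sqrtr_ge0]|exact: sqr_ge0].
    by rewrite lerXn2r ?nnegrE ?nrm_ge0 ?mulr_ge0 ?subr_ge0 ?(ltW D0)// mulrC.
  - pose G z := dist z ^+ 2 * cmod (radial h z) ^+ 2.
    have cG : ctsO (fun z => G ((r%:C)%C *: z)) := ctsO_comp r01 cX.
    have cu : ctsO (fun w => dist w ^+ 2 * cmod (radial u w) ^+ 2).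
      by apply: ctsOM; [apply: ctsOX ctsO_dist|exact: sqr_cmod_ctsO (hol_radial hu)].
    apply: (@le_trans _ _ (iO (fun z => 4 * G ((r%:C)%C *: z)))).
      apply: le_iO => //.
        by apply: ctsOM; [exact: ctsO_cst|exact: cG].
      move=> z Oz; rewrite mulr_ge0 ?sqr_ge0//= Ru// /G mulrA ler_wpM2r ?sqr_ge0//.
      have dc := dist_concave Oz r01.
      have dd : dist z <= 2 * dist ((r%:C)%C *: z).
        have h1 : 0 <= (1 - r) * dist 0 by rewrite mulr_ge0 ?dist_ge0// subr_ge0 ltW.
        have h2 : (1 / 2) * dist z <= r * dist z by rewrite ler_wpM2r// dist_ge0.
        by lra.
      have -> : 4 * dist ((r%:C)%C *: z) ^+ 2 = (2 * dist ((r%:C)%C *: z)) ^+ 2 by ring.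
      by rewrite lerXn2r ?nnegrE ?mulr_ge0 ?dist_ge0.
    rewrite (iOZ (ler0n _ 4) cG); last by move=> z _; rewrite /G.
    have -> : 2 ^+ (2 * n.+1 + 2) * x = 4 * (2 ^+ (2 * n.+1) * x).
      by rewrite exprD; ring.
    rewrite EFinM lee_wpmul2l//; apply: le_trans (iO_dilate _ cX _) _; [by rewrite r0 ltW|by []|].
    rewrite -/X XE EFinM lee_wpmul2r ?lee_fin//.
    rewrite lerXn2r ?nnegrE ?invr_ge0 ?(ltW r0)//.
    by rewrite -div1r ler_pdivrMr//; lra.
rewrite XE -EFinM -mulrA.
apply: (@iO_fatou (fun k z => cmod (h (((rk k)%:C)%C *: z)) ^+ 2)).
- by move=> k; exact: (ctsO_comp (rk01 k) (sqr_cmod_ctsO hh)).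
- by move=> k z _; exact: sqr_ge0.
- by move=> z Oz; apply: cconv_sqr; exact: rk_conv.
- by move=> k; apply: dil; exact: rk1.
Qed.

(** * The inner product of the Bergman space *)

Local Notation A2O := (A2 Omega).
Local Arguments inner : simpl never.

Lemma conjcM (x y : C) : (x * y)^*%C = x^*%C * y^*%C.
Proof. exact: rmorphM. Qed.

Lemma sqnormE f : sqnorm Omega f = iO (fun z => cmod (f z) ^+ 2).
Proof. by []. Qed.

Definition nsq f : R := fine (sqnorm Omega f).

Lemma sqnorm_ge0 f : (0 <= sqnorm Omega f)%E.
Proof. by rewrite sqnormE; apply: iO_ge0 => z _; exact: sqr_ge0. Qed.

Lemma nsq_ge0 f : 0 <= nsq f.
Proof. exact/fine_ge0/sqnorm_ge0. Qed.

Lemma A2_nsq f : A2O f -> sqnorm Omega f = (nsq f)%:E.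
Proof. by move=> [_]; rewrite -ge0_fin_numE ?sqnorm_ge0// => /fineK ->. Qed.

Lemma holZD (a : C) f h : holomorphic_on Omega f -> holomorphic_on Omega h ->
  holomorphic_on Omega (fun w => a * f w + h w).
Proof.
move=> hf hh; apply: grad_hol => z Oz; eexists.
exact: is_gradD (is_gradZ a (hol_grad hf Oz)) (hol_grad hh Oz).
Qed.

Lemma grad_comb (a : C) f h z : holomorphic_on Omega f -> holomorphic_on Omega h ->
  Omega z -> radial (fun w => a * f w + h w) z = a * radial f z + radial h z.
Proof.
move=> hf hh Oz.
have /is_grad_grad E := is_gradD (is_gradZ a (hol_grad hf Oz)) (hol_grad hh Oz).
rewrite !radialE E /lin mulr_sumr -big_split /=.
by apply: eq_bigr => k _; rewrite mulrDr mulrCA.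
Qed.

Lemma hol_cst (c : C) : holomorphic_on Omega (fun=> c).
Proof. by move=> z _; exact: differentiable_cst. Qed.

Lemma radial_cst (c : C) z : radial (fun=> c) z = 0.
Proof.
rewrite radialE (@is_grad_grad _ _ (fun=> 0)).
  by rewrite /lin big1// => k _; rewrite mulr0.
move=> e e0; exists 1 => // v _; rewrite subrr sub0r /lin big1 ?oppr0 ?cmod0.
  by rewrite mulr_ge0 ?nrm_ge0// ltW.
by move=> k _; rewrite mulr0.
Qed.

Lemma sqnorm_comb (a : C) f h : holomorphic_on Omega f -> holomorphic_on Omega h ->
  (sqnorm Omega (fun w => a * f w + h w)%R
     <= (2 * cmod a ^+ 2)%:E * sqnorm Omega f + 2%:E * sqnorm Omega h)%E.
Proof.
move=> hf hh; have a0 : 0 <= 2 * cmod a ^+ 2 by apply: mulr_ge0; [exact: ler0n|exact: sqr_ge0].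
have cf := sqr_cmod_ctsO hf; have ch := sqr_cmod_ctsO hh.
have f0 z : Omega z -> 0 <= cmod (f z) ^+ 2 by move=> _; exact: sqr_ge0.
have h0 z : Omega z -> 0 <= cmod (h z) ^+ 2 by move=> _; exact: sqr_ge0.
have caf := ctsOM (ctsO_cst (2 * cmod a ^+ 2)) cf; have cbh := ctsOM (ctsO_cst 2) ch.
rewrite !sqnormE -(iOZ a0 cf f0) -(iOZ (ler0n _ 2) ch h0) -(iOD caf cbh); last 2 first.
- by move=> z Oz; apply: mulr_ge0 => //; exact: f0.
- by move=> z Oz; apply: mulr_ge0; [exact: ler0n|exact: h0].
apply: le_iO; [exact: sqr_cmod_ctsO (holZD a hf hh)|exact: ctsOD|].
move=> z _; rewrite sqr_ge0/=.
have := cmodD (a * f z) (h z); rewrite cmodM.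
have := cmod_ge0 (a * f z + h z); have := cmod_ge0 (h z).
have := mulr_ge0 (cmod_ge0 a) (cmod_ge0 (f z)).
move: (cmod (_ + _)) (cmod a) (cmod (f z)) (cmod (h z)) => s p q t pq t0 s0 st.
have -> : 2 * p ^+ 2 * q ^+ 2 = 2 * (p * q) ^+ 2 by ring.
move: (p * q) pq st => u u0 st.
have : s ^+ 2 <= (u + t) ^+ 2 by rewrite lerXn2r// nnegrE// addr_ge0.
have := sqr_ge0 (u - t); nra.
Qed.

Lemma A2_comb (a : C) f h : A2O f -> A2O h -> A2O (fun w => a * f w + h w).
Proof.
move=> Af Ah; have [hf _] := Af; have [hh _] := Ah; split; first exact: holZD.
apply: le_lt_trans (sqnorm_comb a hf hh) _.
by rewrite (A2_nsq Af) (A2_nsq Ah) -!EFinM -EFinD ltry.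
Qed.

Lemma A2_0 : A2O (fun=> 0).
Proof.
split; first exact: hol_cst.
rewrite sqnormE (_ : (fun=> _) = fun=> 0); last by apply/funext => z; rewrite cmod0 expr0n.
by apply: le_lt_trans (iO_bound (M := 0) (ctsO_cst 0) _) _; rewrite ?mul0e// => z _; rewrite lexx.
Qed.

Lemma eq_hol f h : (forall z, Omega z -> f z = h z) -> holomorphic_on Omega f ->
  holomorphic_on Omega h.
Proof.
move=> fh hf; apply: grad_hol => z Oz; exists (grad f z) => e e0.
have [d d0 Hd] := hol_grad hf Oz e0; exists (Num.min d (dist z)).
  by rewrite lt_min d0 dist_gt0.
move=> v; rewrite lt_min => /andP[/Hd H vd]; rewrite -!fh//.
by apply: (@dist_in z); rewrite addrAC subrr add0r.
Qed.

Lemma eq_grad f h z : (forall z, Omega z -> f z = h z) -> holomorphic_on Omega f ->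
  Omega z -> grad f z = grad h z.
Proof.
move=> fh hf Oz; apply/esym/is_grad_grad => e e0.
have [d d0 Hd] := hol_grad hf Oz e0; exists (Num.min d (dist z)).
  by rewrite lt_min d0 dist_gt0.
move=> v; rewrite lt_min => /andP[/Hd H vd]; rewrite -!fh//.
by apply: (@dist_in z); rewrite addrAC subrr add0r.
Qed.

Lemma eq_radial f h z : (forall z, Omega z -> f z = h z) -> holomorphic_on Omega f ->
  Omega z -> radial f z = radial h z.
Proof. by move=> fh hf Oz; rewrite !radialE (eq_grad fh hf Oz). Qed.

Lemma eq_sqnorm f h : (forall z, Omega z -> f z = h z) -> sqnorm Omega f = sqnorm Omega h.
Proof. by move=> fh; rewrite !sqnormE; apply: eq_iO => z /fh ->. Qed.

Lemma eq_A2 f h : (forall z, Omega z -> f z = h z) -> A2O f -> A2O h.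
Proof. by move=> fh [hf sf]; split; [exact: eq_hol hf|rewrite -(eq_sqnorm fh)]. Qed.

Definition rint F : R := Rintegral mu Ot (fun x => F (pt x)).
Definition itg F := mu.-integrable Ot (fun x => (F (pt x))%:E).

Lemma itg_dom F G : ctsO F -> ctsO G -> (forall z, Omega z -> `|F z| <= G z) ->
  (iO G < +oo)%E -> itg F.
Proof.
move=> cF cG FG Goo; apply/integrableP; split; first exact: ctsO_measE.
apply: le_lt_trans Goo; apply: ge0_le_integral; first exact: measurable_Ot.
- by move=> x _; exact: abse_ge0.
- exact: measurableT_comp (ctsO_measE cF).
- exact: ctsO_measE.
- by move=> x Ox; rewrite /= lee_fin; exact: FG.
Qed.

Lemma rintD F G : itg F -> itg G -> rint (fun z => F z + G z) = rint F + rint G.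
Proof. by move=> iF iG; exact: (RintegralD measurable_Ot iF iG). Qed.

Lemma rintZ (c : R) F : itg F -> rint (fun z => c * F z) = c * rint F.
Proof. by move=> iF; exact: (RintegralZl _ measurable_Ot iF). Qed.

Lemma itgD F G : itg F -> itg G -> itg (fun z => F z + G z).
Proof. by move=> iF iG; exact: (integrableD measurable_Ot iF iG). Qed.

Lemma itgZ (c : R) F : itg F -> itg (fun z => c * F z).
Proof. by move=> iF; exact: (integrableZl measurable_Ot c iF). Qed.

Lemma eq_rint F G : (forall z, Omega z -> F z = G z) -> rint F = rint G.
Proof. by move=> FG; apply: eq_Rintegral => x /set_mem/FG. Qed.

Let P f h z : R := complex.Re (f z * (h z)^*%C).
Let Q f h z : R := complex.Im (f z * (h z)^*%C).

Lemma innerE f h : inner Omega f h = (rint (P f h) +i* rint (Q f h))%C.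
Proof. by []. Qed.

Lemma ctsO_ReIm f : holomorphic_on Omega f ->
  ctsO (fun z => complex.Re (f z)) /\ ctsO (fun z => complex.Im (f z)).
Proof.
move=> hf; split=> z Oz e e0; have [d d0 Hd] := is_grad_cts (hol_grad hf Oz) e0;
  exists d => // w /Hd; apply: le_lt_trans.
  have -> : complex.Re (f w) - complex.Re (f z) = complex.Re (f w - f z).
    by case: (f w) (f z) => ? ? [].
  exact: ler_Re_cmod.
have -> : complex.Im (f w) - complex.Im (f z) = complex.Im (f w - f z).
  by case: (f w) (f z) => ? ? [].
exact: ler_Im_cmod.
Qed.

Lemma ctsO_P f h : holomorphic_on Omega f -> holomorphic_on Omega h -> ctsO (P f h).
Proof.
move=> /ctsO_ReIm[f1 f2] /ctsO_ReIm[h1 h2].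
have -> : P f h = fun z => complex.Re (f z) * complex.Re (h z)
    + complex.Im (f z) * complex.Im (h z).
  by apply/funext => z; rewrite /P; case: (f z) (h z) => a b [c d] /=; ring.
by apply: ctsOD; exact: ctsOM.
Qed.

(** Imaginary parts are real parts, after multiplication by [- i]. *)
Lemma PQ_i f h : Q f h = P (fun w => - 'i%C * f w) h.
Proof.
by apply/funext => z; rewrite /P /Q; case: (f z) (h z) => a b [c d] /=; ring.
Qed.

Lemma A2_scale (a : C) f : A2O f -> A2O (fun w => a * f w).
Proof.
move=> Af; apply: (@eq_A2 (fun w => a * f w + 0)) => [z _|]; first by rewrite addr0.
exact: A2_comb Af A2_0.
Qed.

Lemma itg_P f h : A2O f -> A2O h -> itg (P f h).
Proof.
move=> Af Ah; have [hf _] := Af; have [hh _] := Ah.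
have c1 := sqr_cmod_ctsO hf; have c2 := sqr_cmod_ctsO hh.
apply: (@itg_dom _ (fun z => cmod (f z) ^+ 2 + cmod (h z) ^+ 2)).
- exact: ctsO_P.
- exact: ctsOD.
- move=> z _; apply: le_trans (ler_Re_cmod _) _; rewrite cmodM cmod_conj.
  have := sqr_ge0 (cmod (f z) - cmod (h z)); have := cmod_ge0 (f z); have := cmod_ge0 (h z).
  by move: (cmod (f z)) (cmod (h z)) => a b; nra.
rewrite iOD//; try by move=> z _; exact: sqr_ge0.
by rewrite -!sqnormE (A2_nsq Af) (A2_nsq Ah) -EFinD ltry.
Qed.

Lemma itg_Q f h : A2O f -> A2O h -> itg (Q f h).
Proof. by move=> Af Ah; rewrite PQ_i; exact: itg_P (A2_scale _ Af) Ah. Qed.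

Lemma inner_comb (a : C) f h k : A2O f -> A2O h -> A2O k ->
  inner Omega (fun w => a * f w + h w) k = a * inner Omega f k + inner Omega h k.
Proof.
move=> Af Ah Ak; rewrite !innerE.
have i1 := itg_P Af Ak; have i2 := itg_Q Af Ak; have i3 := itg_P Ah Ak; have i4 := itg_Q Ah Ak.
have -> : rint (P (fun w => a * f w + h w) k) =
    (complex.Re a * rint (P f k) + - complex.Im a * rint (Q f k)) + rint (P h k).
  rewrite -!rintZ// -!rintD//; try (by do ?[apply: itgD|apply: itgZ]).
  apply: eq_rint => z _; rewrite /P /Q; case: (a) (f z) (h z) (k z) => a1 a2 [f1 f2] [h1 h2] [k1 k2] /=.
  ring.
have -> : rint (Q (fun w => a * f w + h w) k) =
    (complex.Re a * rint (Q f k) + complex.Im a * rint (P f k)) + rint (Q h k).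
  rewrite -!rintZ// -!rintD//; try (by do ?[apply: itgD|apply: itgZ]).
  apply: eq_rint => z _; rewrite /P /Q; case: (a) (f z) (h z) (k z) => a1 a2 [f1 f2] [h1 h2] [k1 k2] /=.
  ring.
case: (a) => a1 a2; move: (rint _) (rint _) (rint _) (rint _) => r1 r2 r3 r4 /=.
by simpc; congr (_ +i* _)%C; ring.
Qed.

Lemma inner_conj f h : A2O f -> A2O h -> inner Omega h f = (inner Omega f h)^*%C.
Proof.
move=> Af Ah; rewrite !innerE /=.
have -> : rint (P h f) = rint (P f h).
  by apply: eq_rint => z _; rewrite /P; case: (f z) (h z) => a b [c d] /=; ring.
have -> // : rint (Q h f) = - rint (Q f h).
rewrite -mulN1r -rintZ; last exact: itg_Q.
by apply: eq_rint => z _; rewrite /Q; case: (f z) (h z) => a b [c d] /=; ring.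
Qed.

Lemma inner_self f : inner Omega f f = ((nsq f)%:C)%C.
Proof.
rewrite innerE; have -> : rint (P f f) = nsq f.
  rewrite /nsq sqnormE; congr fine; apply: eq_integral => x _; congr (_%:E).
  by rewrite cmod_sqr /P; case: (f (pt x)) => a b /=; ring.
have -> // : rint (Q f f) = 0.
rewrite -(mul0r (rint (fun=> 0))) -rintZ; last exact: integrable0.
by apply: eq_rint => z _; rewrite mulr0 /Q; case: (f z) => a b /=; ring.
Qed.

Lemma eq_inner f f' h h' : (forall z, Omega z -> f z = f' z) ->
  (forall z, Omega z -> h z = h' z) -> inner Omega f h = inner Omega f' h'.
Proof.
move=> ff hh; rewrite !innerE; congr (_ +i* _)%C; apply: eq_rint => z Oz;
  by rewrite /P /Q ff// hh.
Qed.

Lemma A2_sub f h : A2O f -> A2O h -> A2O (fun w => f w - h w).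
Proof.
move=> Af Ah; apply: (@eq_A2 (fun w => -1 * h w + f w)); last exact: A2_comb.
by move=> z _; rewrite mulN1r addrC.
Qed.

Lemma inner_sub f h k : A2O f -> A2O h -> A2O k ->
  inner Omega (fun w => f w - h w) k = inner Omega f k - inner Omega h k.
Proof.
move=> Af Ah Ak; rewrite (@eq_inner _ (fun w => -1 * h w + f w) k k)//.
  by rewrite inner_comb// mulN1r addrC.
by move=> z _; rewrite mulN1r addrC.
Qed.

Lemma inner_scale (a : C) f k : A2O f -> A2O k ->
  inner Omega (fun w => a * f w) k = a * inner Omega f k.
Proof.
move=> Af Ak; have A0 := A2_0.
have i0 : inner Omega (fun=> 0) k = 0.
  have := inner_comb 1 A0 A0 Ak; rewrite (@eq_inner _ (fun=> 0) k k)//.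
    by rewrite mul1r => /(congr1 (fun x => x - inner Omega (fun=> 0) k)); rewrite subrr addrK.
  by move=> z _; rewrite mul1r addr0.
rewrite -[RHS]addr0 -i0 -inner_comb//; apply: eq_inner => // z _.
by rewrite addr0.
Qed.

Lemma inner_subr f h k : A2O f -> A2O h -> A2O k ->
  inner Omega k (fun w => f w - h w) = inner Omega k f - inner Omega k h.
Proof.
move=> Af Ah Ak; rewrite (inner_conj (A2_sub Af Ah) Ak) (inner_sub Af Ah Ak).
by rewrite (inner_conj Af Ak) (inner_conj Ah Ak) -[RHS](rmorphB (@conjc R)).
Qed.

Lemma inner_scaler (a : C) f k : A2O f -> A2O k ->
  inner Omega k (fun w => a * f w) = a^*%C * inner Omega k f.
Proof.
move=> Af Ak; rewrite (inner_conj (A2_scale a Af) Ak) (inner_scale a Af Ak) conjcM.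
by rewrite -(inner_conj Af Ak).
Qed.

Lemma nsq_sub_scale (a : C) f h : A2O f -> A2O h ->
  nsq (fun w => f w - a * h w) =
  nsq f - 2 * complex.Re (a^*%C * inner Omega f h) + cmod a ^+ 2 * nsq h.
Proof.
move=> Af Ah; have Aah := A2_scale a Ah; have As := A2_sub Af Aah.
have E : ((nsq (fun w => f w - a * h w))%:C)%C =
  ((nsq f)%:C)%C - a^*%C * inner Omega f h - a * (inner Omega f h)^*%C
    + a * a^*%C * ((nsq h)%:C)%C.
  rewrite -!inner_self (inner_sub Af Aah As) (inner_scale a Ah As).
  rewrite (inner_subr Af Aah Af) (inner_subr Af Aah Ah).
  rewrite (inner_scaler a Ah Af) (inner_scaler a Ah Ah) (inner_conj Af Ah).
  by move: (inner _ _ _) (inner _ _ _) (inner _ _ _) => x y z; ring.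
have := congr1 (@complex.Re R) E; rewrite cmod_sqr.
by case: (a) (inner Omega f h) => a1 a2 [i1 i2]; simpc => /= ->; ring.
Qed.

(** [f - s <f, h> h] has nonnegative norm for all real [s]; the best choice is
    [s = 1 / nsq h], and when [nsq h = 0] any large [s] gives a contradiction. *)
Lemma cauchy_schwarz f h : A2O f -> A2O h ->
  cmod (inner Omega f h) ^+ 2 <= nsq f * nsq h.
Proof.
move=> Af Ah; have H0 := nsq_ge0 h; have F0 := nsq_ge0 f.
set p := cmod (inner Omega f h) ^+ 2; have p0 : 0 <= p by exact: sqr_ge0.
have key (s : R) : 0 <= nsq f - 2 * s * p + s ^+ 2 * p * nsq h.
  have := nsq_ge0 (fun w => f w - ((s%:C)%C * inner Omega f h) * h w).
  rewrite nsq_sub_scale// cmodM cmod_real exprMn real_normK ?num_real// -/p.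
  suff -> : complex.Re (((s%:C)%C * inner Omega f h)^*%C * inner Omega f h) = s * p.
    by rewrite mulrA.
  by rewrite /p cmod_sqr; case: (inner Omega f h) => a b; simpc; rewrite /=; ring.
have [h0|h0] := eqVneq (nsq h) 0.
  rewrite h0 mulr0 leNgt; apply/negP => pp.
  have := key ((nsq f + 1) / (2 * p)); rewrite h0 mulr0 addr0.
  have -> : 2 * ((nsq f + 1) / (2 * p)) * p = nsq f + 1 by field; rewrite gt_eqF.
  lra.
have hp : 0 < nsq h by rewrite lt_neqAle eq_sym h0.
have := key (nsq h)^-1.
have -> : nsq f - 2 * (nsq h)^-1 * p + (nsq h)^-1 ^+ 2 * p * nsq h = nsq f - p / nsq h by field.
by rewrite subr_ge0 ler_pdivrMr.
Qed.

Definition comb (c : nat -> C) (e : nat -> Cn -> C) (m : nat) : Cn -> C :=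
  fun z => \sum_(k < m) c k * e k z.

Lemma combS c e m z : comb c e m.+1 z = c m * e m z + comb c e m z.
Proof. by rewrite /comb big_ord_recr /= addrC. Qed.

Lemma combSE c e m : comb c e m.+1 = fun z => c m * e m z + comb c e m z.
Proof. by apply/funext => z; exact: combS. Qed.

Lemma comb0 c e : comb c e 0 = fun=> 0.
Proof. by apply/funext => z; rewrite /comb big_ord0. Qed.

Lemma A2_comb_seq c e m : (forall k, A2O (e k)) -> A2O (comb c e m).
Proof.
by move=> Ae; elim: m => [|m IH]; [rewrite comb0; exact: A2_0|rewrite combSE; exact: A2_comb].
Qed.

Lemma inner0 k : A2O k -> inner Omega (fun=> 0) k = 0.
Proof.
move=> Ak; apply: etrans (_ : 0 * inner Omega (fun=> 0) k = 0); last exact: mul0r.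
by rewrite -(inner_scale 0 A2_0 Ak); apply: eq_inner => // z _; rewrite mul0r.
Qed.

Lemma inner_comb_seq c e m k : (forall k, A2O (e k)) -> A2O k ->
  inner Omega (comb c e m) k = \sum_(j < m) c j * inner Omega (e j) k.
Proof.
move=> Ae Ak; elim: m => [|m IH]; first by rewrite comb0 big_ord0 inner0.
by rewrite combSE inner_comb ?IH ?big_ord_recr 1?addrC//; exact: A2_comb_seq.
Qed.

Lemma radial_comb c e m z : (forall k, A2O (e k)) -> Omega z ->
  radial (comb c e m) z = \sum_(j < m) c j * radial (e j) z.
Proof.
move=> Ae Oz; elim: m => [|m IH]; first by rewrite comb0 big_ord0 radial_cst.
rewrite combSE grad_comb ?IH ?big_ord_recr 1?addrC//; first by case: (Ae m).
by case: (A2_comb_seq c m Ae).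
Qed.

Definition orthonormal (e : nat -> Cn -> C) :=
  (forall k, A2O (e k)) /\ forall j k, inner Omega (e j) (e k) = (j == k)%:R.

Lemma inner_comb_orth c e m j : orthonormal e ->
  inner Omega (comb c e m) (e j) = if (j < m)%N then c j else 0.
Proof.
move=> [Ae oe]; rewrite inner_comb_seq//; case: ltnP => jm.
  rewrite (bigD1 (Ordinal jm))//= oe eqxx mulr1 big1 ?addr0// => i ij.
  by rewrite oe (negbTE (_ : (i : nat) != j)) ?mulr0.
apply: big1 => i _; rewrite oe (negbTE (_ : (i : nat) != j)) ?mulr0//.
by rewrite neq_ltn (leq_trans (ltn_ord i) jm).
Qed.

Lemma nsq_comb c e m : orthonormal e -> nsq (comb c e m) = \sum_(k < m) cmod (c k) ^+ 2.
Proof.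
move=> oe; have [Ae _] := oe.
have : ((nsq (comb c e m))%:C)%C = ((\sum_(k < m) cmod (c k) ^+ 2)%:C)%C.
  rewrite -inner_self inner_comb_seq//; last exact: A2_comb_seq.
  rewrite rmorph_sum; apply: eq_bigr => k _.
  rewrite (@inner_conj (comb c e m)); [|exact: A2_comb_seq|by []].
  rewrite inner_comb_orth// ltn_ord cmod_sqr; case: (c k) => a b; simpc.
  by congr (_ +i* _)%C; ring.
by move=> /(congr1 (@complex.Re R)).
Qed.

(** The partial Fourier sum is the orthogonal projection. *)
Lemma nsq_rest e f m : orthonormal e -> A2O f ->
  nsq (fun z => f z - comb (fun k => inner Omega f (e k)) e m z) =
  nsq f - \sum_(k < m) cmod (inner Omega f (e k)) ^+ 2.
Proof.
move=> oe Af; have [Ae _] := oe; set g := comb _ e m.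
have Ag : A2O g by exact: A2_comb_seq.
have E : nsq (fun z => f z - g z) = nsq (fun z => f z - 1 * g z).
  by rewrite /nsq (@eq_sqnorm _ (fun z => f z - 1 * g z))// => z _; rewrite mul1r.
rewrite E nsq_sub_scale// (_ : cmod 1 = 1); last exact: cmod1.
have fg : inner Omega f g = ((\sum_(k < m) cmod (inner Omega f (e k)) ^+ 2)%:C)%C.
  rewrite (inner_conj Ag Af) inner_comb_seq// !rmorph_sum; apply: eq_bigr => k _.
  rewrite (inner_conj Af (Ae k)) cmod_sqr; case: (inner _ _ _) => a b /=; simpc.
  by congr (_ +i* _)%C; ring.
by rewrite nsq_comb// fg rmorph1 mul1r expr1n mul1r /=; ring.
Qed.

Lemma bessel e f m : orthonormal e -> A2O f ->
  \sum_(k < m) cmod (inner Omega f (e k)) ^+ 2 <= nsq f.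
Proof. by move=> oe Af; rewrite -subr_ge0 -nsq_rest// nsq_ge0. Qed.

(** * Completeness of the Bergman space *)

Local Notation sqd f h := (sqnorm Omega (fun z => (f z - h z)%R)).

Definition nconv (f_ : nat -> Cn -> C) f := forall eps : R, 0 < eps ->
  exists N, forall m, (N <= m)%N -> (sqd (f_ m) f <= eps%:E)%E.

Lemma point_eval (e : R) : 0 < e -> exists2 K : R, 0 < K & forall f z,
  holomorphic_on Omega f -> Omega z -> e <= dist z ->
  ((cmod (f z) ^+ 2)%:E <= K%:E * sqnorm Omega f)%E.
Proof.
move=> e0; pose r := e / 4; have r0 : 0 < r by rewrite divr_gt0.
exists ((4 / r ^+ 2) ^+ n.+1) => [|f z hf Oz ez].
  by rewrite exprn_gt0// divr_gt0// exprn_gt0.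
by apply: point_bound => //; rewrite /r; lra.
Qed.

(** [interior_sup] for [radial f], followed by [lp_lower]. *)
Lemma radial_eval (e : R) : 0 < e -> exists2 K : R, 0 < K & forall f z,
  holomorphic_on Omega f -> Omega z -> e <= dist z ->
  ((cmod (radial f z) ^+ 2)%:E <= K%:E * sqnorm Omega f)%E.
Proof.
move=> e0; have [K K0 HK] := interior_sup e0; have [c c0 Hc] := lp_lower.
exists (K * c) => [|f z hf Oz ez]; first by rewrite mulr_gt0.
apply: le_trans (HK _ _ (hol_radial hf) Oz ez) _; rewrite EFinM -muleA.
by apply: lee_wpmul2l; [rewrite lee_fin ltW|exact: Hc].
Qed.

Lemma sqr_small (x K s e : R) : 0 <= x -> 0 < K -> 0 < e -> x ^+ 2 <= K * s ->
  s <= e ^+ 2 / K -> x <= e.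
Proof.
move=> x0 K0 e0 h1; rewrite ler_pdivlMr// => h2.
by rewrite -(@ler_pXn2r _ 2) ?nnegrE ?(ltW e0)//; apply: le_trans h1 _; rewrite mulrC.
Qed.

(** For [L] a point value, a radial derivative or an inner product. *)
Lemma nconv_bounded (L : (Cn -> C) -> C) (K : R) (f_ : nat -> Cn -> C) f : 0 < K ->
  (forall m, ((cmod (L (f_ m) - L f) ^+ 2)%:E
     <= K%:E * sqd (f_ m) f)%E) ->
  nconv f_ f -> cconv (fun m => L (f_ m)) (L f).
Proof.
move=> K0 HL Hf e e0; have k0 : 0 < e ^+ 2 / K by rewrite divr_gt0// exprn_gt0.
have [N HN] := Hf _ k0; exists N => m /HN h.
apply: (@sqr_small _ K (e ^+ 2 / K) e) => //; first exact: cmod_ge0.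
rewrite -lee_fin; apply: le_trans (HL m) _; rewrite EFinM.
by apply: lee_wpmul2l h; rewrite lee_fin ltW.
Qed.

Lemma hol_sub f h : holomorphic_on Omega f -> holomorphic_on Omega h ->
  holomorphic_on Omega (fun z => f z - h z).
Proof.
move=> hf hh; apply: (@eq_hol (fun w => -1 * h w + f w)); last exact: holZD.
by move=> z _; rewrite mulN1r addrC.
Qed.

Lemma radial_sub f h z : holomorphic_on Omega f -> holomorphic_on Omega h -> Omega z ->
  radial (fun w => f w - h w) z = radial f z - radial h z.
Proof.
move=> hf hh Oz; have E w : Omega w -> f w - h w = -1 * h w + f w.
  by move=> _; rewrite mulN1r addrC.
by rewrite (eq_radial E (hol_sub hf hh) Oz) (grad_comb _ hh hf Oz) mulN1r addrC.
Qed.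

Lemma nconv_point (f_ : nat -> Cn -> C) f z : (forall m, A2O (f_ m)) -> A2O f -> Omega z -> nconv f_ f ->
  cconv (fun m => f_ m z) (f z).
Proof.
move=> Af_ [hf _] Oz; have [K K0 HK] := point_eval (dist_gt0 Oz).
apply: (nconv_bounded (L := fun f => f z) K0) => m.
by have [hm _] := Af_ m; exact: (HK _ _ (hol_sub hm hf) Oz (lexx _)).
Qed.

Lemma nconv_radial (f_ : nat -> Cn -> C) f z : (forall m, A2O (f_ m)) -> A2O f -> Omega z -> nconv f_ f ->
  cconv (fun m => radial (f_ m) z) (radial f z).
Proof.
move=> Af_ [hf _] Oz; have [K K0 HK] := radial_eval (dist_gt0 Oz).
apply: (nconv_bounded (L := fun f => radial f z) K0) => m; have [hm _] := Af_ m.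
rewrite -(radial_sub hm hf Oz); exact: (HK _ _ (hol_sub hm hf) Oz (lexx _)).
Qed.

Lemma nconv_inner (f_ : nat -> Cn -> C) f h : (forall m, A2O (f_ m)) -> A2O f -> A2O h -> nconv f_ f ->
  cconv (fun m => inner Omega (f_ m) h) (inner Omega f h).
Proof.
move=> Af_ Af Ah; have K0 : 0 < nsq h + 1 by rewrite ltr_wpDl// nsq_ge0.
apply: (nconv_bounded (L := fun f => inner Omega f h) K0) => m.
have Ad := A2_sub (Af_ m) Af.
rewrite -inner_sub// (A2_nsq Ad) -EFinM lee_fin; apply: le_trans (cauchy_schwarz Ad Ah) _.
by rewrite mulrC ler_wpM2r ?nsq_ge0// lerDl.
Qed.

Lemma sqnorm_subC f h : sqd f h = sqd h f.
Proof. by rewrite !sqnormE; apply: eq_iO => z _; rewrite cmod_distC. Qed.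

(** The Bergman space is complete: a norm-Cauchy sequence converges locally
    uniformly, hence to a holomorphic function, and Fatou's lemma does the rest. *)
Lemma A2_complete (f_ : nat -> Cn -> C) : (forall m, A2O (f_ m)) ->
  (forall eps : R, 0 < eps -> exists N, forall i j, (N <= i)%N -> (N <= j)%N ->
     (sqd (f_ i) (f_ j) <= eps%:E)%E) ->
  exists2 f, A2O f & nconv f_ f.
Proof.
move=> Af HC; have hf_ m : holomorphic_on Omega (f_ m) by case: (Af m).
have unif (e : R) : 0 < e -> forall eps : R, 0 < eps -> exists N, forall i j,
    (N <= i)%N -> (N <= j)%N -> forall z, Omega z -> e <= dist z ->
    cmod (f_ i z - f_ j z) <= eps.
  move=> e0 eps eps0; have [K K0 HK] := point_eval e0.
  have k0 : 0 < eps ^+ 2 / K by rewrite divr_gt0// exprn_gt0.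
  have [N HN] := HC _ k0; exists N => i j Ni Nj z Oz ez.
  apply: (@sqr_small _ K (eps ^+ 2 / K) eps) => //; first exact: cmod_ge0.
  rewrite -lee_fin; apply: le_trans (HK _ _ (hol_sub (hf_ i) (hf_ j)) Oz ez) _.
  by rewrite EFinM; apply: lee_wpmul2l; [rewrite lee_fin ltW|exact: HN].
have /choice[f Hf] : forall z, exists l, Omega z -> cconv (fun m => f_ m z) l.
  move=> z; have [Oz|nO] := pselect (Omega z); last by exists 0.
  have [|l Hl] := @cconv_complete R (fun m => f_ m z); last by exists l.
  move=> eps e0; have [N HN] := unif _ (dist_gt0 Oz) _ e0.
  by exists N => i j Ni Nj; exact: HN.
have hf : holomorphic_on Omega f.
  apply: grad_hol => z Oz; have d0 := dist_gt0 Oz.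
  have r0 : 0 < dist z / 2 by rewrite divr_gt0.
  have near w : nrm (w - z) <= dist z / 2 -> Omega w /\ dist z / 2 <= dist w.
    move=> wz; split; first by apply: (@dist_in z); lra.
    by have := dist_lip z w; rewrite nrm_distC; lra.
  have [] := @weierstrass _ _ f_ f z (dist z / 2) r0.
  - by move=> m; apply: hol_ball_dist => //; lra.
  - move=> eps e0; have [N HN] := unif _ r0 _ e0; exists N => m Nm w /near[Ow dw].
    rewrite cmod_distC; apply: (cconv_le (Hf w Ow)); exists N => k Nk; exact: HN.
  by move=> d Hd _; exists d.
have lim (i : nat) (eps : R) : 0 < eps -> (exists N, forall j, (N <= j)%N ->
    (sqd (f_ i) (f_ j) <= eps%:E)%E) ->
    (sqd (f_ i) f <= eps%:E)%E.
  move=> e0 [N HN]; rewrite sqnormE.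
  apply: (@iO_fatou (fun k z => cmod (f_ i z - f_ (N + k)%N z) ^+ 2)).
  - by move=> k; apply: sqr_cmod_ctsO; exact: hol_sub.
  - by move=> k z _; exact: sqr_ge0.
  - move=> z Oz; apply: cconv_sqr => e' e'0; have [M HM] := Hf z Oz e' e'0.
    exists M => m Mm; rewrite opprB addrC addrA subrK cmod_distC.
    by apply: HM; apply: (leq_trans Mm); exact: leq_addl.
  - by move=> k; apply: HN; exact: leq_addr.
have cv : nconv f_ f.
  move=> eps e0; have [N HN] := HC _ e0; exists N => m Nm; apply: lim => //.
  by exists N => j Nj; exact: HN.
exists f => //; split=> //; have [N HN] := cv _ (@ltr01 R).
have hN := hol_sub (hf_ N) hf.
rewrite (@eq_sqnorm f (fun z => -1 * (f_ N z - f z) + f_ N z)); last by move=> z _; ring.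
apply: le_lt_trans (sqnorm_comb (-1) hN (hf_ N)) _.
have s1 : (sqd (f_ N) f <= 1)%E by exact: HN.
rewrite (A2_nsq (Af N)); apply: (@le_lt_trans _ _ ((2 * cmod (-1 : C) ^+ 2)%:E * 1 + 2%:E * (nsq (f_ N))%:E)%E).
  by apply: leeD => //; apply: lee_wpmul2l s1; rewrite lee_fin mulr_ge0// sqr_ge0.
by rewrite mule1 -EFinM -EFinD ltry.
Qed.

(** * The Bergman kernel and the radial derivative *)

Lemma comb_add c e i p z :
  comb c e (i + p) z = comb c e i z + comb (fun k => c (i + k)%N) (fun k => e (i + k)%N) p z.
Proof. by rewrite /comb big_split_ord. Qed.

Lemma orthonormal_shift e i : orthonormal e -> orthonormal (fun k => e (i + k)%N).
Proof. by move=> [Ae oe]; split=> // j k; rewrite oe eqn_add2l. Qed.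

(** Riesz-Fischer: by orthonormality the partial sums form a Cauchy sequence, and
    the space is complete. *)
Lemma comb_cvg (c : nat -> C) e (B : R) : orthonormal e ->
  (forall m, \sum_(k < m) cmod (c k) ^+ 2 <= B) ->
  exists r, [/\ A2O r, nconv (comb c e) r, forall k, inner Omega r (e k) = c k &
    (fun m => \sum_(k < m) cmod (c k) ^+ 2) @ \oo --> nsq r].
Proof.
move=> oe cB; have [Ae _] := oe; pose s m : R := \sum_(k < m) cmod (c k) ^+ 2.
have Ac m : A2O (comb c e m) by exact: A2_comb_seq.
have sS i p : s (i + p)%N = s i + \sum_(k < p) cmod (c (i + k)%N) ^+ 2.
  by rewrite /s big_split_ord.
have sd i j : (i <= j)%N -> sqd (comb c e j) (comb c e i) = (s j - s i)%:E.
  move=> ij; have Ad := A2_sub (Ac j) (Ac i); rewrite (A2_nsq Ad); congr (_%:E).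
  rewrite -(subnKC ij) sS addrC addKr -(nsq_comb (fun k => c (i + k)%N) _ (orthonormal_shift i oe)).
  rewrite /nsq; congr fine; apply: eq_sqnorm => z _.
  by rewrite comb_add addrC addKr.
have ns : nondecreasing_seq s.
  by move=> i j ij; rewrite -(subnKC ij) sS lerDl sumr_ge0// => k _; exact: sqr_ge0.
have cs : cvgn s.
  by apply: nondecreasing_is_cvgn => //; exists B => _ [m _ <-]; exact: cB.
have [l sl] : exists l : R, s @ \oo --> l by exists (limn s : R).
have sle m : s m <= l by rewrite -(cvg_lim _ sl)//; exact: nondecreasing_cvgn_le.
have near (eps : R) : 0 < eps -> exists N, forall m, (N <= m)%N -> l - s m <= eps.
  move=> e0; move/cvgrPdist_le: sl => /(_ _ e0)[N _ HN]; exists N => m /= /HN.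
  by rewrite ger0_norm// subr_ge0.
have [eps e0|r Ar cr] := A2_complete Ac.
  have [N HN] := near _ e0; exists N.
  have main i j : (N <= i)%N -> (i <= j)%N -> (sqd (comb c e j) (comb c e i) <= eps%:E)%E.
    move=> Ni ij; rewrite sd// lee_fin; have := HN i Ni; have := sle j; lra.
  move=> i j Ni Nj; have [ij|/ltnW ij] := leqP i j; last exact: main.
  by rewrite sqnorm_subC; exact: main.
have rk k : inner Omega r (e k) = c k.
  apply: cconv_unique (nconv_inner Ac Ar (Ae k) cr) _ => eps e0.
  by exists k.+1 => m km; rewrite inner_comb_orth// km subrr cmod0 ltW.
exists r; split=> //; apply/cvgrPdist_le => eps e0; have [N HN] := cr _ e0.
exists N => // m /= Nm; have := HN m Nm; rewrite sqnorm_subC.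
have Ad := A2_sub Ar (Ac m); rewrite (A2_nsq Ad) lee_fin.
have := nsq_rest m oe Ar; have -> : (fun k => inner Omega r (e k)) = c by exact/funext.
have -> : \sum_(k < m) cmod (inner Omega r (e k)) ^+ 2 = s m.
  by apply: eq_bigr => k _; rewrite rk.
move=> ->; rewrite -/(s m) => h; rewrite ger0_norm// subr_ge0.
have := bessel m oe Ar; have -> // : \sum_(k < m) cmod (inner Omega r (e k)) ^+ 2 = s m.
by apply: eq_bigr => k _; rewrite rk.
Qed.

Lemma cvge0_eps (u : nat -> \bar R) : (forall m, (0 <= u m)%E) ->
  (u @ \oo --> 0%E <-> forall eps : R, 0 < eps -> exists N, forall m, (N <= m)%N ->
     (u m <= eps%:E)%E).
Proof.
move=> u0; split=> [/fine_cvgP[[N1 _ H1] /cvgrPdist_le H2] eps /H2[N2 _ {}H2]|H].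
  exists (maxn N1 N2) => m; rewrite geq_max => /andP[m1 m2].
  have := H2 m m2; rewrite /= sub0r normrN ger0_norm ?fine_ge0// => h.
  by rewrite -(fineK (H1 m m1)) lee_fin.
apply/fine_cvgP; split.
  have [N HN] := H _ (@ltr01 R); exists N => // m /= /HN h.
  by rewrite ge0_fin_numE//; exact: le_lt_trans h (ltry _).
apply/cvgrPdist_le => eps e0; have [N HN] := H _ e0; exists N => // m /= /HN h.
rewrite sub0r normrN ger0_norm ?fine_ge0// -lee_fin fineK// ge0_fin_numE//.
exact: le_lt_trans h (ltry _).
Qed.

Lemma basis_orthonormal e : orthonormal_basis Omega e -> orthonormal e.
Proof. by case. Qed.

Lemma basis_nconv e f : orthonormal_basis Omega e -> A2O f ->
  nconv (comb (fun k => inner Omega f (e k)) e) f.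
Proof.
move=> [_ _ Hb] Af; have := Hb f Af; rewrite cvge0_eps; last by move=> m; exact: sqnorm_ge0.
move=> H eps /H[N HN]; exists N => m /HN; rewrite sqnorm_subC; exact.
Qed.

(** Riesz representation of the bounded functional [f |-> R f (w)]; its squared
    norm is the sum of [|R e_k (w)|^2] over any orthonormal basis. *)
Lemma riesz_radial e w : orthonormal_basis Omega e -> Omega w ->
  exists r, [/\ A2O r, forall f, A2O f -> radial f w = inner Omega f r &
    (fun m => \sum_(k < m) cmod (radial (e k) w) ^+ 2) @ \oo --> nsq r].
Proof.
move=> be Ow; have oe := basis_orthonormal be; have [Ae _] := oe.
have [K K0 HK] := radial_eval (dist_gt0 Ow).
pose c k := (radial (e k) w)^*%C; pose s m : R := \sum_(k < m) cmod (radial (e k) w) ^+ 2.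
have cs m : \sum_(k < m) cmod (c k) ^+ 2 = s m.
  by apply: eq_bigr => k _; rewrite cmod_conj.
(* The bound on the functional, applied to the combination of coefficients [c],
   reads [s m ^ 2 <= K * s m]. *)
have sK m : \sum_(k < m) cmod (c k) ^+ 2 <= K.
  have Ac := A2_comb_seq c m Ae; have [hc _] := Ac.
  have := HK _ _ hc Ow (lexx _); rewrite (A2_nsq Ac) nsq_comb// radial_comb//.
  rewrite cs -EFinM lee_fin (_ : \sum_(j < m) _ = ((s m)%:C)%C); last first.
    rewrite rmorph_sum; apply: eq_bigr => k _; rewrite /c cmod_sqr.
    by case: (radial _ _) => a b; simpc; congr (_ +i* _)%C; ring.
  have s0 : 0 <= s m by apply: sumr_ge0 => k _; exact: sqr_ge0.
  rewrite cmod_real ger0_norm// => h.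
  have [->|sn] := eqVneq (s m) 0; first exact: ltW.
  have sp : 0 < s m by rewrite lt_neqAle eq_sym sn.
  by rewrite -(ler_pM2r sp) -expr2.
have [r [Ar cr rk sr]] := comb_cvg oe sK.
exists r; split=> //; last first.
  by rewrite (_ : (fun m => _) = (fun m => \sum_(k < m) cmod (c k) ^+ 2))//; apply/funext => m.
move=> f Af; pose b k := inner Omega f (e k).
have cf := basis_nconv be Af; have Ab m : A2O (comb b e m) := A2_comb_seq b m Ae.
apply: cconv_unique (nconv_radial Ab Af Ow cf) _.
have := nconv_inner Ab Af Ar cf.
rewrite (_ : (fun m => inner Omega _ r) = (fun m => radial (comb b e m) w))//.
apply/funext => m; rewrite inner_comb_seq// radial_comb//; apply: eq_bigr => k _.
by rewrite (inner_conj Ar (Ae k)) rk /c conjcK.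
Qed.

Lemma real_derive_eps (f : Cn -> R) v w (k : R) :
  (forall e : R, 0 < e -> exists2 d : R, 0 < d & forall t : R, `|t| < d ->
     `|f (w + (t%:C)%C *: v) - f w - k * t| <= e * `|t|) -> real_derive f v w = k.
Proof.
move=> H; rewrite /real_derive derive1E; apply: derive_val; apply: is_derive_eps => e e0.
have [d d0 Hd] := H e e0; exists d => // t.
rewrite add0r => /Hd; rewrite /real_line scale0r addr0; exact.
Qed.

(** Conjugation exchanges the derivatives in [w_k] and in its conjugate. *)
Lemma radial_bar_conj f (F : Cn -> C) w : holomorphic_on Omega f ->
  (forall z, Omega z -> F z = (f z)^*%C) -> Omega w ->
  radial_bar F w = (radial f w)^*%C.
Proof.
move=> hf Ff Ow; have d0 := dist_gt0 Ow.
pose l v := lin (grad f w) v.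
have D v : (real_derive (fun z => complex.Re (F z)) v w
    +i* real_derive (fun z => complex.Im (F z)) v w)%C = (l v)^*%C.
  have key (e : R) : 0 < e -> exists2 d : R, 0 < d & forall t : R, `|t| < d ->
      F (w + (t%:C)%C *: v) = (f (w + (t%:C)%C *: v))^*%C /\
      cmod (f (w + (t%:C)%C *: v) - f w - (t%:C)%C * l v) <= e * `|t|.
    move=> e0; have k0 : 0 < 1 + nrm v by rewrite ltr_pwDl// nrm_ge0.
    have [d dp Hd] := hol_grad hf Ow (divr_gt0 e0 k0).
    exists (Num.min (d / (1 + nrm v)) (dist w / (1 + nrm v))).
      by rewrite lt_min !divr_gt0.
    move=> t; rewrite lt_min !ltr_pdivlMr// => /andP[t1 t2].
    have nt : nrm ((t%:C)%C *: v) <= `|t| * (1 + nrm v).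
      by rewrite nrmZ cmod_real ler_wpM2l// lerDr.
    split; first by apply: Ff; apply: (@dist_in w); rewrite addrAC subrr add0r; exact: le_lt_trans t2.
    have := Hd _ (le_lt_trans nt t1); rewrite linZ => /le_trans; apply.
    by rewrite mulrAC ler_pdivrMr// -mulrA ler_wpM2l// ltW.
  rewrite (_ : (l v)^*%C = (complex.Re (l v) +i* - complex.Im (l v))%C); last by case: (l v).
  congr (_ +i* _)%C; apply: real_derive_eps => e /key[d dp Hd]; exists d => // t /Hd[FE].
    rewrite FE (Ff w Ow); apply: le_trans; apply: le_trans (ler_Re_cmod _).
    by case: (f (_ + _)) (f w) (l v) => a1 a2 [b1 b2] [l1 l2]; simpc; rewrite /= mulrC.
  rewrite FE (Ff w Ow); apply: le_trans; apply: le_trans (ler_Im_cmod _).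
  rewrite -normrN; case: (f (_ + _)) (f w) (l v) => a1 a2 [b1 b2] [l1 l2]; simpc.
  by rewrite /= le_eqVlt; apply/orP; left; apply/eqP; congr (`|_|); ring.
have Dk k : dbar k F w = (grad f w k)^*%C.
  have -> : dbar k F w =
      ((l (delta_mx ord0 k))^*%C + 'i%C * (l ('i%C *: delta_mx ord0 k))^*%C) / 2%:R.
    by rewrite -!D.
  rewrite /l linZ lin_delta conjcM; move: (grad f w k)^*%C => x.
  have -> : 'i%C * ('i%C^*%C * x) = x :> C.
    by rewrite mulrA; have -> : 'i%C * 'i%C^*%C = 1 :> C; [simpc|rewrite mul1r].
  have two : (2%:R : C) != 0 by rewrite pnatr_eq0.
  by rewrite -mulr2n -[x *+ 2]mulr_natr mulfK.
rewrite /radial_bar radialE /lin rmorph_sum; apply: eq_bigr => k _.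
by rewrite Dk -[RHS]/((w ord0 k * grad f w k)^*%C) conjcM.
Qed.

Lemma kernel_sym K z w : bergman_kernel Omega K -> Omega z -> Omega w ->
  K z w = (K w z)^*%C.
Proof.
move=> HK Oz Ow; have [Aw Ew] := HK _ Ow; have [Az Ez] := HK _ Oz.
by rewrite (Ez _ Aw) (Ew _ Az) -inner_conj.
Qed.

(** The kernel [K] represents point evaluations, so [conj (R K (., z)) (w)] is the
    value at [z] of the representative of [f |-> R f (w)]. *)
Lemma kernel_radial K e w : bergman_kernel Omega K -> orthonormal_basis Omega e ->
  Omega w ->
  (fun m => \sum_(k < m) cmod (radial (e k) w) ^+ 2) @ \oo --> radial_radial_bar K w /\
  forall f, A2O f -> cmod (radial f w) ^+ 2 <= nsq f * radial_radial_bar K w.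
Proof.
move=> HK be Ow; have [r [Ar Hr sr]] := riesz_radial be Ow.
have E : radial_radial_bar K w = nsq r.
  rewrite /radial_radial_bar (@eq_radial _ r)//.
  - by rewrite Hr// inner_self.
  - move=> z Oz; have [Az Ez] := HK _ Oz; have [hz _] := Az.
    rewrite (radial_bar_conj hz)//; last by move=> w' Ow'; exact: kernel_sym.
    by rewrite Hr// -inner_conj// -Ez.
  - apply: (@eq_hol r); last by case: Ar.
    move=> z Oz; have [Az Ez] := HK _ Oz; have [hz _] := Az.
    rewrite (radial_bar_conj hz)//; last by move=> w' Ow'; exact: kernel_sym.
    by rewrite Hr// -inner_conj// -Ez.
by split; [rewrite E|move=> f Af; rewrite Hr// E; exact: cauchy_schwarz].
Qed.

(** * Existence of an orthonormal basis *)

(** Rational points, enumerated without repetition so that the kernel functions at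
    these points are linearly independent. *)
Lemma dense_sequence : exists w : nat -> Cn, [/\ forall j, Omega (w j), injective w &
  forall z (e : R), Omega z -> 0 < e -> exists j, nrm (w j - z) < e].
Proof.
pose p (q : {ffun 'I_n.+1 -> rat * rat}) : Cn :=
  \row_k (ratr (q k).1 +i* ratr (q k).2)%C.
pose A : set Cn := p @` setT `&` Omega.
have dens z (e : R) : Omega z -> 0 < e -> exists2 w, A w & nrm (w - z) < e.
  move=> Oz e0; pose d := Num.min e (dist z).
  have d0 : 0 < d by rewrite lt_min e0 dist_gt0.
  have approx (x : R) : exists q : rat, `|ratr q - x| < d / 2.
    have [|q] := @rat_in_itvoo R (x - d / 2) (x + d / 2); first by lra.
    rewrite in_itv /= => /andP[q1 q2]; exists q; rewrite ltr_norml; lra.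
  have /choice[q Hq] : forall k, exists q : rat * rat,
      cmod ((ratr q.1 +i* ratr q.2)%C - z ord0 k) < d.
    move=> k; have [q1 h1] := approx (complex.Re (z ord0 k)).
    have [q2 h2] := approx (complex.Im (z ord0 k)); exists (q1, q2).
    apply: le_lt_trans (cmod_ReIm _) _; case: (z ord0 k) h1 h2 => a b /= h1 h2; lra.
  have nd : nrm (p (finfun q) - z) < d.
    by apply: nrm_ltP => // k; rewrite !mxE ffunE.
  move: nd; rewrite lt_min => /andP[n1 n2]; exists (p (finfun q)) => //.
  by split; [exists (finfun q)|exact: (@dist_in z)].
have cA : countable A.
  apply: (@sub_countable _ _ _ (p @` setT)); first by apply: subset_card_le => w [].
  exact: sub_countable (card_image_le _ _) (countableP _).
have iA : ~ finite_set A.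
  have [|q0] := @rat_in_itvoo R 0 (dist 0); first exact: dist_gt0.
  rewrite in_itv /= => /andP[q1 q2].
  pose q m : rat := q0 / m.+1%:R.
  pose g m : Cn := p [ffun k => (q m, 0)].
  have q00 : q0 != 0 by apply: contraTN q1 => /eqP ->; rewrite raddf0 ltxx.
  have gi : injective g.
    move=> i j /rowP/(_ ord0); rewrite !mxE !ffunE /= => -[] /fmorph_inj.
    move=> /(mulfI q00)/invr_inj/eqP; rewrite eqr_nat eqSS => /eqP //.
  have gA : g @` setT `<=` A.
    move=> _ [m _ <-]; split; first by exists [ffun k => (q m, 0)].
    apply: (@dist_in 0); rewrite subr0; apply: le_lt_trans q2; apply: nrm_leP => [|k].
      exact: ltW.
    have -> : g m ord0 k = ((ratr (q m))%:C)%C by rewrite mxE ffunE /= raddf0.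
    rewrite cmod_real /q fmorph_div rmorph_nat normrM.
    rewrite gtr0_norm// ler_piMr ?(ltW q1)// ger0_norm ?invr_ge0// invf_le1 ?ler1n//.
  move=> /(sub_finite_set gA); rewrite (eq_finite_set (inj_card_eq _)).
    exact: infinite_nat.
  by move=> i j _ _; exact: gi.
have /card_esym/pcard_eqP/unsquash f := eq_card_nat cA iA.
exists f; split.
- by move=> j; have [] := 'funS_f (I : setT j).
- by move=> i j; apply: 'inj_f; rewrite inE.
- move=> z e Oz e0; have [w Aw wz] := dens z e Oz e0.
  by have [j _ fj] := 'surj_f Aw; exists j; rewrite fj.
Qed.

(** A product of differences [z_k - (w j)_k], with a coordinate [k] depending on
    [j] in which [w j] and [z0] differ. *)
Lemma coord_poly (w : nat -> Cn) m z0 : (forall j, (j < m)%N -> w j <> z0) ->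
  exists f, [/\ A2O f, forall j, (j < m)%N -> f (w j) = 0 & f z0 != 0].
Proof.
move=> wz; have [B B0 HB] := bounded_nrm.
suff [f [hf [M HM] f0 fz]] : exists f, [/\ holomorphic_on Omega f,
    exists M : R, forall z, Omega z -> cmod (f z) <= M,
    forall j, (j < m)%N -> f (w j) = 0 & f z0 != 0].
  exists f; split=> //; split=> //; rewrite sqnormE.
  have M0 : 0 <= M by apply: le_trans (HM _ Omega0); exact: cmod_ge0.
  have [|x _ ->] := @iO_fin _ (M ^+ 2) (sqr_cmod_ctsO hf); last exact: ltry.
  by move=> z /HM h; rewrite sqr_ge0 lerXn2r// nnegrE cmod_ge0.
elim: m wz => [|m IH] wz.
  exists (fun=> 1); split; [exact: hol_cst| |by []|exact: oner_neq0].
  by exists 1 => z _; rewrite cmod1.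
have [j jm|f [hf [M HM] f0 fz]] := IH; first by apply: wz; exact: ltnW.
have [k wk] : exists k, w m ord0 k != z0 ord0 k.
  apply/not_existsP => H; apply: (wz m (ltnSn m)); apply/rowP => k.
  by have /negP := H k; rewrite negbK => /eqP.
exists (fun z => f z * (z ord0 k - w m ord0 k)); split.
- move=> z Oz; apply: differentiableM; first exact: hf.
  by apply: differentiableB; [exact: differentiable_coord|exact: differentiable_cst].
- exists (M * (B + cmod (w m ord0 k))) => z Oz; rewrite cmodM.
  apply: ler_pM; rewrite ?cmod_ge0 ?HM//; apply: le_trans (cmodB _ _) _.
  by rewrite lerD2r; apply: le_trans (cmod_le_nrm _ _) (HB _ Oz).
- move=> j; rewrite ltnS leq_eqVlt => /predU1P[->|jm]; first by rewrite subrr mulr0.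
  by rewrite f0// mul0r.
- by rewrite mulf_neq0// subr_eq0 eq_sym.
Qed.

Section gram_schmidt.
Variables (v : nat -> Cn -> C).

Definition normalize h : Cn -> C := fun z => (((Num.sqrt (nsq h))^-1)%:C)%C * h z.

(** [gs m k] is the [k]-th vector of the orthonormal family for [k < m], and zero
    otherwise: step [m] needs all the previous vectors, hence the recursion on the
    length of the family. *)
Fixpoint gs m : nat -> Cn -> C :=
  if m is j.+1 then fun k => if k == j then
      normalize (fun z => v j z - comb (fun i => inner Omega (v j) (gs j i)) (gs j) j z)
    else gs j k
  else fun _ => fun=> 0.

Lemma gs_ge m k : (m <= k)%N -> gs m k = fun=> 0.
Proof.
elim: m k => [//|m IH] k mk /=; rewrite ifF; first by apply: IH; exact: ltnW.
by rewrite gtn_eqF.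
Qed.

Lemma gs_lt m k : (k < m)%N -> gs m k = gs k.+1 k.
Proof.
elim: m => [//|m IH]; rewrite ltnS leq_eqVlt => /predU1P[->//|km] /=.
by rewrite ltn_eqF// IH.
Qed.

Hypothesis Av : forall j, A2O (v j).
(* Linear independence by duality: a functional separates [v m] from the previous
   vectors. *)
Hypothesis vind : forall m, exists f, [/\ A2O f,
  forall j, (j < m)%N -> inner Omega f (v j) = 0 & inner Omega f (v m) != 0].

Lemma A2_gs m k : A2O (gs m k).
Proof.
elim: m k => [|m IH] k /=; first exact: A2_0.
case: eqP => _; last exact: IH.
exact: A2_scale (A2_sub (Av m) (A2_comb_seq _ _ IH)).
Qed.

Definition gs_res m z :=
  v m z - comb (fun i => inner Omega (v m) (gs m i)) (gs m) m z.

Lemma A2_gs_res m : A2O (gs_res m).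
Proof. by apply: A2_sub => //; apply: A2_comb_seq => k; exact: A2_gs. Qed.

Lemma inner_gs_res m f : A2O f -> inner Omega (gs_res m) f = inner Omega (v m) f -
  \sum_(i < m) inner Omega (v m) (gs m i) * inner Omega (gs m i) f.
Proof.
move=> Af; have Ag k : A2O (gs m k) := A2_gs m k.
by rewrite (inner_sub (Av m) (A2_comb_seq _ _ Ag) Af) (inner_comb_seq _ _ Ag Af).
Qed.

(** The second half says, by duality, that [gs m k] is in the span of the first
    [m] vectors; by independence the residue normalized at step [m] is then not
    zero. *)
Lemma gs_props m :
  (forall j k, inner Omega (gs m j) (gs m k) = ((j == k) && (k < m)%N)%:R) /\
  (forall k f, A2O f -> (forall j, (j < m)%N -> inner Omega f (v j) = 0) ->
     inner Omega f (gs m k) = 0).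
Proof.
elim: m => [|m [IH1 IH2]].
  split=> [j k|k f Af _] /=; first by rewrite andbF inner0//; exact: A2_0.
  by rewrite (inner_conj A2_0 Af) inner0// conjc0.
have Ag := A2_gs m; have Ad := A2_gs_res m.
have dg k : inner Omega (gs_res m) (gs m k) = 0.
  rewrite inner_gs_res//; have [km|mk] := ltnP k m.
    rewrite (bigD1 (Ordinal km))//= IH1 eqxx km mulr1 big1 ?addr0 ?subrr// => i ik.
    by rewrite IH1 (negbTE (_ : (i : nat) != k)) ?mulr0.
  rewrite (gs_ge mk) (inner_conj A2_0 (Av m)) inner0// conjc0 big1 ?subr0// => i _.
  by rewrite (inner_conj A2_0 (Ag i)) inner0// conjc0 mulr0.
have d0 : 0 < nsq (gs_res m).
  have [f [Af f0 fm]] := vind m; rewrite lt_neqAle nsq_ge0 andbT; apply/eqP => E.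
  have := cauchy_schwarz Ad Af; rewrite -E mul0r => h.
  have := cmod_ge0 (inner Omega (gs_res m) f).
  have {}h : cmod (inner Omega (gs_res m) f) = 0.
    by apply/eqP; rewrite -sqrf_eq0; apply/eqP/le_anti; rewrite h sqr_ge0.
  move=> _; have : inner Omega (gs_res m) f = 0 by apply/eqP; rewrite -cmod_eq0 h.
  rewrite inner_gs_res// big1 ?subr0; last first.
    by move=> i _; rewrite (inner_conj Af (Ag i)) (IH2 i f Af f0) conjc0 mulr0.
  by rewrite (inner_conj Af (Av m)) => /eqP; rewrite conjc_eq0 (negbTE fm).
have gm : gs m.+1 m = normalize (gs_res m) by rewrite /= eqxx.
have gk k : k != m -> gs m.+1 k = gs m k by rewrite /= => /negbTE ->.
have ng k : inner Omega (normalize (gs_res m)) (gs m k) = 0.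
  by rewrite inner_scale// dg mulr0.
have An : A2O (normalize (gs_res m)) by exact: A2_scale.
split=> [j k|k f Af f0].
  have [->|jm] := eqVneq j m; have [->|km] := eqVneq k m.
  - rewrite gm ltnSn inner_scale// inner_scaler// inner_self.
    have : Num.sqrt (nsq (gs_res m)) != 0 by rewrite gt_eqF ?sqrtr_gt0.
    have := sqr_sqrtr (nsq_ge0 (gs_res m)).
    move: (Num.sqrt (nsq (gs_res m))) => s <- s0; simpc.
    by rewrite /= expr2; congr (_ +i* _)%C; field.
  - by rewrite gm gk// ng.
  - by rewrite gm gk// (inner_conj An (Ag j)) ng conjc0 (negbTE jm).
  - rewrite !gk// IH1; congr (_ && _)%:R; rewrite ltnS [in RHS]leq_eqVlt (negbTE km)//.
have [->|km] := eqVneq k m.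
  rewrite gm inner_scaler// (inner_conj Ad Af) inner_gs_res// big1 ?subr0; last first.
    move=> i _; rewrite (inner_conj Af (Ag i)) (IH2 i f Af) ?conjc0 ?mulr0// => j jm.
    by apply: f0; exact: ltnW.
  by rewrite (inner_conj Af (Av m)) f0// !conjc0 mulr0.
by rewrite gk// IH2// => j jm; apply: f0; exact: ltnW.
Qed.

Definition gs_basis k := gs k.+1 k.

Lemma gs_orthonormal : orthonormal gs_basis.
Proof.
split=> [k|j k]; first exact: A2_gs.
have jm : (j < maxn j k + 1)%N by rewrite addn1 ltnS leq_maxl.
have km : (k < maxn j k + 1)%N by rewrite addn1 ltnS leq_maxr.
by rewrite /gs_basis -(gs_lt jm) -(gs_lt km) (gs_props _).1 km andbT.
Qed.

Lemma gs_orth g : A2O g -> (forall k, inner Omega g (gs_basis k) = 0) ->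
  forall m, inner Omega g (v m) = 0.
Proof.
move=> Ag g0 m; have Ad := A2_gs_res m.
have gE k : (k < m)%N -> inner Omega g (gs m k) = 0.
  by move=> km; rewrite (gs_lt km); exact: g0.
have d0 : inner Omega g (gs_res m) = 0.
  have := g0 m; rewrite /gs_basis /= eqxx -/(gs_res m) (inner_scaler _ Ad Ag).
  have [n0|n0] := eqVneq (nsq (gs_res m)) 0.
    move=> _; have := cauchy_schwarz Ag Ad; rewrite n0 mulr0 => h.
    by apply/eqP; rewrite -cmod_eq0 -sqrf_eq0; apply/eqP/le_anti; rewrite h sqr_ge0.
  move/eqP; rewrite mulf_eq0 => /orP[|/eqP//].
  rewrite conjc_eq0 => /eqP/(congr1 (@complex.Re R))/= /eqP; rewrite invr_eq0 sqrtr_eq0.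
  by rewrite leNgt lt_neqAle eq_sym n0 nsq_ge0.
have Acomb := A2_comb_seq (fun i => inner Omega (v m) (gs m i)) m (A2_gs m).
have := inner_subr (Av m) Acomb Ag; rewrite -/(gs_res m) d0 => /esym/eqP.
rewrite subr_eq0 => /eqP ->; rewrite (inner_conj Acomb Ag).
rewrite (inner_comb_seq _ _ (A2_gs m) Ag) big1 ?conjc0// => i _.
by rewrite (inner_conj Ag (A2_gs m i)) gE// conjc0 mulr0.
Qed.

End gram_schmidt.

(** Gram-Schmidt applied to the kernel functions of a dense sequence of points: a
    function orthogonal to all of them vanishes at these points, hence
    everywhere. *)
Lemma basis_exists K : bergman_kernel Omega K -> exists e, orthonormal_basis Omega e.
Proof.
move=> HK; have [w [Ow wi wd]] := dense_sequence.
pose v j := K ^~ (w j); have Av j : A2O (v j) by case: (HK _ (Ow j)).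
have Ev f j : A2O f -> inner Omega f (v j) = f (w j).
  by move=> Af; have [_ E] := HK _ (Ow j); rewrite -E.
have vind m : exists f, [/\ A2O f, forall j, (j < m)%N -> inner Omega f (v j) = 0 &
    inner Omega f (v m) != 0].
  have [j jm /wi jE|f [Af f0 fm]] := @coord_poly w m (w m); first by rewrite jE ltnn in jm.
  by exists f; split; rewrite ?Ev// => j jm; rewrite Ev// f0.
have oe := gs_orthonormal Av vind; have [Ae oe2] := oe; set e := gs_basis v in oe Ae oe2.
exists e; split=> // f Af; apply/cvge0_eps => [m|]; first exact: sqnorm_ge0.
have [r [Ar cr rk _]] := @comb_cvg (fun k => inner Omega f (e k)) e _ oe (fun m => bessel m oe Af).
pose g z := f z - r z; have Ag : A2O g by exact: A2_sub.
have g0 j : g (w j) = 0.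
  rewrite -(Ev g j Ag); apply: (gs_orth Av) => // k.
  by rewrite (inner_sub Af Ar (Ae k)) rk subrr.
have fr z : Omega z -> f z = r z.
  move=> Oz; apply/eqP; rewrite -subr_eq0 -/(g z) -cmod_eq0; apply/negPn/negP => gz.
  have gp : 0 < cmod (g z) by rewrite lt_neqAle eq_sym gz cmod_ge0.
  have [hg _] := Ag; have [d d0 Hd] := is_grad_cts (hol_grad hg Oz) gp.
  have [j wj] := wd z d Oz d0; have := Hd _ wj.
  by rewrite g0 sub0r cmodN ltxx.
move=> eps e0; have [N HN] := cr _ e0; exists N => m /HN; rewrite sqnorm_subC.
by rewrite (@eq_sqnorm _ (fun z => f z - comb (fun k => inner Omega f (e k)) e m z))// => z /fr ->.
Qed.

(** * Primitives along rays *)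

Definition ccts (f : R -> C) :=
  cts_on 0 1 (fun t => complex.Re (f t)) /\ cts_on 0 1 (fun t => complex.Im (f t)).

Definition cint (f : R -> C) : C :=
  (int_itv 0 1 (fun t => complex.Re (f t)) +i* int_itv 0 1 (fun t => complex.Im (f t)))%C.

Lemma cctsP (f : R -> C) : (forall t, 0 <= t <= 1 -> forall e : R, 0 < e ->
  exists2 d : R, 0 < d & forall s : R, `|s - t| < d -> cmod (f s - f t) < e) -> ccts f.
Proof.
move=> H; split=> t /H{}H; apply/cvgrPdist_lt => e /H[d d0 Hd];
  apply/nbhs_ballP; exists d => // s; rewrite /ball /= distrC => /Hd;
  rewrite distrC; apply: le_lt_trans.
  have -> : complex.Re (f s) - complex.Re (f t) = complex.Re (f s - f t).
    by case: (f s) (f t) => ? ? [].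
  exact: ler_Re_cmod.
have -> : complex.Im (f s) - complex.Im (f t) = complex.Im (f s - f t).
  by case: (f s) (f t) => ? ? [].
exact: ler_Im_cmod.
Qed.

Lemma cctsB (f h : R -> C) : ccts f -> ccts h -> ccts (fun t => f t - h t).
Proof.
move=> [f1 f2] [h1 h2]; split.
  rewrite (_ : (fun t => _) = (fun t => complex.Re (f t)) \- (fun t => complex.Re (h t))).
    exact: cts_onB.
  by apply/funext => t /=; case: (f t) (h t) => ? ? [].
rewrite (_ : (fun t => _) = (fun t => complex.Im (f t)) \- (fun t => complex.Im (h t))).
  exact: cts_onB.
by apply/funext => t /=; case: (f t) (h t) => ? ? [].
Qed.

Lemma cintB (f h : R -> C) : ccts f -> ccts h -> cint (fun t => f t - h t) = cint f - cint h.
Proof.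
move=> [f1 f2] [h1 h2]; rewrite /cint; simpc; rewrite -!int_itvB//.
by congr (_ +i* _)%C; apply: eq_int_itv => t _ /=; case: (f t) (h t) => ? ? [].
Qed.

Lemma cintZ (a : C) (f : R -> C) : ccts f ->
  ccts (fun t => a * f t) /\ cint (fun t => a * f t) = a * cint f.
Proof.
move=> [f1 f2].
have cz (k : R) u : cts_on 0 1 u -> cts_on 0 1 (fun t => k * u t).
  by move=> cu t /cu ct; apply: cvgM => //; exact: cvg_cst.
have iz (k : R) u : cts_on 0 1 u -> int_itv 0 1 (fun t => k * u t) = k * int_itv 0 1 u.
  by move=> cu; apply: RintegralZl => //; exact: cts_on_integrable.
have E1 : (fun t => complex.Re (a * f t)) =
    (fun t => complex.Re a * complex.Re (f t)) \- (fun t => complex.Im a * complex.Im (f t)).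
  by apply/funext => t /=; case: (a) (f t) => a1 a2 [].
have E2 : (fun t => complex.Im (a * f t)) =
    (fun t => complex.Re a * complex.Im (f t)) \- (fun t => - complex.Im a * complex.Re (f t)).
  by apply/funext => t /=; case: (a) (f t) => a1 a2 [b1 b2] /=; ring.
split; first by rewrite /ccts E1 E2; split; apply: cts_onB; exact: cz.
rewrite /cint E1 E2 !int_itvB; try exact: cz.
by rewrite !iz//; case: (a) => a1 a2; simpc; rewrite /=; congr (_ +i* _)%C; ring.
Qed.

Lemma cint_lin (A : 'I_n.+1 -> R -> C) v : (forall k, ccts (A k)) ->
  ccts (fun t => lin (A ^~ t) v) /\ cint (fun t => lin (A ^~ t) v) = lin (fun k => cint (A k)) v.
Proof.
move=> cA; rewrite /lin.
have H (s : seq 'I_n.+1) : ccts (fun t => \sum_(k <- s) v ord0 k * A k t) /\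
    cint (fun t => \sum_(k <- s) v ord0 k * A k t) = \sum_(k <- s) v ord0 k * cint (A k).
  elim: s => [|k s [IH1 IH2]].
    under eq_fun do rewrite big_nil; rewrite big_nil; split.
      by split; exact: cts_on_cst.
    by rewrite /cint int_itv_cst// mul0r.
  have [z1 z2] := cintZ (v ord0 k) (cA k); have [n1 n2] := cintZ (-1) IH1.
  have E : (fun t => \sum_(k <- k :: s) v ord0 k * A k t) =
      (fun t => v ord0 k * A k t - -1 * \sum_(k <- s) v ord0 k * A k t).
    by apply/funext => t; rewrite big_cons mulN1r opprK.
  rewrite E; split; first exact: cctsB.
  by rewrite (cintB z1 n1) z2 n2 IH2 big_cons mulN1r opprK.
exact: H.
Qed.

Lemma cint_bound (f : R -> C) (M : R) : ccts f ->
  (forall t, 0 <= t <= 1 -> cmod (f t) <= M) -> cmod (cint f) <= 2 * M.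
Proof.
move=> [f1 f2] fM; apply: le_trans (cmod_ReIm _) _ => /=.
have b1 : `|int_itv 0 1 (fun t => complex.Re (f t))| <= M * (1 - 0).
  by apply: int_itv_bound => // t /fM; apply: le_trans; exact: ler_Re_cmod.
have b2 : `|int_itv 0 1 (fun t => complex.Im (f t))| <= M * (1 - 0).
  by apply: int_itv_bound => // t /fM; apply: le_trans; exact: ler_Im_cmod.
lra.
Qed.

Lemma int_itv_derive (f h : R -> R) : cts_on 0 1 h ->
  (forall t : R, 0 <= t <= 1 -> is_derive t 1 f (h t)) -> int_itv 0 1 h = f 1 - f 0.
Proof.
move=> ch df; have dc (t : R) : 0 <= t <= 1 -> {for t, continuous f}.
  by move=> /df dt; apply: differentiable_continuous; apply/derivable1_diffP; case: dt.
have b0 : 0 <= (0 : R) <= 1 by rewrite lexx ler01.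
have b1 : 0 <= (1 : R) <= 1 by rewrite lexx ler01.
rewrite /int_itv /Rintegral (@continuous_FTC2 _ h f)//.
- by apply: continuous_in_subspaceT => x /set_mem/=; rewrite in_itv/=; apply: ch.
- split.
  + by move=> x /[!in_itv]/= /andP[x0 x1]; have [] := df x; rewrite ?ltW.
  + by apply: cvg_at_right_filter; exact: dc.
  + by apply: cvg_at_left_filter; exact: dc.
- move=> x /[!in_itv]/= /andP[x0 x1]; rewrite derive1E; apply: derive_val.
  by apply: df; rewrite !ltW.
Qed.

Section radial_primitive.
Variables (F : Cn -> C).
Hypotheses (hF : holomorphic_on Omega F) (F0 : F 0 = 0).

(** The integrand of the primitive of [F] along the ray to [z], with its limit as
    value at [t = 0]. *)
Definition quot z (t : R) : C :=
  if t == 0 then lin (grad F 0) z else F ((t%:C)%C *: z) / (t%:C)%C.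

Lemma ccts_ray h z : holomorphic_on Omega h -> Omega z ->
  ccts (fun t => h ((t%:C)%C *: z)).
Proof.
move=> hh Oz; apply: cctsP => t t01 e e0.
have [d d0 Hd] := is_cderiv_cts (is_cderiv_ray hh (scale_in Oz t01)) e0.
exists d => // s st; apply: Hd.
by rewrite -[X in cmod X]/((s%:C)%C - (t%:C)%C) -rmorphB cmod_real.
Qed.

Lemma ccts_quot z : Omega z -> ccts (quot z).
Proof.
move=> Oz; apply: cctsP => t t01 e e0; have [->|t0] := eqVneq t 0.
  have k0 : 0 < 1 + nrm z by rewrite ltr_pwDl// nrm_ge0.
  have ek : 0 < e / (1 + nrm z) by rewrite divr_gt0.
  have [d d0 Hd] := hol_grad hF Omega0 ek.
  exists (d / (1 + nrm z)); first by rewrite divr_gt0.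
  move=> s; rewrite subr0 ltr_pdivlMr// => sd; rewrite /quot eqxx.
  case: eqP => [_|/eqP s0]; first by rewrite subrr cmod0.
  have ns : nrm ((s%:C)%C *: z) < d.
    by apply: le_lt_trans sd; rewrite nrmZ cmod_real ler_wpM2l// lerDr.
  have := Hd _ ns; rewrite add0r F0 subr0 linZ nrmZ cmod_real => h.
  have sp : 0 < `|s| by rewrite normr_gt0.
  have sC : (s%:C)%C != 0 :> C by rewrite -cmod_eq0 cmod_real normr_eq0.
  have E : F ((s%:C)%C *: z) / (s%:C)%C - lin (grad F 0) z =
      (F ((s%:C)%C *: z) - (s%:C)%C * lin (grad F 0) z) / (s%:C)%C by field.
  rewrite E cmodM cmodV cmod_real ltr_pdivrMr//; apply: le_lt_trans h _.
  rewrite mulrCA mulrC ltr_pM2r// mulrAC ltr_pdivrMr// ltr_pM2l//.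
  by rewrite ltrDr.
have tC : (t%:C)%C != 0 :> C by rewrite -cmod_eq0 cmod_real normr_eq0.
have tp : 0 < t by rewrite lt_neqAle eq_sym t0; case/andP: t01.
have H := is_cderivM (is_cderiv_ray hF (scale_in Oz t01)) (is_cderivV tC).
have [d d0 Hd] := is_cderiv_cts H e0; exists (Num.min d t); first by rewrite lt_min d0.
move=> s; rewrite lt_min => /andP[sd st].
have s0 : s != 0.
  by apply: contraTN st => /eqP ->; rewrite sub0r normrN gtr0_norm// ltxx.
rewrite /quot (negbTE s0) (negbTE t0); apply: (Hd (s%:C)%C).
by rewrite -[X in cmod X]/((s%:C)%C - (t%:C)%C) -rmorphB cmod_real.
Qed.

(** Compactness of the segment from [0] to [z]. *)
Lemma ray_tube z : Omega z -> exists r M : R, [/\ 0 < r, 0 <= M & forall t w,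
  0 <= t <= 1 -> nrm (w - (t%:C)%C *: z) <= r -> Omega w /\ cmod (F w) <= M].
Proof.
move=> Oz.
have cpt : compact (`[0, 1] : set R) by exact: segment_compact.
move/compact_near_coveringP : cpt.
move=> /(_ R 0^'+ (fun i t => forall w, nrm (w - (t%:C)%C *: z) <= i ->
  Omega w /\ cmod (F w) <= i^-1) _).
move=> H.
have /H : forall t : R, `[0, 1]%classic t -> \forall t' \near t & i \near 0^'+,
    forall w, nrm (w - (t'%:C)%C *: z) <= i -> Omega w /\ cmod (F w) <= i^-1.
  move=> t /=; rewrite in_itv /= => t01; have Ot' := scale_in Oz t01.
  have [d d0 Hd] := is_grad_cts (hol_grad hF Ot') (@ltr01 R).
  pose e := Num.min d (dist ((t%:C)%C *: z)).
  have e0 : 0 < e by rewrite lt_min d0 dist_gt0.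
  pose M := cmod (F ((t%:C)%C *: z)) + 1.
  have M0 : 0 < M by rewrite ltr_wpDl ?cmod_ge0.
  have k0 : 0 < 1 + nrm z by rewrite ltr_pwDl// nrm_ge0.
  exists (ball t (e / 2 / (1 + nrm z)), [set i | 0 < i] `&` [set i | i < Num.min (e / 2) M^-1]).
    split.
      by apply: nbhsx_ballx; rewrite !divr_gt0.
    apply: filterI; first exact: nbhs_right_gt.
    by apply: nbhs_right_lt; rewrite lt_min divr_gt0// invr_gt0.
  move=> [t' i] /= [tt' [i0]]; rewrite lt_min => /andP[i1 i2] w wi.
  have wt : nrm (w - (t%:C)%C *: z) < e.
    rewrite -(subrK ((t'%:C)%C *: z) w) -addrA.
    apply: le_lt_trans (nrmD _ _) _.
    have : nrm ((t'%:C)%C *: z - (t%:C)%C *: z) < e / 2.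
      rewrite -scalerBl nrmZ -rmorphB cmod_real distrC.
      apply: (@le_lt_trans _ _ (`|t - t'| * (1 + nrm z))).
        by rewrite ler_wpM2l// lerDr.
      by rewrite -ltr_pdivlMr.
    by move=> h; rewrite [e]splitr; apply: ltrD h; exact: le_lt_trans wi i1.
  move: wt; rewrite lt_min => /andP[w1 w2]; split; first exact: (@dist_in ((t%:C)%C *: z)).
  have h1 := Hd w w1; have h2 := cmodD (F w - F ((t%:C)%C *: z)) (F ((t%:C)%C *: z)).
  rewrite subrK in h2; apply: (@le_trans _ _ M).
    by apply: (le_trans h2); rewrite /M addrC lerD2l ltW.
  by rewrite -[M]invrK lef_pV2 ?posrE ?invr_gt0// ltW.
move=> Hn.
have [i [i0 Hi]] : exists i : R, 0 < i /\ (forall t, `[0, 1]%classic t ->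
    forall w, nrm (w - (t%:C)%C *: z) <= i -> Omega w /\ cmod (F w) <= i^-1).
  have Hp : \forall i \near 0^'+, 0 < (i : R) by exact: nbhs_right_gt.
  have [i [h1 h2]] := @filter_ex _ _ (at_right_proper_filter (0 : R)) _ (filterI Hn Hp).
  by exists i; split=> // t /h1.
exists i, i^-1; split=> //; first by rewrite invr_ge0 ltW.
by move=> t w t01; apply: Hi; rewrite /= in_itv.
Qed.

(** Differentiation under the integral sign.  The second-order Taylor bound at
    [t z] is uniform in [t] by [ray_tube], and quadratic in the increment [t v],
    which compensates the division by [t]. *)
Lemma quot_grad z : Omega z ->
  is_grad (fun w => cint (quot w)) z (fun k => cint (fun t => grad F ((t%:C)%C *: z) k)).
Proof.
move=> Oz; have [r [M [r0 M0 HM]]] := ray_tube Oz.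
pose A k (t : R) := grad F ((t%:C)%C *: z) k.
have cA k : ccts (A k) := ccts_ray (hol_pderiv k hF) Oz.
set K : R := 128 * M / r ^+ 2.
have K0 : 0 <= K by apply: divr_ge0; [apply: mulr_ge0|exact: sqr_ge0].
have b1 : 0 <= (1 : R) <= 1 by rewrite lexx ler01.
move=> e e0; pose d := Num.min (r / 4) (e / (2 * (K + 1))).
have K1 : 0 < 2 * (K + 1) by rewrite mulr_gt0// ltr_wpDl.
exists d => [|v]; first by rewrite lt_min !divr_gt0.
rewrite lt_min => /andP[v1 v2].
have Ozv : Omega (z + v).
  have [|//] := HM 1 (z + v) b1; rewrite scale1r addrAC subrr add0r.
  by apply: ltW; lra.
have [cL EL] := cint_lin v cA; rewrite -EL -cintB; [|exact: ccts_quot|exact: ccts_quot].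
rewrite -cintB; [|by apply: cctsB; exact: ccts_quot|exact: cL].
apply: (@le_trans _ _ (2 * (K * nrm v ^+ 2))); last first.
  have -> : 2 * (K * nrm v ^+ 2) = 2 * K * nrm v * nrm v by ring.
  rewrite ler_wpM2r ?nrm_ge0//.
  move: v2; rewrite ltr_pdivlMr// => v2; have := nrm_ge0 v; nra.
apply: cint_bound.
  by apply: cctsB cL; apply: cctsB; exact: ccts_quot.
move=> t t01; rewrite /quot; have [->|t0] := eqVneq t 0.
  have -> : A ^~ 0 = grad F 0 by apply/funext => k; rewrite /A scale0r.
  rewrite linD [_ + lin _ v]addrC addrK subrr cmod0.
  by apply: mulr_ge0 => //; exact: sqr_ge0.
have [tn t1] := andP t01; have tp : 0 < t by rewrite lt_neqAle eq_sym t0.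
have tC : (t%:C)%C != 0 :> C by rewrite -cmod_eq0 cmod_real normr_eq0.
have nv : nrm ((t%:C)%C *: v) <= r / 4.
  rewrite nrmZ cmod_real ger0_norm//; apply: (le_trans _ (ltW v1)).
  by rewrite ler_piMl// nrm_ge0.
have T := @taylor2 _ _ F ((t%:C)%C *: z) r M _ ((t%:C)%C *: v) r0.
have {}T : cmod (F ((t%:C)%C *: z + (t%:C)%C *: v) - F ((t%:C)%C *: z)
    - lin (grad F ((t%:C)%C *: z)) ((t%:C)%C *: v)) <= K * nrm ((t%:C)%C *: v) ^+ 2.
  apply: T => //.
  - move=> w wr; exists (grad F w); apply: hol_grad => //.
    exact: (HM t w t01 wr).1.
  - by move=> w wr; exact: (HM t w t01 wr).2.
  - by apply: hol_grad => //; exact: scale_in.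
rewrite -scalerDr linZ in T.
set a := F _ in T *; set b := F _ in T *; set l := lin _ v in T *.
have -> : a / (t%:C)%C - b / (t%:C)%C - l = (a - b - (t%:C)%C * l) / (t%:C)%C by field.
rewrite cmodM cmodV cmod_real gtr0_norm// ler_pdivrMr//; apply: le_trans T _.
rewrite nrmZ cmod_real gtr0_norm// exprMn mulrCA -[leRHS]mulrC ler_wpM2r//.
  by rewrite mulr_ge0 ?sqr_ge0.
by rewrite expr2 ler_piMl.
Qed.

Lemma quot_hol : holomorphic_on Omega (fun w => cint (quot w)).
Proof. by apply: grad_hol => z Oz; eexists; exact: quot_grad. Qed.

(** By [quot_grad], the radial derivative is the integral over [[0, 1]] of the
    derivative of [t |-> F (t z)]. *)
Lemma quot_radial z : Omega z -> radial (fun w => cint (quot w)) z = F z.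
Proof.
move=> Oz; rewrite radialE (is_grad_grad (quot_grad Oz)).
pose A k (t : R) := grad F ((t%:C)%C *: z) k.
have cA k : ccts (A k) := ccts_ray (hol_pderiv k hF) Oz.
have [cL <-] := cint_lin z cA.
have D (a : C) (t : R) : 0 <= t <= 1 ->
    is_derive t 1 (fun s : R => complex.Re (a * F ((s%:C)%C *: z)))
      (complex.Re (a * lin (A ^~ t) z)).
  move=> t01; have E : (fun s : R => complex.Re (a * F ((0 + (s%:C)%C * 1) *: z))) =
      (fun s : R => complex.Re (a * F ((s%:C)%C *: z))).
    by apply/funext => s; rewrite add0r mulr1.
  have := @is_cderiv_derive_Re R (fun s => F (s *: z)) 0 1 a (lin (A ^~ t) z) t.
  rewrite E add0r !mulr1; apply; exact: (is_cderiv_ray hF (scale_in Oz t01)).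
have I (a : C) : int_itv 0 1 (fun t => complex.Re (a * lin (A ^~ t) z)) = complex.Re (a * F z).
  have [[c1 _] _] := cintZ a cL; rewrite (int_itv_derive c1 (D a)).
  by rewrite scale1r scale0r F0 mulr0 subr0.
rewrite /cint (_ : int_itv 0 1 (fun t => complex.Re (lin (A ^~ t) z)) = complex.Re (1 * F z)).
  rewrite (_ : int_itv 0 1 _ = complex.Re (- 'i%C * F z)).
    by rewrite mul1r; case: (F z) => a b /=; congr (_ +i* _)%C; ring.
  rewrite -I; apply: eq_int_itv => t _.
  by case: (lin _ _) => a b /=; ring.
by rewrite -I; apply: eq_int_itv => t _; rewrite mul1r.
Qed.

(** The integrands differ at [t = 0] only. *)
Lemma cint_quot z : Omega z -> cint (quot z) =
  (Rintegral lebesgue_measure `[0%R, 1%R]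
     (fun t => complex.Re (F ((t%:C)%C *: z) / (t%:C)%C))
   +i* Rintegral lebesgue_measure `[0%R, 1%R]
     (fun t => complex.Im (F ((t%:C)%C *: z) / (t%:C)%C)))%C.
Proof.
move=> Oz; have [c1 c2] := ccts_quot Oz.
have main (u v : R -> R) : cts_on 0 1 u -> (forall t, 0 < t -> u t = v t) ->
    int_itv 0 1 u = Rintegral lebesgue_measure `[0%R, 1%R] v.
  move=> cu uv; have iu : lebesgue_measure.-integrable `]0%R, 1%R] (EFin \o u).
    apply: integrableS (cts_on_integrable cu) => //.
    by apply: subset_itvr; rewrite bnd_simp.
  have E : {in `]0%R, 1%R]%classic, u =1 v}.
    by move=> t /set_mem /=; rewrite in_itv /= => /andP[t0 _]; exact: uv.
  have EI : Rintegral lebesgue_measure `]0%R, 1%R] u = Rintegral lebesgue_measure `]0%R, 1%R] v.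
    exact: eq_Rintegral.
  rewrite /int_itv -(Rintegral_itv_obnd_cbnd iu); apply: etrans EI _.
  apply: Rintegral_itv_obnd_cbnd.
  by apply: eq_integrable iu => // t /E /= ->.
rewrite /cint; congr (_ +i* _)%C; apply: main => // t t0.
  by rewrite /quot gt_eqF.
by rewrite /quot gt_eqF.
Qed.

End radial_primitive.

(** The Volterra integral inverts the radial derivative. *)
Lemma volterra_primitive g phi f : holomorphic_on Omega g -> holomorphic_on Omega phi ->
  (forall z, Omega z -> Omega (phi z)) -> phi 0 = 0 -> holomorphic_on Omega f ->
  [/\ holomorphic_on Omega (volterra g phi f),
      forall z, Omega z -> radial (volterra g phi f) z = radial f (phi z) * g z &
      volterra g phi f 0 = 0].
Proof.
move=> hg hp Op p0 hf; pose F z := radial f (phi z) * g z.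
have hF : holomorphic_on Omega F.
  move=> z Oz; apply: differentiableM; last exact: hg.
  apply: differentiable_comp; first exact: hp.
  by apply: hol_radial => //; exact: Op.
have F0 : F 0 = 0.
  by rewrite /F p0 radialE /lin big1 ?mul0r// => k _; rewrite mxE mul0r.
have E z : Omega z -> cint (quot F z) = volterra g phi f z.
  by move=> Oz; rewrite (cint_quot hF F0 Oz).
have hq := quot_hol hF F0; split.
- exact: eq_hol E hq.
- by move=> z Oz; rewrite -(eq_radial E hq Oz) quot_radial.
rewrite -E// /cint; have q0 t : quot F 0 t = 0.
  rewrite /quot; case: eqP => _; last by rewrite scaler0 F0 mul0r.
  by rewrite /lin big1// => k _; rewrite mxE mul0r.
rewrite (@eq_int_itv _ _ _ _ (fun=> 0)); last by move=> t _; rewrite q0.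
by rewrite (@eq_int_itv _ _ _ (fun t => complex.Im _) (fun=> 0)) ?int_itv_cst ?mul0r// => t _; rewrite q0.
Qed.

(** * Density of dilates *)

(** A function with zero radial derivative is constant along rays. *)
Lemma radial_unique f h : holomorphic_on Omega f -> holomorphic_on Omega h ->
  (forall z, Omega z -> radial f z = radial h z) -> f 0 = h 0 ->
  forall z, Omega z -> f z = h z.
Proof.
move=> hf hh Rfh fh0 z Oz; have hd := hol_sub hf hh.
have := @ray_bound (fun w => f w - h w) z 0 hd Oz.
rewrite fh0 subrr subr0 => H; apply/eqP; rewrite -subr_eq0 -cmod_eq0; apply/eqP/le_anti.
rewrite cmod_ge0 andbT; apply: H => t /andP[t0 t1].
have Ot' : Omega ((t%:C)%C *: z) by apply: scale_in => //; rewrite (ltW t0).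
by rewrite radial_sub// Rfh// subrr cmod0 mul0r.
Qed.

(** The parallelogram identity. *)
Lemma sqnorm_add f h : A2O f -> A2O h ->
  (sqnorm Omega (fun z => (f z + h z)%R) + sqd f h =
   2%:E * sqnorm Omega f + 2%:E * sqnorm Omega h)%E.
Proof.
move=> [hf _] [hh _]; have hd := hol_sub hf hh.
have ha : holomorphic_on Omega (fun z => f z + h z).
  apply: (@eq_hol (fun z => 1 * f z + h z)) => [z _|]; first by rewrite mul1r.
  exact: holZD.
have s0 (u : Cn -> C) z : Omega z -> 0 <= cmod (u z) ^+ 2 by move=> _; exact: sqr_ge0.
have cf := sqr_cmod_ctsO hf; have ch := sqr_cmod_ctsO hh.
have m0 (u : Cn -> C) z : Omega z -> 0 <= 2 * cmod (u z) ^+ 2.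
  by move=> _; rewrite mulr_ge0// sqr_ge0.
rewrite !sqnormE -(iOD (sqr_cmod_ctsO ha) (sqr_cmod_ctsO hd) (s0 _) (s0 (fun z => f z - h z))).
rewrite -(iOZ (ler0n _ 2) cf (s0 f)) -(iOZ (ler0n _ 2) ch (s0 h)).
rewrite -(iOD (ctsOM (ctsO_cst 2) cf) (ctsOM (ctsO_cst 2) ch) (m0 f) (m0 h)).
apply: eq_iO => z _; rewrite !cmod_sqr.
by case: (f z) (h z) => a b [c d] /=; ring.
Qed.

Lemma nsq_dilate f (r : R) : 0 < r <= 1 -> A2O f ->
  A2O (fun z => f ((r%:C)%C *: z)) /\
  nsq (fun z => f ((r%:C)%C *: z)) <= (r^-1) ^+ (2 * n.+1) * nsq f.
Proof.
move=> r01 Af; have [hf _] := Af; have /andP[r0 r1] := r01.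
have [hr _] := @hol_dilate f r (introT andP (conj (ltW r0) r1)) hf.
have b : (sqnorm Omega (fun z => f ((r%:C)%C *: z)) <= ((r^-1) ^+ (2 * n.+1) * nsq f)%:E)%E.
  rewrite EFinM -(A2_nsq Af); apply: (iO_dilate r01 (sqr_cmod_ctsO hf)) => z _.
  exact: sqr_ge0.
have Ar : A2O (fun z => f ((r%:C)%C *: z)).
  by split=> //; apply: le_lt_trans b (ltry _).
by split=> //; rewrite -lee_fin -A2_nsq.
Qed.

(** The norm of [f_r] is at most that of [f], up to a factor tending to [1].  If
    [f_r] stayed away from [f], the parallelogram identity would bound the norm of
    [f_r + f] away from twice that of [f], against Fatou's lemma. *)
Lemma dilate_dense f (eps : R) : A2O f -> 0 < eps -> exists k,
  (sqd (fun z => f (((rk k)%:C)%C *: z)) f <= eps%:E)%E.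
Proof.
move=> Af e0; apply/not_existsP => H; have [hf _] := Af.
have rp k : 0 < rk k <= 1 by have := rk1 k; lra.
pose fk k z := f (((rk k)%:C)%C *: z).
have Afk k : A2O (fk k) by case: (nsq_dilate (rp k) Af).
have nfk k : nsq (fk k) <= ((rk k)^-1) ^+ (2 * n.+1) * nsq f by case: (nsq_dilate (rp k) Af).
pose S := nsq f; have S0 : 0 <= S := nsq_ge0 f.
have h0 : 0 < hardy_const by rewrite /hardy_const ltr_wpDl// mulr_ge0// exprn_ge0.
pose N := Num.bound (4 * (hardy_const * S) / eps).
have rN k : 2 * nsq (fk (N + k)%N) <= 2 * S + eps / 2.
  have r1 : 1 / 2 <= rk (N + k) <= 1 by have := rk1 (N + k); lra.
  have := dilation_factor (2 * n.+1) r1; rewrite -/hardy_const => d1.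
  have d2 := ler_wpM2r S0 d1; have := nfk (N + k)%N; rewrite -/S => d3.
  have q1 : 1 - rk (N + k) = ((N + k).+2%:R)^-1 by rewrite /rk; ring.
  have p1 : 0 < (N + k).+2%:R :> R by rewrite ltr0n.
  have small : hardy_const * (1 - rk (N + k)) * S <= eps / 4.
    have -> : hardy_const * (1 - rk (N + k)) * S = hardy_const * S / (N + k).+2%:R.
      by rewrite q1; ring.
    rewrite ler_pdivrMr//.
    have b0 : 0 <= 4 * (hardy_const * S) / eps.
      by rewrite divr_ge0 ?(ltW e0)// !mulr_ge0// ltW.
    have := archi_boundP b0; rewrite ltr_pdivrMr// -/N => bN.
    have : N%:R * eps <= (N + k).+2%:R * eps.
      by rewrite ler_wpM2r ?(ltW e0)// ler_nat -addn2 -addnA leq_addr.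
    lra.
  have rS : rk (N + k) * S <= S by rewrite ler_piMl//; case/andP: r1.
  rewrite mulrBl in d2; lra.
have up k : (sqnorm Omega (fun z => (fk (N + k)%N z + f z)%R) <= (4 * S - eps / 2)%:E)%E.
  have Aa : A2O (fun z => fk (N + k)%N z + f z).
    apply: (@eq_A2 (fun z => 1 * fk (N + k)%N z + f z)); last exact: A2_comb.
    by move=> z _; rewrite mul1r.
  have Ad := A2_sub (Afk (N + k)%N) Af.
  have := sqnorm_add (Afk (N + k)%N) Af; rewrite (A2_nsq Aa) (A2_nsq Ad) (A2_nsq Af).
  rewrite (A2_nsq (Afk _)) -!EFinM -!EFinD => -[] E; rewrite lee_fin -/S.
  have := H (N + k)%N; rewrite (A2_nsq Ad) lee_fin => /negP; rewrite -ltNge => lt.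
  have := rN k; rewrite -/S in E; lra.
have lim : (iO (fun z => cmod (f z + f z) ^+ 2)%R <= (4 * S - eps / 2)%:E)%E.
  apply: (@iO_fatou (fun k z => cmod (fk (N + k)%N z + f z) ^+ 2)).
  - move=> k; apply: sqr_cmod_ctsO; apply: (@eq_hol (fun z => 1 * fk (N + k)%N z + f z)).
      by move=> z _; rewrite mul1r.
    by apply: holZD => //; case: (Afk (N + k)%N).
  - by move=> k z _; exact: sqr_ge0.
  - move=> z Oz; apply: cconv_sqr; apply: cconvD (cconv_cst _) => e /(rk_conv hf Oz)[M HM].
    by exists M => k Mk; apply: HM; exact: leq_trans Mk (leq_addl _ _).
  - by move=> k; exact: up.
have E : iO (fun z => cmod (f z + f z) ^+ 2) = (4 * S)%:E.
  rewrite (@eq_iO _ (fun z => 4 * cmod (f z) ^+ 2)).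
    rewrite (iOZ (ler0n _ 4) (sqr_cmod_ctsO hf)) => [|z _]; last exact: sqr_ge0.
    by rewrite -sqnormE (A2_nsq Af).
  by move=> z _; rewrite !cmod_sqr; case: (f z) => a b /=; ring.
by move: lim; rewrite E lee_fin; lra.
Qed.

(** [r z] is the combination, with weights [r] and [1 - r], of a point [w] of
    [Omega] close to [z] and of the small vector [r (z - w) / (1 - r)]. *)
Lemma closure_dilate (r : R) z : 0 <= r < 1 -> closure Omega z -> Omega ((r%:C)%C *: z).
Proof.
move=> /andP[r0 r1] cz; have d0 := dist_gt0 Omega0.
have e0 : 0 < (1 - r) * dist 0 by rewrite mulr_gt0// subr_gt0.
have : nbhs z [set w | nrm (w - z) < (1 - r) * dist 0] by apply/nbhs_nrm; exists ((1 - r) * dist 0).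
move=> /cz[w [Ow /= wz]]; pose s : C := ((1 - r)%:C)%C.
have s0 : s != 0 by rewrite -cmod_eq0 cmod_real normr_eq0 subr_eq0 gt_eqF.
pose u := s^-1 *: ((r%:C)%C *: (z - w)).
have Ou : Omega u.
  apply: (@dist_in 0); rewrite subr0 /u !nrmZ cmodV !cmod_real (ger0_norm r0).
  rewrite gtr0_norm ?subr_gt0// ltr_pdivrMl ?subr_gt0// nrm_distC.
  by apply: le_lt_trans wz; rewrite ler_piMl ?nrm_ge0// ltW.
have := @convexE w u r; rewrite r0 (ltW r1) => /(_ isT Ow Ou).
by rewrite /u scalerA mulfV// scale1r -scalerDr addrC subrK.
Qed.

(** * The operator and its Hilbert-Schmidt norm *)

(** The integral of a nonnegative function is a supremum over simple functions, so
    it is monotone on all functions, measurable or not. *)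
Lemma le_integral_ge0 (d : measure_display) (T : measurableType d)
    (m : {measure set T -> \bar R}) (D : set T) (f1 f2 : T -> \bar R) :
  (forall x, D x -> 0 <= f1 x <= f2 x)%E ->
  (\int[m]_(x in D) f1 x <= \int[m]_(x in D) f2 x)%E.
Proof.
move=> f12; have f10 x : D x -> (0 <= f1 x)%E by move=> /f12/andP[].
have f20 x : D x -> (0 <= f2 x)%E by move=> /f12/andP[a b]; exact: le_trans a b.
rewrite (ge0_integralE _ f10) (ge0_integralE _ f20).
apply: ge_ereal_sup => _ [h /= hf <-]; apply: ereal_sup_ubound; exists h => //= x.
apply: le_trans (hf x) _; rewrite !patchE; case: ifPn => // /set_mem/f12/andP[_].
exact.
Qed.

Section operator.
Variables (g : Cn -> C) (phi : Cn -> Cn).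
Hypotheses (hg : holomorphic_on Omega g) (hphi : holomorphic_on Omega phi).
Hypotheses (Ophi : forall z, Omega z -> Omega (phi z)) (phi0 : phi 0 = 0).

Local Opaque volterra.
Let V := volterra g phi.

Lemma radial_volterra f : A2O f -> [/\ holomorphic_on Omega (V f),
  forall z, Omega z -> radial (V f) z = radial f (phi z) * g z & V f 0 = 0].
Proof. by move=> [hf _]; exact: volterra_primitive. Qed.

Lemma volterra_linear (a : C) f h z : A2O f -> A2O h -> Omega z ->
  V (fun w => a * f w + h w) z = a * V f z + V h z.
Proof.
move=> Af Ah Oz; have [v1 r1 z1] := radial_volterra (A2_comb a Af Ah).
have [v2 r2 z2] := radial_volterra Af; have [v3 r3 z3] := radial_volterra Ah.
have [hf _] := Af; have [hh _] := Ah.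
have z123 : V (fun w => a * f w + h w) 0 = a * V f 0 + V h 0.
  by rewrite z1 z2 z3 mulr0 addr0.
refine (radial_unique v1 (holZD a v2 v3) _ z123 Oz) => w Ow.
apply: (etrans (r1 w Ow)); apply: etrans (esym (grad_comb a v2 v3 Ow)).
refine (etrans (congr1 (fun x => x * g w) (grad_comb a hf hh (Ophi Ow))) _).
refine (etrans _ (esym (congr2 (fun x y => a * x + y) (r2 w Ow) (r3 w Ow)))).
by rewrite mulrDl mulrA.
Qed.

(** The Volterra integral gives the identity for dilates, which are holomorphic near
    the closure.  They are dense, and point values and radial derivatives are
    continuous for the norm, so that the identity passes to the limit. *)
Lemma radial_extension T f : volterra_extension Omega g phi T -> A2O f ->
  [/\ holomorphic_on Omega (T f),
    forall z, Omega z -> radial (T f) z = radial f (phi z) * g z & T f 0 = 0].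
Proof.
move=> [[TA Tlin [M HM]] Text] Af; have [hf _] := Af.
have /choice[kk Hkk] : forall m : nat, exists k,
    (sqd (fun z => f (((rk k)%:C)%C *: z)) f <= (m.+1%:R^-1)%:E)%E.
  by move=> m; apply: dilate_dense => //; rewrite invr_gt0.
pose h m z := f (((rk (kk m))%:C)%C *: z).
have rp k : 0 < rk k <= 1 by have := rk1 k; lra.
have Ah m : A2O (h m) by case: (nsq_dilate (rp (kk m)) Af).
have hf' : nconv h f.
  move=> e e0; pose N := Num.bound e^-1; exists N => m Nm; apply: le_trans (Hkk m) _.
  rewrite lee_fin -[e]invrK lef_pV2 ?posrE ?invr_gt0//.
  have ei : 0 <= e^-1 by rewrite invr_ge0 ltW.
  by apply: le_trans (ltW (archi_boundP ei)) _; rewrite ler_nat (leq_trans Nm).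
have TE m z : Omega z -> T (h m) z = V (h m) z.
  pose U := [set z | Omega (((rk (kk m))%:C)%C *: z)].
  have := rk1 (kk m); set r := rk (kk m) => /andP[r1 r2].
  have r0 : 0 <= r < 1 by rewrite r2 andbT; lra.
  apply: (Text U).
  - apply: nrm_open => w Uw; exists (dist ((r%:C)%C *: w)); first exact: dist_gt0.
    move=> v vw; apply: (@dist_in ((r%:C)%C *: w)); apply: le_lt_trans vw.
    rewrite -scalerBr nrmZ cmod_real ger0_norm ?ler_piMl ?nrm_ge0//; last by case/andP: r0.
    exact: ltW.
  - by move=> w cw; exact: closure_dilate.
  - move=> w Uw; have [] // := @is_grad_diff _ _ (h m) w _ (is_grad_dilate (hol_grad hf Uw)).
have [ATf _] := TA _ Af; have ATh m : A2O (T (h m)) := TA _ (Ah m).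
have Tc : nconv (fun m => T (h m)) (T f).
  move=> e e0; have M0 : 0 < `|M| + 1 by rewrite ltr_wpDl.
  have k0 : 0 < e / (`|M| + 1) by rewrite divr_gt0.
  have [N HN] := hf' _ k0; exists N => m Nm.
  rewrite (@eq_sqnorm _ (T (fun w => -1 * f w + h m w))); last first.
    by move=> z Oz; rewrite Tlin// mulN1r addrC.
  apply: le_trans (HM _ (A2_comb _ Af (Ah m))) _.
  rewrite (@eq_sqnorm _ (fun z => h m z - f z)); last first.
    by move=> z _; rewrite mulN1r addrC.
  have Ad := A2_sub (Ah m) Af; have := HN m Nm.
  rewrite (A2_nsq Ad) -EFinM !lee_fin ler_pdivlMr// => h1; apply: le_trans h1.
  rewrite mulrC ler_wpM2l ?nsq_ge0//.
  by apply: le_trans (ler_norm M) _; rewrite lerDl.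
have TAf := TA _ Af; split=> // [z Oz|].
  apply: cconv_unique (nconv_radial ATh TAf Oz Tc) _.
  have E : (fun m => radial (T (h m)) z) = (fun m => g z * radial (h m) (phi z)).
    apply/funext => m; have [hT _] := ATh m; have [_ rV _] := radial_volterra (Ah m).
    by rewrite (eq_radial (TE m) hT Oz) (rV z Oz) mulrC.
  rewrite E mulrC; exact: (cconvZ (g z) (nconv_radial Ah Af (Ophi Oz) hf')).
apply: cconv_unique (nconv_point ATh TAf Omega0 Tc) _.
have E : (fun m => T (h m) 0) = fun=> 0.
  by apply/funext => m; rewrite (TE m 0 Omega0); have [] := radial_volterra (Ah m).
rewrite E; exact: cconv_cst.
Qed.

(** By the Littlewood-Paley equivalence, its integral is comparable to the squared
    norm of the image of [f]. *)
Definition sqfun f z : R := dist z ^+ 2 * cmod (radial f (phi z) * g z) ^+ 2.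

Lemma sqfun_ge0 f z : 0 <= sqfun f z.
Proof. by rewrite mulr_ge0 ?sqr_ge0. Qed.

Lemma ctsO_sqfun f : holomorphic_on Omega f -> ctsO (sqfun f).
Proof.
move=> hf; apply: ctsOM; first exact: ctsOX ctsO_dist.
apply: sqr_cmod_ctsO => z Oz; apply: differentiableM; last exact: hg.
apply: differentiable_comp; first exact: hphi.
by apply: hol_radial => //; exact: Ophi.
Qed.

Lemma sqfun_radial f h : (forall z, Omega z -> radial h z = radial f (phi z) * g z) ->
  iO (fun z => dist z ^+ 2 * cmod (radial h z) ^+ 2) = iO (sqfun f).
Proof. by move=> H; apply: eq_iO => z Oz; rewrite H. Qed.

Section kernel.
Variables (K : Cn -> Cn -> C) (e : nat -> Cn -> C).
Hypotheses (HK : bergman_kernel Omega K) (be : orthonormal_basis Omega e).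

Let Ae k : A2O (e k). Proof. by case: be. Qed.

Definition sqsum : \bar R := (\sum_(0 <= k <oo) iO (sqfun (e k)))%E.

(** Monotone convergence and [kernel_radial] at the points [phi z].  The constant
    [c] stays inside the integral to avoid proving the integrand measurable. *)
Lemma sqsum_integral (c : R) : 0 <= c ->
  vintegral Omega (fun z => (c * (dist z ^+ 2 * cmod (g z) ^+ 2 *
    radial_radial_bar K (phi z)))%:E) = (c%:E * sqsum)%E.
Proof.
move=> c0; rewrite /sqsum -nneseriesZl; last first.
  by move=> k _; apply: iO_ge0 => z _; exact: sqfun_ge0.
have cs k := ctsO_sqfun (Ae k).1.
rewrite (eq_eseriesr (g := fun k => (\int[mu]_(x in Ot) (c * sqfun (e k) (pt x))%:E)%E)); last first.
  by move=> k _; rewrite -iOZ// => z _; exact: sqfun_ge0.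
rewrite -integral_nneseries.
- apply: eq_integral => x /set_mem Ox.
  have [cv _] := kernel_radial HK be (Ophi Ox).
  set q := c * (dist (pt x) ^+ 2 * cmod (g (pt x)) ^+ 2).
  have -> : c * (dist (pt x) ^+ 2 * cmod (g (pt x)) ^+ 2 * radial_radial_bar K (phi (pt x))) =
      q * radial_radial_bar K (phi (pt x)) by rewrite /q !mulrA.
  apply/esym/cvg_lim => //.
  rewrite (_ : (fun m => _) =
    (fun m => (q * \sum_(k < m) cmod (radial (e k) (phi (pt x))) ^+ 2)%:E)).
    apply: cvg_EFin; first exact: nearW.
    exact: (cvgM (cvg_cst q) cv).
  apply/funext => m; rewrite big_mkord mulr_sumr -sumEFin; apply: eq_bigr => k _.
  by congr (_%:E); rewrite /q /sqfun cmodM exprMn; ring.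
- exact: measurable_Ot.
- by move=> k; apply: (ctsO_measE (F := fun z => c * sqfun (e k) z)); apply: ctsOM => //; exact: ctsO_cst.
- by move=> k x _; rewrite lee_fin mulr_ge0// sqfun_ge0.
Qed.

Lemma rrb_ge0 w : Omega w -> 0 <= radial_radial_bar K w.
Proof.
move=> Ow; have [cv _] := kernel_radial HK be Ow.
rewrite -(cvg_lim _ cv)//; apply: limr_ge; first exact: cvgP cv.
apply: nearW => m; apply: sumr_ge0 => k _; exact: sqr_ge0.
Qed.

Lemma rrb0 : radial_radial_bar K 0 = 0.
Proof.
have [cv _] := kernel_radial HK be Omega0.
have E : (fun m => \sum_(k < m) cmod (radial (e k) 0) ^+ 2) = fun=> 0.
  apply/funext => m; apply: big1 => k _.
  rewrite radialE (_ : lin _ 0 = 0) ?cmod0 ?expr0n//.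
  by rewrite /lin big1// => j _; rewrite mxE mul0r.
by rewrite E in cv; rewrite -(cvg_lim _ cv)// lim_cst.
Qed.

(** Radial derivatives vanish at the origin, so the points with [phi z = 0] do not
    contribute. *)
Lemma kernel_integralE : kernel_integral Omega K g phi =
  vintegral Omega (fun z => (cmod (g z) ^+ 2 * delta Omega z ^+ 2 *
    radial_radial_bar K (phi z))%:E).
Proof.
rewrite /kernel_integral /vintegral integral_mkcond [RHS]integral_mkcond.
apply: eq_integral => x _; rewrite !patchE.
have [Ox|nO] := pselect (Omega (pt x)); last first.
  by rewrite !memNset// => -[].
rewrite [in RHS]mem_set//; have [p|p] := pselect (phi (pt x) = 0).
  by rewrite memNset; [rewrite p rrb0 mulr0|case].
by rewrite mem_set.
Qed.

(** In this lemma and the next one, [dist <= delta <= n.+1%:R * dist]. *)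
Lemma sqsum_le_kernel : (sqsum <= kernel_integral Omega K g phi)%E.
Proof.
rewrite -[sqsum]mul1e -(sqsum_integral ler01) kernel_integralE; apply: le_integral_ge0 => x Ox.
have r0 := rrb_ge0 (Ophi Ox).
have p0 := mulr_ge0 (mulr_ge0 (sqr_ge0 (dist (pt x))) (sqr_ge0 (cmod (g (pt x))))) r0.
rewrite !lee_fin mul1r p0 /=.
rewrite ler_wpM2r// mulrC ler_wpM2l ?sqr_ge0// lerXn2r ?nnegrE ?dist_ge0 ?delta_ge0//.
exact: dist_le_delta.
Qed.

Lemma kernel_le_sqsum : (kernel_integral Omega K g phi <= (n.+1%:R ^+ 2)%:E * sqsum)%E.
Proof.
rewrite -(sqsum_integral (sqr_ge0 _)) kernel_integralE; apply: le_integral_ge0 => x Ox.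
have r0 := rrb_ge0 (Ophi Ox).
have p0 := mulr_ge0 (mulr_ge0 (sqr_ge0 (cmod (g (pt x)))) (sqr_ge0 (delta Omega (pt x)))) r0.
apply/andP; split; rewrite lee_fin //.
have sq : delta Omega (pt x) ^+ 2 <= n.+1%:R ^+ 2 * dist (pt x) ^+ 2.
  rewrite -exprMn lerXn2r ?nnegrE ?mulr_ge0 ?dist_ge0 ?delta_ge0//.
  exact: delta_le_dist.
move: sq r0; move: (cmod (g (pt x)) ^+ 2) (sqr_ge0 (cmod (g (pt x)))) => G G0.
move: (_ ^+ 2) (_ ^+ 2) (_ ^+ 2) (radial_radial_bar _ _) => p q r s pq s0.
have -> : q * (p * G * s) = G * (q * p) * s by ring.
by rewrite ler_wpM2r// ler_wpM2l.
Qed.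

(** The second part of [kernel_radial], integrated: the norm of the operator is
    bounded by its Hilbert-Schmidt norm. *)
Lemma sqfun_bound f : A2O f -> (iO (sqfun f) <= (nsq f)%:E * sqsum)%E.
Proof.
move=> Af; rewrite -(sqsum_integral (nsq_ge0 f)); apply: le_integral_ge0 => x Ox.
have [_ H] := kernel_radial HK be (Ophi Ox).
rewrite !lee_fin sqfun_ge0 /sqfun cmodM exprMn /=.
have := H f Af; have := rrb_ge0 (Ophi Ox).
move: (radial_radial_bar _ _) (cmod (radial f _) ^+ 2) => s t s0 ts.
have -> : nsq f * (dist (pt x) ^+ 2 * cmod (g (pt x)) ^+ 2 * s) =
  dist (pt x) ^+ 2 * ((nsq f * s) * cmod (g (pt x)) ^+ 2) by ring.
by rewrite ler_wpM2l ?sqr_ge0// ler_wpM2r ?sqr_ge0.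
Qed.

End kernel.

(** The Littlewood-Paley equivalence, applied to [T (e k)] for each [k]. *)
Lemma hs_comparable c c' T e :
  (forall h, holomorphic_on Omega h ->
    (iO (fun z => dist z ^+ 2 * cmod (radial h z) ^+ 2)%R <=
       c%:E * iO (fun z => cmod (h z) ^+ 2)%R)%E) ->
  (forall h, holomorphic_on Omega h -> h 0 = 0 ->
    (iO (fun z => cmod (h z) ^+ 2)%R <=
       c'%:E * iO (fun z => dist z ^+ 2 * cmod (radial h z) ^+ 2)%R)%E) ->
  volterra_extension Omega g phi T -> orthonormal_basis Omega e ->
  (sqsum e <= c%:E * hs_sqnorm Omega e T)%E /\ (hs_sqnorm Omega e T <= c'%:E * sqsum e)%E.
Proof.
move=> Hc Hc' Text be; have Ae k : A2O (e k) by case: be.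
have F0 k : (0 <= iO (sqfun (e k)))%E by apply: iO_ge0 => z _; exact: sqfun_ge0.
have T0 k : xpredT k -> (0 <= sqnorm Omega (T (e k)))%E by move=> _; exact: sqnorm_ge0.
rewrite /hs_sqnorm /sqsum -(nneseriesZl _ _ T0) -(nneseriesZl _ _ (fun k _ => F0 k)); split.
  apply: lee_nneseries => [k _ _|k _]; first exact: F0.
  have [hT RT _] := radial_extension Text (Ae k).
  by rewrite -(sqfun_radial RT) sqnormE; exact: Hc.
apply: lee_nneseries => [k _ _|k _]; first exact: sqnorm_ge0.
have [hT RT Tk0] := radial_extension Text (Ae k).
by rewrite -(sqfun_radial RT) sqnormE; exact: Hc'.
Qed.

(** The Volterra integral converges for every [f] in the Bergman space, so it is its
    own extension; [sqfun_bound] and [lp_upper] bound it. *)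
Lemma volterra_bounded K e : bergman_kernel Omega K -> orthonormal_basis Omega e ->
  (sqsum e < +oo)%E -> volterra_extension Omega g phi V.
Proof.
move=> HK be Soo; have [c c0 Hc] := lp_upper.
have SE : sqsum e = (fine (sqsum e))%:E.
  rewrite fineK// ge0_fin_numE//; apply: nneseries_ge0 => k _ _.
  by apply: iO_ge0 => z _; exact: sqfun_ge0.
set s := fine (sqsum e) in SE.
have HV f : A2O f -> (sqnorm Omega (V f) <= (c * s)%:E * sqnorm Omega f)%E.
  move=> Af; have [hV RV V0] := radial_volterra Af.
  rewrite sqnormE; apply: le_trans (Hc _ hV V0) _; rewrite (sqfun_radial RV) EFinM -muleA.
  apply: lee_wpmul2l; first by rewrite lee_fin ltW.
  by rewrite (A2_nsq Af) muleC -SE; exact: (sqfun_bound HK be Af).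
split=> //; split.
- move=> f Af; split; first by case: (radial_volterra Af).
  by apply: le_lt_trans (HV f Af) _; rewrite (A2_nsq Af) -EFinM ltry.
- by move=> a f h z Af Ah Oz; exact: volterra_linear.
- by exists (c * s).
Qed.

End operator.

(** The constants come from [lp_lower], [lp_upper] and the comparison of [dist] with
    [delta], so they depend on [Omega] alone. *)
Theorem volterra_hilbert_schmidt K : bergman_kernel Omega K ->
  exists c1 c2 : R, [/\ 0 < c1, 0 < c2 & forall g phi,
    holomorphic_on Omega g -> holomorphic_on Omega phi ->
    (forall z, Omega z -> Omega (phi z)) -> phi 0 = 0 ->
    (volterra_in_S2 Omega g phi <-> (kernel_integral Omega K g phi < +oo)%E) /\
    (forall T e, volterra_extension Omega g phi T -> orthonormal_basis Omega e ->
      (c1%:E * kernel_integral Omega K g phi <= hs_sqnorm Omega e T)%E /\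
      (hs_sqnorm Omega e T <= c2%:E * kernel_integral Omega K g phi)%E)].
Proof.
move=> HK; have [c c0 Hc] := lp_lower; have [c' c'0 Hc'] := lp_upper.
have N0 : 0 < n.+1%:R ^+ 2 :> R by rewrite exprn_gt0.
have k0 : 0 < n.+1%:R ^+ 2 * c by rewrite mulr_gt0.
exists (n.+1%:R ^+ 2 * c)^-1, c'; split=> //; first by rewrite invr_gt0.
move=> g phi hg hphi Ophi phi0.
have two T e : volterra_extension Omega g phi T -> orthonormal_basis Omega e ->
    (kernel_integral Omega K g phi <= (n.+1%:R ^+ 2 * c)%:E * hs_sqnorm Omega e T)%E /\
    (hs_sqnorm Omega e T <= c'%:E * kernel_integral Omega K g phi)%E.
  move=> Text be.
  have [h1 h2] := hs_comparable hg hphi Ophi phi0 Hc Hc' Text be; split.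
    apply: le_trans (kernel_le_sqsum hg hphi Ophi HK be) _; rewrite (EFinM _ c) -muleA.
    by apply: lee_wpmul2l => //; rewrite lee_fin ltW.
  apply: le_trans h2 _; apply: lee_wpmul2l; first by rewrite lee_fin ltW.
  exact: sqsum_le_kernel.
split; last first.
  move=> T e Text be; have [h1 h2] := two T e Text be; split=> //.
  by rewrite muleC lee_pdivrMr // muleC.
split=> [[T Text [_ [e be hs]]]|Koo].
  have [h1 _] := two T e Text be; apply: le_lt_trans h1 _.
  by apply: lte_mul_pinfty => //; rewrite ?lee_fin ?ltW.
have [e be] := basis_exists HK.
have Soo : (sqsum g phi e < +oo)%E.
  exact: le_lt_trans (sqsum_le_kernel hg hphi Ophi HK be) Koo.
have Text := volterra_bounded hg hphi Ophi phi0 HK be Soo.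
exists (volterra g phi) => //; split; first by case: Text.
have [_ h2] := two _ e Text be.
suff hs : (hs_sqnorm Omega e (volterra g phi) < +oo)%E by exists e.
apply: le_lt_trans h2 _.
by apply: lte_mul_pinfty => //; rewrite ?lee_fin ?ltW.
Qed.

End domain_geometry.

Theorem mainTheorem5 (R : realType) (n : nat) (Omega : set 'rV[R[i]]_n.+1)
  (Omega_open : open Omega) (Omega_convex : convex_set Omega)
  (Omega_bounded : bounded_set Omega) (Omega0 : Omega 0)
  (Omega_bdry : smooth_finite_type_boundary Omega)
  (K : 'rV[R[i]]_n.+1 -> 'rV[R[i]]_n.+1 -> R[i])
  (K_bergman : bergman_kernel Omega K) :
  exists c1 c2 : R, [/\ 0 < c1, 0 < c2 &
    forall (g : 'rV[R[i]]_n.+1 -> R[i])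
      (phi : 'rV[R[i]]_n.+1 -> 'rV[R[i]]_n.+1),
    holomorphic_on Omega g ->
    holomorphic_on Omega phi -> (forall z, Omega z -> Omega (phi z)) ->
    phi 0 = 0 ->
    locally_finite_on Omega (mu2 Omega g phi) ->
    (volterra_in_S2 Omega g phi <-> (kernel_integral Omega K g phi < +oo)%E) /\
    (forall T e, volterra_extension Omega g phi T ->
      orthonormal_basis Omega e ->
      (c1%:E * kernel_integral Omega K g phi <= hs_sqnorm Omega e T)%E /\
      (hs_sqnorm Omega e T <= c2%:E * kernel_integral Omega K g phi)%E)].
Proof.
have [c1 [c2 [c10 c20 H]]] :=
  volterra_hilbert_schmidt Omega_open Omega_convex Omega_bounded Omega0 K_bergman.
by exists c1, c2; split=> // g phi hg hphi Ophi phi0 _; exact: H.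
Qed.
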